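(* Let $H$ be a separable complex Hilbert space of dimension at least $3$, and let $\mathcal{B}_{sa}(H)$ be the set of bounded self-adjoint operators on $H$. Let $\Phi\colon \mathcal{B}_{sa}(H) \to \mathcal{B}_{sa}(H)$ be a bijective map that satisfies $$B \preceq A \iff \Phi(B) \preceq \Phi(A) \qquad (A,B\in \mathcal{B}_{sa}(H)).$$ In the case when $\dim H = \aleph_0$, assume further that $\Phi$ is continuous with respect to a unitary-antiunitarily invariant vector topology $\mathcal{T}$ on $\mathcal{B}_{sa}(H)$ in which the set $\{A\in\mathcal{B}_{sa}(H)\colon\#\sigma(A)<\infty\}$ is dense. Then there exist an operator $U\colon H\to H$ that is either unitary or antiunitary and a positive number $\alpha$ such that $$\Phi\left([A]_{v}\right) = [\alpha UAU^*]_{v} \qquad (A\in\mathcal{B}_{sa}(H)),$$ where $[A]_v$ denotes the variance-equivalence class of $A$ and $\Phi([A]_v)$ denotes the image of the set $[A]_v$ under $\Phi$.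
   Context: For a unit vector $x\in H$ and $A\in\mathcal{B}_{sa}(H)$, the variance is $\Delta_x(A) := \langle A^2x, x\rangle - \langle Ax, x\rangle^2$. The variance order: for $A,B\in\mathcal{B}_{sa}(H)$, write $A\preceq B$ (equivalently $B\succeq A$) if and only if $\Delta_x(A)\le\Delta_x(B)$ for all unit vectors $x\in H$. The variance-equivalence class of $A$ is the set $[A]_v := \{B\in\mathcal{B}_{sa}(H)\colon A\preceq B \text{ and } B\preceq A\}$. $\sigma(A)$ is the spectrum of $A$ and $\#$ denotes cardinality. An antiunitary operator is a bijective conjugate-linear isometry of $H$; for it $U^*=U^{-1}$. A topology $\mathcal{T}$ on $\mathcal{B}_{sa}(H)$ is called a unitary-antiunitarily invariant vector topology if $(\mathcal{B}_{sa}(H),\mathcal{T})$ is a real Hausdorff topological vector space such that the map $A\mapsto U^*AU$ is a homeomorphism of $(\mathcal{B}_{sa}(H),\mathcal{T})$ for every unitary and every antiunitary operator $U\colon H\to H$. Continuity of $\Phi$ is as a map from $(\mathcal{B}_{sa}(H),\mathcal{T})$ to itself. *)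

(* Defs.v *)
From HB Require Import structures.
From mathcomp Require Import all_boot all_order all_algebra complex ring.
From mathcomp Require Import all_classical all_reals all_analysis.

Set Implicit Arguments.
Unset Strict Implicit.
Unset Printing Implicit Defensive.

Import Order.TTheory GRing.Theory Num.Theory.
Import numFieldNormedType.Exports.

Local Open Scope classical_set_scope.
Local Open Scope ring_scope.
Local Open Scope complex_scope.

(* As in [sesquilinear], [inner] is linear in its first argument and
   conjugate-linear in its second one. *)
HB.mixin Record CompleteNormedModule_isHilbert (R : realType) H
    of CompleteNormedModule R[i] H := {
  inner : {dot H for @Num.conj R[i]} ;
  hilbert_normE : forall x : H, `|x| ^+ 2 = inner x x
}.

#[short(type="hilbertType")]
HB.structure Definition Hilbert (R : realType) :=
  {H of CompleteNormedModule R[i] H & CompleteNormedModule_isHilbert R H}.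

Lemma eq_conj_of_sums (C : numClosedFieldType) (d d' : C) :
  d' + Num.conj d' = d + Num.conj d ->
  Num.conj 'i%R * d' + Num.conj (Num.conj 'i%R * d') =
    'i%R * d + Num.conj ('i%R * d) ->
  d' = Num.conj d.
Proof.
move=> e1; rewrite !rmorphM /= !conjCi rmorphN /= conjCi opprK !mulNr.
rewrite addrC -!mulrBr => /(mulfI (neq0Ci _)) e2.
apply: (@mulfI _ 2); first by rewrite pnatr_eq0.
rewrite !mulr_natl !mulr2n.
have -> : d' + d' = (d' + Num.conj d') - (Num.conj d' - d').
  by ring.
by rewrite e1 e2; ring.
Qed.

Section Operators.
Variables (R : realType) (H : hilbertType R).
Implicit Types (A B : H -> H) (x y : H) (l : R[i]).

Definition separable := exists S : set H, countable S /\ dense S.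

Definition linear_span (E : set H) : set H :=
  [set x | exists n (e : 'I_n -> H) (c : 'I_n -> R[i]),
    (forall i, E (e i)) /\ x = \sum_i c i *: e i].

Definition orthonormal_basis (E : set H) : Prop :=
  (forall e f, E e -> E f -> inner e f = (e == f)%:R) /\
  closure (linear_span E) = setT.

(* The dimension meant here is the Hilbert dimension: the cardinality of an
   orthonormal basis. *)
Definition dim_ge (n : nat) : Prop :=
  exists E : set H, orthonormal_basis E /\ (`I_n #<= E)%card.

Definition dim_aleph0 : Prop :=
  exists E : set H, orthonormal_basis E /\ (E #= [set: nat])%card.

Definition bounded_operator A : Prop :=
  linear A /\ exists M : R, forall x, `|A x| <= M%:C * `|x|.

Definition selfadjoint A : Prop := forall x y, inner (A x) y = inner x (A y).

Definition bsa_pred : pred (H -> H) :=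
  fun A => `[< bounded_operator A /\ selfadjoint A >].

Record bsa := Bsa { bsa_fun :> H -> H ; bsaP : bsa_fun \in bsa_pred }.

HB.instance Definition _ := [isSub for bsa_fun].
HB.instance Definition _ := [Choice of bsa by <:].

Lemma bsa_predP A :
  reflect (bounded_operator A /\ selfadjoint A) (A \in bsa_pred).
Proof. exact: asboolP. Qed.

Lemma bsa_zmod_closed : zmod_closed bsa_pred.
Proof.
split=> [|A B /bsa_predP[[lA [M hM]] sA] /bsa_predP[[lB [N hN]] sB]];
  apply/bsa_predP; split.
- split; first by move=> a x y /=; rewrite scaler0 addr0.
  by exists 0 => x; rewrite /= normr0 mul0r.
- by move=> x y /=; rewrite linear0l linear0r.
- split.
    move=> a x y; rewrite /= /GRing.add /GRing.opp /= lA lB.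
    by rewrite scalerBr opprD addrACA.
  exists (M + N) => x.
  rewrite rmorphD mulrDl (le_trans (ler_normB _ _)) // lerD //.
- by move=> x y; rewrite /= linearBl /= linearBr /= sA sB.
Qed.

HB.instance Definition _ := GRing.isZmodClosed.Build _ bsa_pred bsa_zmod_closed.
HB.instance Definition _ := [SubChoice_isSubZmodule of bsa by <:].

Fact bsa_scale_subproof (a : R) (A : bsa) :
  (fun x => a%:C *: A x) \in bsa_pred.
Proof.
have /bsa_predP[[lA [M hM]] sA] := bsaP A; apply/bsa_predP; split; first split.
- by move=> b x y /=; rewrite lA scalerDr !scalerA mulrC.
- exists (`|a| * M) => x /=.
  rewrite normrZ rmorphM -mulrA normc_def /= expr0n addr0 sqrtr_sqr.
  by apply: ler_wpM2l; rewrite ?ler0c.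
- move=> x y /=; rewrite linearZl_LR linearZr_LR /= sA; congr (_ * _).
  by apply/esym/CrealP; rewrite complex_real.
Qed.

Definition bsa_scale (a : R) (A : bsa) : bsa := Bsa (bsa_scale_subproof a A).

Fact bsa_scaleA (a b : R) (A : bsa) : bsa_scale a (bsa_scale b A) = bsa_scale (a * b) A.
Proof. by apply/val_inj/funext => x /=; rewrite scalerA rmorphM. Qed.

Fact bsa_scale1 : left_id 1 bsa_scale.
Proof. by move=> A; apply/val_inj/funext => x /=; rewrite scale1r. Qed.

Fact bsa_scaleDr : right_distributive bsa_scale +%R.
Proof. by move=> a A B; apply/val_inj/funext => x /=; rewrite scalerDr. Qed.

Fact bsa_scaleDl (A : bsa) : {morph bsa_scale^~ A : a b / a + b}.
Proof.
by move=> a b; apply/val_inj/funext => x /=; rewrite rmorphD /= scalerDl.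
Qed.

HB.instance Definition _ := GRing.Zmodule_isLmodule.Build R bsa
  bsa_scaleA bsa_scale1 bsa_scaleDr bsa_scaleDl.

Definition spectrum (A : H -> H) : set R[i] :=
  [set l | ~ exists B : H -> H, [/\ bounded_operator B,
     cancel (fun x => A x - l *: x) B & cancel B (fun x => A x - l *: x)]].

(* For a self-adjoint [A] this is a real number, and [<=] on [R[i]] restricted
   to real numbers is the order of [R]. *)
Definition variance (x : H) (A : bsa) : R[i] :=
  inner (A (A x)) x - inner (A x) x ^+ 2.

Definition vle (A B : bsa) : Prop :=
  forall x : H, `|x| = 1 -> variance x A <= variance x B.

Definition vclass (A : bsa) : set bsa := [set B | vle A B /\ vle B A].

(* [V] plays the role of [U^*]. *)
Definition unitary (U V : H -> H) : Prop :=
  [/\ linear U, forall x y, inner (U x) y = inner x (V y),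
      cancel U V & cancel V U].

(* Here [U^*] is by convention the inverse [V] of [U]. *)
Definition antiunitary (U V : H -> H) : Prop :=
  [/\ forall l x y, U (l *: x + y) = Num.conj l *: U x + U y,
      forall x, `|U x| = `|x|, cancel U V & cancel V U].

Record unitary_or_antiunitary := UnitaryOrAntiunitary {
  ua_fun :> H -> H ;
  ua_adj_fun : H -> H ;
  uaP : unitary ua_fun ua_adj_fun \/ antiunitary ua_fun ua_adj_fun
}.

Lemma unitary_norm U V : unitary U V -> forall x, `|U x| = `|x|.
Proof.
move=> [_ UV UK _] x; apply/eqP; rewrite -(@eqrXn2 _ 2) //.
by rewrite !hilbert_normE UV UK.
Qed.

Lemma unitary_adj U V : unitary U V -> unitary V U.
Proof.
move=> [lU UV UK VK]; split=> //.
- by move=> l x y; apply: (can_inj UK); rewrite lU !VK.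
- by move=> x y; rewrite -{1}(UK y) -UV VK.
Qed.

Lemma antiunitary_adj U V : antiunitary U V -> antiunitary V U.
Proof.
move=> [lU nU UK VK]; split=> //.
- by move=> l x y; apply: (can_inj UK); rewrite lU !VK conjCK.
- by move=> x; rewrite -{2}(VK x) nU.
Qed.

Lemma antiunitary_inner U V : antiunitary U V ->
  forall x y, inner (U x) (U y) = inner y x.
Proof.
move=> [lU nU _ _].
have UD x y : U (x + y) = U x + U y.
  by rewrite -[x in LHS]scale1r lU rmorph1 scale1r.
have U0 : U 0 = 0 by apply: (addIr (U 0)); rewrite -UD !add0r.
have UZ l x : U (l *: x) = Num.conj l *: U x.
  by rewrite -[_ *: x]addr0 lU U0 addr0.
have pol x y : inner (U x) (U y) + Num.conj (inner (U x) (U y)) =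
               inner x y + Num.conj (inner x y).
  have := hilbert_normE (U (x + y)).
  rewrite nU hilbert_normE UD !dnormD -!hilbert_normE !nU.
  by move/addrI => ->.
move=> x y; rewrite [RHS]hermC expr0 mul1r.
apply: eq_conj_of_sums (pol x y) _.
by have := pol (@Num.imaginary R[i] *: x) y; rewrite UZ !linearZl_LR.
Qed.

Definition ua_adj (U : unitary_or_antiunitary) : unitary_or_antiunitary :=
  UnitaryOrAntiunitary
    (match uaP U with
     | or_introl h => or_introl (unitary_adj h)
     | or_intror h => or_intror (antiunitary_adj h)
     end).

Fact bsa_conj_subproof (U : unitary_or_antiunitary) (A : bsa) :
  (fun x => U (A (ua_adj U x))) \in bsa_pred.
Proof.
have /bsa_predP[[lA [M hM]] sA] := bsaP A.
case: U => U V /= [hU|hU]; apply/bsa_predP; (split; first split).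
- have [lU _ _ _] := hU; have [lV _ _ _] := unitary_adj hU.
  by move=> l x y /=; rewrite lV lA lU.
- exists M => x; rewrite (unitary_norm hU).
  by rewrite -[in leRHS](unitary_norm (unitary_adj hU) x).
- have [_ UV _ _] := hU; have [_ VU _ _] := unitary_adj hU.
  by move=> x y; rewrite UV sA VU.
- have [lU _ _ _] := hU; have [lV _ _ _] := antiunitary_adj hU.
  by move=> l x y /=; rewrite lV lA lU conjCK.
- have [_ nU _ _] := hU; have [_ nV _ _] := antiunitary_adj hU.
  by exists M => x; rewrite nU -[in leRHS]nV.
- have [_ _ _ VK] := hU => x y /=.
  rewrite -[y in LHS]VK (antiunitary_inner hU) -sA.
  by rewrite -[x in RHS]VK (antiunitary_inner hU).
Qed.

Definition bsa_conj (U : unitary_or_antiunitary) (A : bsa) : bsa :=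
  Bsa (bsa_conj_subproof U A).

Definition homeomorphism (X Y : topologicalType) (f : X -> Y) : Prop :=
  exists g : Y -> X, [/\ cancel f g, cancel g f, continuous f & continuous g].

(* A term of type [Topological bsa] is a topology on [bsa]. *)
Definition vector_topology (T : Topological bsa) : Prop :=
  let X : topologicalType := Topological.Pack T in
  [/\ hausdorff_space X,
      continuous ((fun p => (p.1 : bsa) + (p.2 : bsa)) : X * X -> X) &
      continuous ((fun p => (p.1 : R) *: (p.2 : bsa)) : R^o * X -> X)].

Definition ua_invariant_vector_topology (T : Topological bsa) : Prop :=
  let X : topologicalType := Topological.Pack T in
  vector_topology T /\
  forall U : unitary_or_antiunitary,
    @homeomorphism X X (bsa_conj (ua_adj U)).

End Operators.

Arguments separable {R} H.
Arguments dim_ge {R} H n.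
Arguments dim_aleph0 {R} H.
Arguments bsa {R} H.
Arguments unitary_or_antiunitary {R} H.

(* Main.v *)
(* If [A <= C] in the variance order, then [A] lies in the double commutant of
   [C]: Bernstein polynomials in [C] cut [C] into approximate spectral pieces,
   and on a piece where [C] is nearly scalar so is [A].  Hence two operators
   with a common upper bound commute; conversely a projection and an operator
   commuting with it have a common upper bound.

   The operators whose down-set is a chain are, up to equivalence, the multiples
   of projections, and commutation singles out the rank-one projections among
   them (up to complements).  So [Phi] induces a bijection between lines that
   preserves orthogonality in both directions; by Uhlhorn's theorem it is given
   by a unitary or antiunitary [U].  After composition with the conjugation by
   [U^-1], [A] and [Phi A] have the same eigenvectors, because [x] is an
   eigenvector of [A] iff [A] and the projection onto [x] have a common upper
   bound.

   Comparing upper bounds of multiples of three orthogonal projections gives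
   [Phi (t P) ~ alpha t P] with one [alpha] for all [P].  Once [alpha] is
   normalised to [1], comparing upper bounds of an operator and of multiples of
   its spectral projections shows [Phi A = A + c] or [Phi A = - A + c] whenever
   [A] has finite spectrum.  By density this holds for all [A], since the line of
   scalar operators is closed. *)

Require Import Defs.
From HB Require Import structures.
From mathcomp Require Import all_boot all_order all_algebra complex.
From mathcomp Require Import all_classical all_reals all_analysis.
From mathcomp Require Import ring lra.

Set Implicit Arguments.
Unset Strict Implicit.
Unset Printing Implicit Defensive.

Import Order.TTheory GRing.Theory Num.Theory.
Import numFieldNormedType.Exports.

Local Open Scope classical_set_scope.
Local Open Scope ring_scope.

(** The order sees an operator only up to sign and real scalar shifts. Hence the sign and the
    constant [c] found at the end may depend on [A] with no coherence to be shown: both vanish in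
    the variance class. The variance of [A] at [x] measures how far [x] is from being an
    eigenvector, so each comparison of operators is turned into one about eigenvectors, exact or
    approximate. No spectral theorem is used: positive polynomials in one operator stand in for
    spectral projections, and for finite spectrum Lagrange polynomials produce them. The multiples
    of a single projection form a chain, whose order any increasing bijection preserves. Linearity
    of the amplitude is therefore invisible on one projection; it appears only with three orthogonal
    ones, where the gaps between levels add up. Dimension three also excludes [pr x = 1 - pr y],
    which the order could not tell apart, and makes Uhlhorn's argument possible. Continuity enters
    only in infinite dimension, where operators of infinite spectrum exist. *)

Section RealInner.
Variables (R : realType) (H : hilbertType R).
Implicit Types (x y z : H) (c : R[i]) (t : R) (A B C : bsa H).

(** * Real-valued norm and inner product; the homogeneous variance *)

Definition nr x : R := complex.Re `|x|.
Definition rip x y : R := complex.Re (inner x y).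

Lemma innerC x y : inner x y = Num.conj (inner y x).
Proof. by rewrite hermC expr0 mul1r. Qed.

Lemma innerDl x y z : inner (x + y) z = inner x z + inner y z.
Proof. by rewrite linearDl. Qed.
Lemma innerDr x y z : inner x (y + z) = inner x y + inner x z.
Proof. by rewrite linearDr. Qed.
Lemma innerNl x y : inner (- x) y = - inner x y.
Proof. by rewrite linearNl. Qed.
Lemma innerNr x y : inner x (- y) = - inner x y.
Proof. by rewrite linearNr. Qed.
Lemma innerBl x y z : inner (x - y) z = inner x z - inner y z.
Proof. by rewrite linearBl. Qed.
Lemma innerBr x y z : inner x (y - z) = inner x y - inner x z.
Proof. by rewrite linearBr. Qed.
Lemma inner0l y : inner 0 y = 0.
Proof. by rewrite linear0l. Qed.
Lemma inner0r x : inner x 0 = 0.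
Proof. by rewrite linear0r. Qed.
Lemma innerZl c x y : inner (c *: x) y = c * inner x y.
Proof. by rewrite linearZl_LR. Qed.
Lemma innerZr c x y : inner x (c *: y) = Num.conj c * inner x y.
Proof. by rewrite linearZr_LR. Qed.

Lemma conjR t : Num.conj (t%:C)%C = (t%:C)%C.
Proof. by apply/CrealP; rewrite complex_real. Qed.

Lemma ReMr t c : complex.Re ((t%:C)%C * c) = t * complex.Re c.
Proof. by case: c => a b; rewrite /= mul0r subr0. Qed.

Lemma Re_conj c : complex.Re (Num.conj c) = complex.Re c.
Proof. by case: c. Qed.

Lemma ReD c d : complex.Re (c + d) = complex.Re c + complex.Re d.
Proof. by case: c; case: d. Qed.

Lemma ReN c : complex.Re (- c) = - complex.Re c.
Proof. by case: c. Qed.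

Lemma ripC x y : rip x y = rip y x.
Proof. by rewrite /rip innerC Re_conj. Qed.

Lemma ripDl x y z : rip (x + y) z = rip x z + rip y z.
Proof. by rewrite /rip innerDl ReD. Qed.
Lemma ripDr x y z : rip x (y + z) = rip x y + rip x z.
Proof. by rewrite /rip innerDr ReD. Qed.
Lemma ripNl x y : rip (- x) y = - rip x y.
Proof. by rewrite /rip innerNl ReN. Qed.
Lemma ripNr x y : rip x (- y) = - rip x y.
Proof. by rewrite /rip innerNr ReN. Qed.
Lemma ripBl x y z : rip (x - y) z = rip x z - rip y z.
Proof. by rewrite ripDl ripNl. Qed.
Lemma ripBr x y z : rip x (y - z) = rip x y - rip x z.
Proof. by rewrite ripDr ripNr. Qed.
Lemma rip0l y : rip 0 y = 0.
Proof. by rewrite /rip inner0l. Qed.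
Lemma rip0r x : rip x 0 = 0.
Proof. by rewrite /rip inner0r. Qed.
Lemma ripZl t x y : rip ((t%:C)%C *: x) y = t * rip x y.
Proof. by rewrite /rip innerZl ReMr. Qed.
Lemma ripZr t x y : rip x ((t%:C)%C *: y) = t * rip x y.
Proof. by rewrite ripC ripZl ripC. Qed.
Definition ripE := (ripDl, ripDr, ripNl, ripNr, ripZl, ripZr, rip0l, rip0r).

Lemma rip_suml I (r : seq I) (P : pred I) (F : I -> H) y :
  rip (\sum_(i <- r | P i) F i) y = \sum_(i <- r | P i) rip (F i) y.
Proof.
elim/big_rec2: _ => [|i s x _ <-]; first by rewrite rip0l.
by rewrite ripDl.
Qed.

Lemma Re_ge0C c : 0 <= c -> c = ((complex.Re c)%:C)%C.
Proof. by move/ger0_real => h; rewrite RRe_real. Qed.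

Lemma Re_norm_ge0 c : 0 <= complex.Re `|c|.
Proof. by have := normr_ge0 c; rewrite {1}(Re_ge0C (normr_ge0 c)) ler0c. Qed.

Lemma nrE x : `|x| = ((nr x)%:C)%C.
Proof. by apply: Re_ge0C; apply: normr_ge0. Qed.

Lemma nr_ge0 x : 0 <= nr x.
Proof. by rewrite -ler0c -nrE. Qed.

Lemma inner_xx x : inner x x = ((nr x ^+ 2)%:C)%C.
Proof. by rewrite -hilbert_normE nrE rmorphXn. Qed.

Lemma ripxx x : rip x x = nr x ^+ 2.
Proof. by rewrite /rip inner_xx. Qed.

Lemma rip_ge0 x : 0 <= rip x x.
Proof. by rewrite ripxx sqr_ge0. Qed.

Lemma nr0 : nr 0 = 0.
Proof. by rewrite /nr normr0. Qed.

Lemma nr_eq0 x : (nr x == 0) = (x == 0).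
Proof. by rewrite -[x == 0]normr_eq0 nrE -(inj_eq (@complexI _)). Qed.

Lemma nr_gt0 x : (0 < nr x) = (x != 0).
Proof. by rewrite lt_def nr_ge0 andbT nr_eq0. Qed.

Lemma rip_eq0 x : (rip x x == 0) = (x == 0).
Proof. by rewrite ripxx sqrf_eq0 nr_eq0. Qed.

Lemma nr_triangle x y : nr (x + y) <= nr x + nr y.
Proof. by rewrite -lecR rmorphD /= -!nrE ler_normD. Qed.

Lemma nrN x : nr (- x) = nr x.
Proof. by rewrite /nr normrN. Qed.

Lemma nrB x y : nr (x - y) <= nr x + nr y.
Proof. by rewrite -[nr y]nrN nr_triangle. Qed.

Lemma nrCZ c x : nr (c *: x) = complex.Re `|c| * nr x.
Proof.
apply: (@complexI R).
by rewrite -nrE normrZ nrE rmorphM /= -Re_ge0C // normr_ge0.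
Qed.

Lemma normCR t : `|(t%:C)%C| = (`|t|%:C)%C.
Proof. by rewrite normc_def /= expr0n addr0 sqrtr_sqr. Qed.

Lemma nrZ t x : nr ((t%:C)%C *: x) = `|t| * nr x.
Proof. by rewrite nrCZ normCR. Qed.

Lemma nr_sum (I : finType) (F : I -> H) : nr (\sum_i F i) <= \sum_i nr (F i).
Proof.
elim/big_rec2: _ => [|i s x _ h]; first by rewrite nr0.
by rewrite (le_trans (nr_triangle _ _)) // lerD2l.
Qed.

Lemma sqnrD x y : nr (x + y) ^+ 2 = nr x ^+ 2 + nr y ^+ 2 + 2 * rip x y.
Proof. rewrite -!ripxx !ripE [rip y x]ripC; ring. Qed.

Lemma sqnrB x y : nr (x - y) ^+ 2 = nr x ^+ 2 + nr y ^+ 2 - 2 * rip x y.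
Proof. by rewrite sqnrD nrN ripNr mulrN. Qed.

Lemma rip_CS2 x y : rip x y ^+ 2 <= nr x ^+ 2 * nr y ^+ 2.
Proof.
have [->|y0] := eqVneq y 0; first by rewrite rip0r nr0 expr0n mulr0.
have := rip_ge0 (((nr y ^+ 2)%:C)%C *: x - ((rip x y)%:C)%C *: y).
rewrite !ripE [rip y x]ripC !ripxx => h.
have p : 0 < nr y ^+ 2 by rewrite exprn_gt0 // nr_gt0.
by rewrite -(ler_pM2l p); nra.
Qed.

Lemma rip_CS x y : `|rip x y| <= nr x * nr y.
Proof.
rewrite -(@ler_pXn2r _ 2) ?nnegrE ?mulr_ge0 ?nr_ge0 //.
by rewrite real_normK ?num_real // exprMn rip_CS2.
Qed.

(* Cauchy-Schwarz for the complex product follows from the real one after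
   multiplying [y] by the phase of the product. *)
Lemma inner_CS x y : complex.Re `|inner x y| <= nr x * nr y.
Proof.
set c := inner x y.
have [c0|c0] := eqVneq c 0; first by rewrite c0 normr0 mulr_ge0 ?nr_ge0.
have n0 : `|c| != 0 by rewrite normr_eq0.
have := rip_CS x ((c / `|c|) *: y).
rewrite nrCZ normf_div normr_id divff // mul1r /rip innerZr -/c.
have -> : Num.conj (c / `|c|) * c = `|c|.
  rewrite rmorphM /= fmorphV /= conj_normC mulrAC [_ * c]mulrC -normCK expr2.
  by rewrite mulfK.
by rewrite [X in X <= _]ger0_norm // Re_norm_ge0.
Qed.

Lemma bsaL A : linear A.
Proof. by have /bsa_predP[[]] := bsaP A. Qed.
Lemma bsaS A x y : inner (A x) y = inner x (A y).
Proof. by have /bsa_predP[_] := bsaP A; apply. Qed.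
Lemma bsa_bound A : exists2 M : R, 0 < M & forall x, nr (A x) <= M * nr x.
Proof.
have /bsa_predP[[_ [M hM]] _] := bsaP A.
exists (`|M| + 1); first by rewrite ltr_wpDl.
move=> x; rewrite -lecR rmorphM /= -!nrE (le_trans (hM x)) // ler_wpM2r //.
by rewrite lecR (le_trans (ler_norm M)) // lerDl.
Qed.

Lemma bsaS_rip A x y : rip (A x) y = rip x (A y).
Proof. by rewrite /rip bsaS. Qed.

Lemma bsa0r A : A 0 = 0.
Proof. by have := bsaL A (-1) 0 0; rewrite scaler0 addr0 scaleN1r addNr. Qed.
Lemma bsaDr A x y : A (x + y) = A x + A y.
Proof. by have := bsaL A 1 x y; rewrite !scale1r. Qed.
Lemma bsaZr A c x : A (c *: x) = c *: A x.
Proof. by have := bsaL A c x 0; rewrite bsa0r !addr0. Qed.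
Lemma bsaNr A x : A (- x) = - A x.
Proof. by rewrite -scaleN1r bsaZr scaleN1r. Qed.
Lemma bsaBr A x y : A (x - y) = A x - A y.
Proof. by rewrite bsaDr bsaNr. Qed.
Lemma bsa_sumr A I (r : seq I) (P : pred I) (F : I -> H) :
  A (\sum_(i <- r | P i) F i) = \sum_(i <- r | P i) A (F i).
Proof.
elim/big_rec2: _ => [|i s x _ <-]; first by rewrite bsa0r.
by rewrite bsaDr.
Qed.

Lemma bsaDE A B x : (A + B) x = A x + B x. Proof. by []. Qed.
Lemma bsaBE A B x : (A - B) x = A x - B x. Proof. by []. Qed.
Lemma bsa0E x : (0 : bsa H) x = 0. Proof. by []. Qed.
Lemma bsaZE t A x : (t *: A) x = (t%:C)%C *: A x. Proof. by []. Qed.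
Lemma bsa_sumE I (r : seq I) (P : pred I) (F : I -> bsa H) x :
  (\sum_(i <- r | P i) F i) x = \sum_(i <- r | P i) F i x.
Proof. by elim/big_rec2: _ => [|i s y _ <-]. Qed.
Lemma bsa_ext A B : (forall x, A x = B x) -> A = B.
Proof. by move=> h; apply/val_inj/funext. Qed.

Lemma inner_bsa_xx A x : inner (A x) x = ((rip (A x) x)%:C)%C.
Proof.
rewrite /rip RRe_real //; apply/CrealP.
by rewrite -[LHS]innerC -bsaS.
Qed.


Fact bsa_one_subproof : (id : H -> H) \in @bsa_pred R H.
Proof.
apply/bsa_predP; split=> //; split=> //.
by exists 1 => x; rewrite mul1r.
Qed.

Definition bsa_one : bsa H := Bsa bsa_one_subproof.
Lemma bsa_oneE x : bsa_one x = x. Proof. by []. Qed.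

(** The Gram determinant of [x] and [A x]. Being homogeneous of degree four, it lets the order be
    tested on sums such as [u + v] without normalising. *)
Definition hvar x A : R := nr x ^+ 2 * nr (A x) ^+ 2 - rip (A x) x ^+ 2.

Lemma varianceE x A : nr x = 1 -> Defs.variance x A = ((hvar x A)%:C)%C.
Proof.
move=> h; rewrite /Defs.variance /hvar h expr1n mul1r bsaS inner_xx inner_bsa_xx.
by rewrite -rmorphXn -rmorphB.
Qed.

Lemma hvarZ t x A : hvar ((t%:C)%C *: x) A = t ^+ 4 * hvar x A.
Proof.
rewrite /hvar bsaZr !nrZ !ripE !exprMn !real_normK ?num_real //; ring.
Qed.

Lemma vleP A B : vle A B <-> forall x, hvar x A <= hvar x B.
Proof.
split=> h x; last first.
  by rewrite nrE => /complexI nx; rewrite !varianceE // lecR.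
have [->|x0] := eqVneq x 0.
  by rewrite /hvar !bsa0r !rip0l.
have n0 : 0 < nr x by rewrite nr_gt0.
have e : x = ((nr x)%:C)%C *: (((nr x)^-1%:C)%C *: x).
  by rewrite scalerA -rmorphM /= divff ?gt_eqF // scale1r.
rewrite e 2!(hvarZ (nr x)) ler_pM2l ?exprn_gt0 //.
have n1 : nr (((nr x)^-1%:C)%C *: x) = 1.
  by rewrite nrZ gtr0_norm ?invr_gt0 // mulVf ?gt_eqF.
have := h (((nr x)^-1%:C)%C *: x); rewrite nrE n1 => /(_ erefl).
by rewrite !(varianceE _ n1) lecR.
Qed.

Lemma vle_refl A : vle A A.
Proof. by apply/vleP. Qed.
Lemma vle_trans B A C : vle A B -> vle B C -> vle A C.
Proof.
by move=> /vleP h1 /vleP h2; apply/vleP => x; apply: le_trans (h2 x).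
Qed.

Lemma hvar_aff x A t s : hvar x (t *: A + s *: bsa_one) = t ^+ 2 * hvar x A.
Proof.
rewrite /hvar bsaDE !bsaZE bsa_oneE sqnrD !nrZ !exprMn !real_normK ?num_real //.
rewrite !ripE -ripxx; ring.
Qed.

Lemma hvar_scale x A t : hvar x (t *: A) = t ^+ 2 * hvar x A.
Proof. by rewrite -(hvar_aff _ _ _ 0) scale0r addr0. Qed.

Lemma hvar_shift x A s : hvar x (A + s *: bsa_one) = hvar x A.
Proof. by rewrite -[A]scale1r hvar_aff expr1n mul1r scale1r. Qed.

Lemma hvar_ge0 x A : 0 <= hvar x A.
Proof. by rewrite /hvar subr_ge0 mulrC rip_CS2. Qed.

Lemma hvar_scalar x s : hvar x (s *: bsa_one) = 0.
Proof.
rewrite -[s *: _]add0r hvar_shift /hvar bsa0E nr0 rip0l expr0n mulr0.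
by rewrite subrr.
Qed.

Lemma hvar0 x : hvar x 0 = 0.
Proof. by rewrite -(hvar_scalar x 0) scale0r. Qed.

(* [hvar x A / |x|^2] is the least value of [|A x - s x|^2]. *)
Lemma hvar_le x A s :
  hvar x A <= nr x ^+ 2 * nr (A x - (s%:C)%C *: x) ^+ 2.
Proof.
rewrite sqnrB nrZ exprMn real_normK ?num_real // ripZr /hvar -subr_ge0.
have -> : nr x ^+ 2 * (nr (A x) ^+ 2 + s ^+ 2 * nr x ^+ 2 -
  2 * (s * rip (A x) x)) - (nr x ^+ 2 * nr (A x) ^+ 2 - rip (A x) x ^+ 2) =
  (s * nr x ^+ 2 - rip (A x) x) ^+ 2 by ring.
exact: sqr_ge0.
Qed.

Lemma hvarE x A : x != 0 ->
  hvar x A =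
  nr x ^+ 2 * nr (A x - ((rip (A x) x / nr x ^+ 2)%:C)%C *: x) ^+ 2.
Proof.
rewrite -nr_eq0 => x0; rewrite sqnrB nrZ exprMn real_normK ?num_real //.
by rewrite ripZr /hvar; field.
Qed.

Definition eigv A x := exists s : R, A x = (s%:C)%C *: x.

(** The equality case of Cauchy-Schwarz for [x] and [A x]; it makes eigenvectors visible to the
    order. *)
Lemma hvar_eig A x : hvar x A = 0 <-> eigv A x.
Proof.
split=> [|[s e]]; last first.
  by rewrite /hvar e nrZ exprMn real_normK ?num_real // ripZl -ripxx; ring.
have [->|x0] := eqVneq x 0; first by exists 0; rewrite bsa0r scaler0.
rewrite hvarE // => /eqP; rewrite mulf_eq0 !sqrf_eq0 !nr_eq0 (negPf x0) /=.
by rewrite subr_eq0 => /eqP e; exists (rip (A x) x / nr x ^+ 2).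
Qed.

Lemma vle_eig A B x : vle A B -> eigv B x -> eigv A x.
Proof.
move=> /vleP/(_ x) h /hvar_eig e; apply/hvar_eig/le_anti.
by rewrite hvar_ge0 -e h.
Qed.

(** This test vector turns an inequality between operators into one between gaps of eigenvalues. *)
Lemma hvar_eig2 A u v a b : inner u v = 0 -> nr u = 1 -> nr v = 1 ->
  A u = (a%:C)%C *: u -> A v = (b%:C)%C *: v -> hvar (u + v) A = (a - b) ^+ 2.
Proof.
move=> uv nu nv Au Av.
have r : rip u v = 0 by rewrite /rip uv.
rewrite /hvar bsaDr Au Av !sqnrD !nrZ !exprMn !real_normK ?num_real //.
rewrite !ripE [rip v u]ripC r !ripxx nu nv; ring.
Qed.

Definition veq A B := vle A B /\ vle B A.

Lemma veqP A B : veq A B <-> forall x, hvar x A = hvar x B.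
Proof.
split=> [[/vleP h1 /vleP h2] x|h].
  by apply/le_anti; rewrite h1 h2.
by split; apply/vleP => x; rewrite h.
Qed.
Lemma veq_refl A : veq A A. Proof. by split; apply: vle_refl. Qed.
Lemma veq_sym A B : veq A B -> veq B A. Proof. by case. Qed.
Lemma veq_trans B A C : veq A B -> veq B C -> veq A C.
Proof. by move=> [? ?] [? ?]; split; apply: (@vle_trans B). Qed.
Lemma veq_scale t A B : veq A B -> veq (t *: A) (t *: B).
Proof. by move/veqP => h; apply/veqP => x; rewrite !hvar_scale h. Qed.
Lemma vle_scale t A B : vle A B -> vle (t *: A) (t *: B).
Proof.
by move/vleP => h; apply/vleP => x; rewrite !hvar_scale ler_wpM2l ?sqr_ge0.
Qed.
Lemma veq_aff A s : veq (A + s *: bsa_one) A.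
Proof. by apply/veqP => x; rewrite hvar_shift. Qed.
Lemma veq_opp A : veq (- A) A.
Proof.
by apply/veqP => x; rewrite -scaleN1r hvar_scale sqrrN expr1n mul1r.
Qed.


Lemma unitize x : x != 0 -> nr (((nr x)^-1%:C)%C *: x) = 1.
Proof.
rewrite -nr_gt0 => h; rewrite nrZ gtr0_norm ?invr_gt0 //.
by rewrite mulVf ?gt_eqF.
Qed.

End RealInner.

(** * Projections and common upper bounds *)

Section Projections.
Variables (R : realType) (H : hilbertType R).
Implicit Types (x y z : H) (c : R[i]) (t s : R) (A B C F : bsa H).

Definition bcomm A B := forall x, A (B x) = B (A x).



Definition isproj F := forall x, F (F x) = F x.

Fact pr_subproof x :
  (fun z => (inner z x / ((nr x ^+ 2)%:C)%C) *: x) \in @bsa_pred R H.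
Proof.
have e : Num.conj ((nr x ^+ 2)%:C)%C = ((nr x ^+ 2)%:C)%C by exact: conjR.
apply/bsa_predP; split; first split.
- by move=> l y z /=; rewrite innerDl innerZl mulrDl scalerDl scalerA mulrA.
- exists 1 => y; rewrite mul1r !nrE lecR nrCZ.
  have [->|x0] := eqVneq x 0; first by rewrite nr0 mulr0 nr_ge0.
  have n0 : 0 < nr x by rewrite nr_gt0.
  rewrite normf_div normCR (ger0_norm (sqr_ge0 _)) (Re_ge0C (normr_ge0 (inner y x))).
  have -> : (((nr x ^+ 2)%:C)%C)^-1 = (((nr x ^+ 2)^-1)%:C)%C :> R[i].
    by rewrite fmorphV.
  rewrite -rmorphM /= expr2 invfM mulrA mulfVK ?gt_eqF // ler_pdivrMr //.
  exact: inner_CS.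
- move=> y z /=; rewrite innerZl innerZr [Num.conj (_ / _)]rmorphM /=.
  rewrite [Num.conj _^-1]fmorphV /= e -innerC.
  by rewrite mulrAC [inner y x * _]mulrC mulrAC.
Qed.

(** The orthogonal projection onto the line of [x]; at [x = 0] it is the zero operator. *)
Definition pr x : bsa H := Bsa (pr_subproof x).
Lemma prE x z : pr x z = (inner z x / ((nr x ^+ 2)%:C)%C) *: x.
Proof. by []. Qed.

Lemma nr2C_neq0 x : x != 0 -> ((nr x ^+ 2)%:C)%C != 0 :> R[i].
Proof. by move=> x0; rewrite -[0]/((0%:C)%C) (inj_eq (@complexI R)) sqrf_eq0 nr_eq0. Qed.

Lemma pr_self x : pr x x = x.
Proof.
have [->|x0] := eqVneq x 0; first by rewrite bsa0r.
by rewrite prE inner_xx divff ?scale1r // nr2C_neq0.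
Qed.

Lemma pr_orth x z : inner z x = 0 -> pr x z = 0.
Proof. by move=> h; rewrite prE h mul0r scale0r. Qed.

Lemma pr_line x z : pr x z = z <-> exists c, z = c *: x.
Proof.
split=> [<-|[c ->]]; last by rewrite bsaZr pr_self.
by exists (inner z x / ((nr x ^+ 2)%:C)%C).
Qed.

Lemma pr_proj x : isproj (pr x).
Proof. by move=> z; rewrite [pr x z]prE bsaZr pr_self. Qed.

Lemma isproj_1B F : isproj F -> isproj (@bsa_one R H - F).
Proof. by move=> pF x; rewrite !bsaBE !bsa_oneE bsaBr pF subrr subr0. Qed.


Lemma bcomm_pr A x : bcomm A (pr x) <-> eigv A x.
Proof.
split=> [h|[s e] z]; last first.
  by rewrite !prE bsaZr e bsaS e innerZr conjR -mulrA scalerA mulrC.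
have [->|x0] := eqVneq x 0; first by exists 0; rewrite bsa0r scaler0.
exists (rip (A x) x / nr x ^+ 2).
rewrite -{1}[x]pr_self h prE inner_bsa_xx -fmorphV -rmorphM /=.
by [].
Qed.

(* [C = A + L F] works for [L >= 4 |A|]: by the law of total variance along
   [F] the variance of [C] exceeds that of [A] by
   [L (L U V + 2 (alpha V - gamma U))] with [U = |F x|^2], [V = |x - F x|^2],
   [alpha = <A F x, F x>] and [gamma = <A (x - F x), x - F x>]. *)
Lemma upper_bound A F s : isproj F -> bcomm A F -> 0 <= s ->
  exists C, vle A C /\ vle (s *: F) C.
Proof.
move=> pF cAF s0; have [M M0 hM] := bsa_bound A.
pose L := 4 * M + s; exists (A + L *: F).
have key x : exists U V a g, [/\ 0 <= U, 0 <= V, `|a| <= M * U, `|g| <= M * V &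
    hvar x (s *: F) = s ^+ 2 * (U * V) /\
    hvar x (A + L *: F) = hvar x A + L * (L * U * V + 2 * (a * V - g * U))].
  have [u [v [xE Fxu Fu Fv]]] :
      exists u v, [/\ x = u + v, F x = u, F u = u & F v = 0].
    exists (F x), (x - F x); split; rewrite ?pF //; first by rewrite addrC subrK.
    by rewrite bsaBr pF subrr.
  have FAu : F (A u) = A u by rewrite -cAF Fu.
  have FAv : F (A v) = 0 by rewrite -cAF Fv bsa0r.
  have o1 y z : F y = y -> F z = 0 -> rip y z = 0.
    by move=> hy hz; rewrite -hy bsaS_rip hz rip0r.
  exists (nr u ^+ 2), (nr v ^+ 2), (rip (A u) u), (rip (A v) v).
  have bd y : `|rip (A y) y| <= M * nr y ^+ 2.
    by rewrite (le_trans (rip_CS _ _)) // expr2 mulrA ler_wpM2r ?nr_ge0.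
  split; rewrite ?sqr_ge0 ?bd //; split.
    rewrite hvar_scale /hvar Fxu xE sqnrD (o1 u v) // ripDr (o1 u v) // ripxx.
    ring.
  have o2 := o1 (A u) v FAu Fv; have o3 := o1 u (A v) Fu FAv.
  have o4 := o1 _ _ FAu FAv; have o5 := o1 _ _ Fu Fv.
  have o3' := etrans (ripC _ _) o3.
  have o5' := etrans (ripC _ _) o5.
  rewrite /hvar; have -> : (A + L *: F) x = (A u + (L%:C)%C *: u) + A v.
    by rewrite bsaDE bsaZE Fxu xE bsaDr addrAC.
  rewrite xE !bsaDr !sqnrD !ripE !nrZ !exprMn !real_normK ?num_real //.
  rewrite ?(o2, o3, o4, o5, o3', o5') !ripxx; ring.
split; apply/vleP => x; have [U [V [a [g [U0 V0 ha hg [h1 h2]]]]]] := key x.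
- rewrite h2 lerDl; move: ha hg; rewrite !ler_norml => /andP[a1 a2] /andP[g1 g2].
  have h : 0 <= a * V + M * U * V by nra.
  have h' : 0 <= M * V * U - g * U by nra.
  have p : 0 <= s * (U * V) by rewrite !mulr_ge0.
  have L0 : 0 <= L by rewrite /L; nra.
  by apply: mulr_ge0 => //; rewrite /L; nra.
- rewrite h1 h2; move: ha hg; rewrite !ler_norml => /andP[a1 a2] /andP[g1 g2].
  have h : 0 <= a * V + M * U * V by nra.
  have h' : 0 <= M * V * U - g * U by nra.
  have p : 0 <= s * (U * V) by rewrite !mulr_ge0.
  have q : s * (U * V) <= L * U * V + 2 * (a * V - g * U) by rewrite /L; nra.
  have L0 : s <= L by rewrite /L; nra.
  rewrite (le_trans _ (_ : L * (s * (U * V)) <= _)) //.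
    by rewrite expr2 -mulrA ler_wpM2r.
  rewrite (le_trans (ler_wpM2l _ q)) ?(le_trans s0) //.
  by rewrite lerDr hvar_ge0.
Qed.

(** * Local constancy of an operator below a multiple of [C] *)

Section LocalConstancy.
Variables (B C : bsa H) (k : R).
Hypothesis k_ge0 : 0 <= k.
Hypothesis BC : forall x, hvar x B <= k ^+ 2 * hvar x C.
Variable mu : R.

Let r y := nr (C y - (mu%:C)%C *: y).
Let b y := rip (B y) y.

(** The distance from [B z] to the real line of [z] is given by the variance, hence is at most [k]
    times the one for [C]; the scalar [mu] can only do worse than the optimal one for [C]. *)
Let near_eig z : exists be, nr (B z - (be%:C)%C *: z) <= k * r z.
Proof.
have [->|z0] := eqVneq z 0.
  by exists 0; rewrite bsa0r scale0r subrr nr0 mulr_ge0 ?nr_ge0.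
exists (rip (B z) z / nr z ^+ 2).
have p : 0 < nr z ^+ 2 by rewrite exprn_gt0 // nr_gt0.
rewrite -(@ler_pXn2r _ 2) ?nnegrE ?mulr_ge0 ?nr_ge0 //.
rewrite -(ler_pM2l p) -hvarE // exprMn mulrCA.
by rewrite (le_trans (BC z)) // ler_wpM2l ?sqr_ge0 // hvar_le.
Qed.

Let near_eig1 y : nr y = 1 -> nr (B y - ((b y)%:C)%C *: y) <= k * r y.
Proof.
move=> y1; rewrite -(@ler_pXn2r _ 2) ?nnegrE ?mulr_ge0 ?nr_ge0 //.
have := hvarE B (_ : y != 0); rewrite -nr_gt0 y1 ltr01 => /(_ isT).
rewrite expr1n mul1r divr1 -/(b y) => <-.
rewrite (le_trans (BC y)) // exprMn ler_wpM2l ?sqr_ge0 //.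
by rewrite (le_trans (hvar_le y C mu)) // y1 expr1n mul1r.
Qed.

(* Test [(B - be) (y + y')], which is small for a suitable [be], against
   [y - y']. *)
Lemma near_eigenvalues y y' : nr y = 1 -> nr y' = 1 ->
  `|b y - b y'| <= 5 * k * (r y + r y').
Proof.
move=> y1 y1'; have [be hbe] := near_eig (y + y').
set w := B (y + y') - _ in hbe.
pose e := B y - ((b y)%:C)%C *: y; pose e' := B y' - ((b y')%:C)%C *: y'.
have he : nr e <= k * r y by exact: near_eig1.
have he' : nr e' <= k * r y' by exact: near_eig1.
have hw : nr w <= k * (r y + r y').
  rewrite (le_trans hbe) // ler_wpM2l //.
  by rewrite /r bsaDr scalerDr opprD addrACA nr_triangle.
have ByE : B y = ((b y)%:C)%C *: y + e by rewrite addrC subrK.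
have ByE' : B y' = ((b y')%:C)%C *: y' + e' by rewrite addrC subrK.
clearbody e e'.
set th := rip y y'.
have dn : nr (y - y') <= 2 by rewrite (le_trans (nrB _ _)) // y1 y1'; lra.
have h1 : rip w (y - y') = (b y - b y') * (1 - th) + rip (e + e') (y - y').
  rewrite /w bsaDr ByE ByE' !ripE [rip y' y]ripC !ripxx y1 y1' -/th; ring.
(* [h1] controls only the difference times [1 - th], which says little when [y] and [y'] are close.
   The symmetry of [B] controls the difference times [th], and the two add up. *)
have h2 : (b y - b y') * th = rip y e' - rip e y'.
  have := bsaS_rip B y y'; rewrite ByE ByE' !ripE -/th; lra.
have c1 : `|rip w (y - y')| <= k * (r y + r y') * 2.
  by rewrite (le_trans (rip_CS _ _)) // ler_pM ?nr_ge0.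
have c2 : `|rip (e + e') (y - y')| <= k * (r y + r y') * 2.
  rewrite (le_trans (rip_CS _ _)) // ler_pM ?nr_ge0 //.
  by rewrite (le_trans (nr_triangle _ _)) // mulrDr lerD.
have c3 : `|rip y e'| <= k * r y'.
  by rewrite (le_trans (rip_CS _ _)) // y1 mul1r.
have c4 : `|rip e y'| <= k * r y.
  by rewrite (le_trans (rip_CS _ _)) // y1' mulr1.
have -> : b y - b y' = rip w (y - y') - rip (e + e') (y - y') +
    (rip y e' - rip e y').
  rewrite -h2 h1; ring.
rewrite (le_trans (ler_normD _ _)) // (le_trans (lerD (ler_normB _ _) (ler_normB _ _))) //.
lra.
Qed.

(** The scalar is the Rayleigh quotient of [B] at a unit vector [y0] whose residual [r y0] is
    minimal up to [e]; the infimum need not be attained. For a unit vector [u] the error is at most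
    [k r u + 5 k (r u + r y0)] with [r y0 <= r u + e], whence the factor 11. *)
Lemma near_scalar (e : R) : 0 < e -> exists c : R, forall y,
  nr (B y - (c%:C)%C *: y) <= 11 * k * (nr (C y - (mu%:C)%C *: y) + e * nr y).
Proof.
move=> e0; pose E := [set r y | y in [set y | nr y = 1]].
have [[y1 hy1]|no] := pselect (exists y, nr y = 1); last first.
  exists 0 => y; have [->|y0] := eqVneq y 0.
    by rewrite !bsa0r !scaler0 !subrr nr0 mulr0 addr0 mulr0.
  by case: no; exists (((nr y)^-1%:C)%C *: y); rewrite unitize.
have hE : has_inf E.
  split; first by exists (r y1), y1.
  by exists 0 => _ [y _ <-]; apply: nr_ge0.
have [_ [y0 /= hy0 <-] h0] := inf_adherent e0 hE.
have r0 y : nr y = 1 -> r y0 <= r y + e.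
  move=> hy; rewrite (le_trans (ltW h0)) // lerD2r.
  by apply: ge_inf; [have [] := hE | exists y].
exists (b y0) => y; have [->|yn0] := eqVneq y 0.
  by rewrite !bsa0r !scaler0 !subrr nr0 mulr0 addr0 mulr0.
have n0 : 0 < nr y by rewrite nr_gt0.
pose u := ((nr y)^-1%:C)%C *: y.
have u1 : nr u = 1 by exact: unitize.
have yE : y = ((nr y)%:C)%C *: u.
  by rewrite /u scalerA -rmorphM /= divff ?gt_eqF // scale1r.
have key : nr (B u - ((b y0)%:C)%C *: u) <= 11 * k * (r u + e).
  have -> : B u - ((b y0)%:C)%C *: u =
      (B u - ((b u)%:C)%C *: u) + ((b u - b y0)%:C)%C *: u.
    by rewrite rmorphB /= scalerBl addrA subrK.
  rewrite (le_trans (nr_triangle _ _)) // nrZ u1 mulr1.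
  rewrite (le_trans (lerD (near_eig1 u1) (near_eigenvalues u1 hy0))) //.
  have := ler_wpM2l k_ge0 (r0 _ u1); have := mulr_ge0 k_ge0 (ltW e0); lra.
clearbody u; rewrite yE !bsaZr !scalerA ![_%:C%C * (nr y)%:C%C]mulrC -!scalerA -!scalerBr !nrZ.
rewrite u1 mulr1 gtr0_norm // [e * _]mulrC -mulrDr mulrCA ler_pM2l //.
Qed.
End LocalConstancy.
End Projections.

(** * Polynomials in one self-adjoint operator *)

Section PolynomialCalculus.
Variables (R : realType) (H : hilbertType R).
Implicit Types (x y z : H) (c : R[i]) (t s : R).

Section OneOperator.
Variable A : bsa H.

Definition cpe (p : {poly R[i]}) x : H := \sum_(i < size p) p`_i *: iter i A x.

Lemma cpe_widen n (p : {poly R[i]}) x : (size p <= n)%N ->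
  cpe p x = \sum_(i < n) p`_i *: iter i A x.
Proof.
move=> h; rewrite /cpe (big_ord_widen _ (fun i => p`_i *: iter i A x) h).
rewrite big_mkcond; apply: eq_bigr => i _; case: ltnP => // hi.
by rewrite nth_default // scale0r.
Qed.

Lemma cpeD (p q : {poly R[i]}) x : cpe (p + q) x = cpe p x + cpe q x.
Proof.
rewrite (cpe_widen x (size_polyD p q)) (cpe_widen x (leq_maxl (size p) (size q))).
rewrite (cpe_widen x (leq_maxr (size p) (size q))) -big_split.
by apply: eq_bigr => i _; rewrite coefD scalerDl.
Qed.

Lemma cpeZ c (p : {poly R[i]}) x : cpe (c *: p) x = c *: cpe p x.
Proof.
rewrite (cpe_widen x (size_scale_leq _ _)) /cpe scaler_sumr.
by apply: eq_bigr => i _; rewrite coefZ scalerA.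
Qed.

Lemma cpe0 x : cpe 0 x = 0.
Proof. by rewrite /cpe size_poly0 big_ord0. Qed.

Lemma cpeC c x : cpe c%:P x = c *: x.
Proof.
by rewrite (cpe_widen x (size_polyC_leq1 c)) big_ord1 coefC.
Qed.

Lemma cpeXr (p : {poly R[i]}) x : cpe (p * 'X) x = A (cpe p x).
Proof.
have h : (size (p * 'X)%R <= (size p).+1)%N.
  by have [->|p0] := eqVneq p 0; rewrite ?mul0r ?size_poly0 // size_mulX.
rewrite (cpe_widen x h) big_ord_recl coefMX /= scale0r add0r /cpe bsa_sumr.
by apply: eq_bigr => i _; rewrite coefMX /= bsaZr.
Qed.

Lemma cpeM (p q : {poly R[i]}) x : cpe (p * q) x = cpe p (cpe q x).
Proof.
elim/poly_ind: p => [|p c IH]; first by rewrite mul0r !cpe0.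
rewrite mulrDl mulrAC mul_polyC !cpeD (cpeXr p) (cpeXr (p * q)) IH cpeZ.
by rewrite cpeC.
Qed.

Lemma cpeX x : cpe 'X x = A x.
Proof. by rewrite -['X]mul1r cpeXr cpeC scale1r. Qed.


Lemma cpe_linear (p : {poly R[i]}) : linear (cpe p).
Proof.
move=> l x y; rewrite /cpe scaler_sumr -big_split; apply: eq_bigr => i _ /=.
have -> : iter i A (l *: x + y) = l *: iter i A x + iter i A y.
  by elim: (i : nat) => //= j ->; rewrite bsaL.
by rewrite scalerDr !scalerA mulrC.
Qed.

Lemma cpe_eig (p : {poly R[i]}) x (a : R[i]) : A x = a *: x -> cpe p x = p.[a] *: x.
Proof.
move=> e; elim/poly_ind: p => [|p c IH]; first by rewrite cpe0 horner0 scale0r.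
by rewrite cpeD cpeXr cpeC IH bsaZr e !hornerE scalerDl scalerA.
Qed.

(** Real coefficients keep the result self-adjoint; the complex calculus [cpe] serves for factoring
    into linear factors. *)
Definition rpe (p : {poly R}) := cpe (map_poly (real_complex R) p).

Lemma rpeD (p q : {poly R}) x : rpe (p + q) x = rpe p x + rpe q x.
Proof. by rewrite /rpe rmorphD cpeD. Qed.
Lemma rpeM (p q : {poly R}) x : rpe (p * q) x = rpe p (rpe q x).
Proof. by rewrite /rpe rmorphM cpeM. Qed.
Lemma rpe0 x : rpe 0 x = 0.
Proof. by rewrite /rpe rmorph0 cpe0. Qed.
Lemma rpeC t x : rpe t%:P x = (t%:C)%C *: x.
Proof. by rewrite /rpe map_polyC cpeC. Qed.
Lemma rpe1 x : rpe 1 x = x.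
Proof. by rewrite /rpe rmorph1 cpeC scale1r. Qed.
Lemma rpeX x : rpe 'X x = A x.
Proof. by rewrite /rpe map_polyX cpeX. Qed.
Lemma rpeN (p : {poly R}) x : rpe (- p) x = - rpe p x.
Proof. by rewrite -mulN1r -[-1]/(- 1%:P) -polyCN rpeM rpeC rmorphN scaleN1r. Qed.
Lemma rpeB (p q : {poly R}) x : rpe (p - q) x = rpe p x - rpe q x.
Proof. by rewrite rpeD rpeN. Qed.
Lemma rpe_sum I (r : seq I) (P : pred I) (F : I -> {poly R}) x :
  rpe (\sum_(i <- r | P i) F i) x = \sum_(i <- r | P i) rpe (F i) x.
Proof.
elim/big_rec2: _ => [|i s p _ <-]; first by rewrite rpe0.
by rewrite rpeD.
Qed.

Fact rpe_bsa (p : {poly R}) : rpe p \in @bsa_pred R H.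
Proof.
apply/bsa_predP; split; first split; first exact: cpe_linear.
  elim/poly_ind: p => [|p t [M hM]].
    by exists 0 => x; rewrite rpe0 normr0 mul0r.
  have [N N0 hN] := bsa_bound A.
  exists (N * M + `|t|) => x; rewrite rpeD mulrC rpeM rpeX rpeC.
  rewrite rmorphD mulrDl (le_trans (ler_normD _ _)) // lerD //; last first.
    by rewrite normrZ normCR.
  rewrite [X in X <= _]nrE (le_trans (_ : _ <= ((N * nr (rpe p x))%:C)%C)) //.
    by rewrite lecR.
  by rewrite !rmorphM /= -nrE -mulrA ler_wpM2l // ler0c ltW.
elim/poly_ind: p => [|p t IH] x y; first by rewrite !rpe0 inner0l inner0r.
rewrite !rpeD innerDl innerDr !rpeC innerZl innerZr conjR; congr (_ + _).
by rewrite mulrC [in LHS]rpeM rpeX bsaS mulrC rpeM rpeX IH.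
Qed.

Definition bsa_poly (p : {poly R}) : bsa H := Bsa (rpe_bsa p).
Lemma bsa_polyE (p : {poly R}) x : bsa_poly p x = rpe p x. Proof. by []. Qed.

(** * Bernstein polynomials as approximate spectral projections *)

Section Bernstein.
Implicit Types (p q : {poly R}).
Hypothesis A_ge0 : forall x, 0 <= rip (A x) x.
Hypothesis A_le1 : forall x, rip (A x) x <= rip x x.

Let pos (p : {poly R}) := forall x, 0 <= rip (rpe p x) x.

Let pos_sqM q p : pos p -> pos (q ^+ 2 * p).
Proof.
move=> h x; rewrite expr2 -mulrA rpeM.
by rewrite -[rpe q (rpe _ x)]bsa_polyE bsaS_rip mulrC rpeM; apply: h.
Qed.

Let posD p q : pos p -> pos q -> pos (p + q).
Proof. by move=> hp hq x; rewrite rpeD ripDl addr_ge0. Qed.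

Let pos1 : pos 1. Proof. by move=> x; rewrite rpe1 rip_ge0. Qed.
Let posX : pos 'X. Proof. by move=> x; rewrite rpeX. Qed.
Let pos1X : pos (1 - 'X).
Proof. by move=> x; rewrite rpeB rpe1 rpeX ripBl subr_ge0. Qed.
Let posX1X : pos ('X * (1 - 'X)).
Proof.
have -> : 'X * (1 - 'X) = 'X ^+ 2 * (1 - 'X) + (1 - 'X) ^+ 2 * 'X :> {poly R}.
  by ring.
by apply: posD; apply: pos_sqM.
Qed.

(** Even powers split off as squares, leaving one of [1], ['X], [1 - 'X] and their product. *)
Let pos_bern i j : pos ('X ^+ i * (1 - 'X) ^+ j).
Proof.
have e (q : {poly R}) n : q ^+ n = (q ^+ n./2) ^+ 2 * q ^+ odd n.
  by rewrite -exprM -exprD muln2 addnC odd_double_half.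
rewrite (e 'X) (e (1 - 'X)) -mulrA [X in _ * X]mulrCA.
by do 2!apply: pos_sqM; case: (odd i); case: (odd j);
  rewrite ?expr0 ?expr1 ?mulr1 ?mul1r.
Qed.

(* Quantifying over [i] and [j] makes this cone, unlike [pos], closed under
   products with ['X] and [1 - 'X]. *)
Let cone (p : {poly R}) := forall i j, pos (p * ('X ^+ i * (1 - 'X) ^+ j)).

Let cone_pos p : cone p -> pos p.
Proof. by move/(_ 0 0)%N; rewrite !expr0 !mulr1. Qed.
Let coneD p q : cone p -> cone q -> cone (p + q).
Proof. by move=> hp hq i j; rewrite mulrDl; apply: posD. Qed.
Let coneX p : cone p -> cone ('X * p).
Proof. by move=> hp i j; have := hp i.+1 j; rewrite exprS !mulrA [p * 'X]mulrC. Qed.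
Let cone1X p : cone p -> cone ((1 - 'X) * p).
Proof.
move=> hp i j; have := hp i j.+1; rewrite exprS.
by rewrite (_ : p * _ = (1 - 'X) * p * ('X^i * (1 - 'X) ^+ j)) //; ring.
Qed.
Let cone_sqM q p : cone p -> cone (q ^+ 2 * p).
Proof. by move=> hp i j; rewrite -mulrA; apply: pos_sqM. Qed.
Let cone1 : cone 1.
Proof. by move=> i j; rewrite mul1r. Qed.
Let cone0 : cone 0.
Proof. by move=> i j x; rewrite mul0r rpe0 rip0l. Qed.

(* The expectation of [f] at the number of successes in [n] independent trials
   of probability ['X]. *)
Fixpoint binE n (f : nat -> {poly R}) : {poly R} :=
  if n is m.+1 then (1 - 'X) * binE m f + 'X * binE m (f \o succn) else f 0%N.

Let binE_cone n f : (forall j, cone (f j)) -> cone (binE n f).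
Proof.
elim: n f => [|n IH] f h //=; apply: coneD; first by apply/cone1X/IH.
by apply/coneX/IH => j; apply: h.
Qed.

Let binE_ext n f g : (forall j, (j <= n)%N -> f j = g j) -> binE n f = binE n g.
Proof.
elim: n f g => [|n IH] f g h /=; first exact: h.
congr (_ * _ + _ * _); apply: IH => j hj; apply: h => //.
exact: leqW.
Qed.

Let binED n (f g : nat -> {poly R}) : binE n (fun j => f j + g j) = binE n f + binE n g.
Proof.
elim: n f g => [|n IH] f g //=.
have -> : (fun j => f j + g j) \o succn =
  fun j => (f \o succn) j + (g \o succn) j by [].
rewrite !IH; ring.
Qed.

Let binEM n (f : nat -> {poly R}) q : binE n (fun j => q * f j) = q * binE n f.
Proof.
elim: n f => [|n IH] f //=.
have -> : (fun j => q * f j) \o succn = fun j => q * (f \o succn) j by [].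
rewrite !IH; ring.
Qed.

Let binEc n q : binE n (fun=> q) = q.
Proof.
elim: n => [|n IH] //=.
have -> : (fun=> q) \o succn = fun=> q :> {poly R} by [].
rewrite !IH; ring.
Qed.

Let binE_sum (I : finType) n (f : I -> nat -> {poly R}) :
  binE n (fun j => \sum_k f k j) = \sum_k binE n (f k).
Proof.
elim: n f => [|n IH] f //=; rewrite IH.
have -> : (fun j => \sum_k f k j) \o succn =
  fun j => \sum_k (f k \o succn) j by [].
by rewrite IH !mulr_sumr -big_split.
Qed.

(** Bias plus variance of the binomial law, with mean [n 'X] and variance [n 'X (1 - 'X)]. *)
Let binE_var n q : binE n (fun j => (q - j%:R) ^+ 2) =
  (q - n%:R * 'X) ^+ 2 + n%:R * ('X * (1 - 'X)).
Proof.
elim: n q => [|n IH] q /=; first by rewrite !mul0r addr0.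
have -> : (fun j => (q - j%:R) ^+ 2) \o succn =
    fun j => ((q - 1) - j%:R) ^+ 2 :> {poly R}.
  by apply/funext => j /=; rewrite -natr1; ring.
rewrite !IH -natr1; ring.
Qed.

Variable m : nat.
Hypothesis m_gt0 : (0 < m)%N.

Let ind (k j : nat) : {poly R} := ((j %/ m)%N == k)%:R.

(** The probability that the number of successes in [m ^ 2] trials lies in the [k]-th block of
    length [m]. The frequency of successes deviates from ['X] by about [1 / m], the width of a
    block, so this is a smoothed indicator of [A] being near [node k]. The index [m] is reached only
    when all trials succeed. *)
Let block (k : 'I_m.+1) : {poly R} := binE (m ^ 2) (ind k).
Let node (k : 'I_m.+1) : R := k%:R / m%:R.

Let block_sum : \sum_k block k = 1.
Proof.
rewrite -binE_sum -[RHS](binEc (m ^ 2)); apply: binE_ext => j hj.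
have hk : (j %/ m < m.+1)%N by rewrite ltnS (leq_trans (leq_div2r m hj)) // -mulnn mulnK.
rewrite (bigD1 (Ordinal hk)) //= /ind eqxx big1 ?addr0 // => k hk'.
by case: eqP => // e; move/eqP: hk'; case; apply: val_inj.
Qed.


(** A block is not idempotent; that its square lies below it is the substitute. Expanding one factor
    by [binE] reduces the product to multiplications by ['X] and [1 - 'X], under which [cone] is
    closed. *)
Let block_idem k : cone (block k * (1 - block k)).
Proof.
rewrite mulrC -binEM; apply: binE_cone => j.
suff h : cone (1 - block k) by rewrite /ind; case: eqP; rewrite ?mulr1 ?mulr0.
have -> : 1 - block k = binE (m ^ 2) (fun j => 1 - ind k j).
  rewrite -[1 in LHS](binEc (m ^ 2)) -mulN1r -binEM -binED.
  by congr binE; apply/funext => i; rewrite mulN1r.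
by apply: binE_cone => i; rewrite /ind; case: eqP; rewrite ?subrr ?subr0.
Qed.

(** Let [far j] be the frequency and [near j] the node of its block, at distance at most [1 / m].
    Then [('X - near)^2 <= 2 ('X - far)^2 + 2 (far - near)^2], and both terms have expectation at
    most [2 / m^2]. All inequalities are kept as explicit elements of [cone]. *)
Let block_spread : exists2 p, cone p &
  \sum_k ('X - (node k)%:P) ^+ 2 * block k + p = (4 / m%:R ^+ 2)%:P.
Proof.
have m0 : m%:R != 0 :> R by rewrite pnatr_eq0 -lt0n.
pose v : {poly R} := ((m%:R ^+ 2)^-1)%:P.
have ev : v * (m ^ 2)%:R = 1.
  by rewrite /v natrX -polyC_natr -polyC_exp -polyCM mulVf ?expf_neq0.
pose near (j : nat) : R := ((j %/ m)%N)%:R / m%:R.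
have e1 : \sum_k ('X - (node k)%:P) ^+ 2 * block k =
    binE (m ^ 2) (fun j => ('X - (near j)%:P) ^+ 2).
  under eq_bigr => k _ do rewrite -binEM.
  rewrite -binE_sum; apply: binE_ext => j hj.
  have hk : (j %/ m < m.+1)%N by rewrite ltnS (leq_trans (leq_div2r m hj)) // -mulnn mulnK.
  rewrite (bigD1 (Ordinal hk)) //= /ind eqxx mulr1 big1 ?addr0 // => k hk'.
  case: eqP => [e|]; last by rewrite mulr0.
  by move/eqP: hk'; case; apply: val_inj.
pose far (j : nat) : R := j%:R / m%:R ^+ 2.
have e2 : binE (m ^ 2) (fun j => ('X - (far j)%:P) ^+ 2) = v * ('X * (1 - 'X)).
  have -> : (fun j => ('X - (far j)%:P) ^+ 2) =
      fun j => v ^+ 2 * ((m ^ 2)%:R * 'X - j%:R) ^+ 2.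
    apply/funext => j; rewrite -exprMn mulrBr mulrA ev mul1r; congr ((_ - _) ^+ 2).
    by rewrite /far /v -polyC_natr -polyCM mulrC.
  rewrite binEM binE_var subrr expr0n add0r [v ^+ 2]expr2 -mulrA.
  by rewrite [v * (_%:R * _)]mulrA ev mul1r.
(* The slack [2 ('X - far)^2 + 2 v - ('X - near)^2], with the square completed. *)
pose rest j : {poly R} :=
  ('X - (2 * far j - near j)%:P) ^+ 2 + (2 * v - 2 * ((far j - near j)^+2)%:P).
pose q := binE (m ^ 2) rest.
have e3 : binE (m ^ 2) (fun j => ('X - (near j)%:P) ^+ 2) + q =
    2 * v * ('X * (1 - 'X)) + 2 * v.
  rewrite -binED -mulrA -e2 -binEM -[X in _ = _ + X](binEc (m ^ 2)) -binED.
  congr binE; apply/funext => j; rewrite /rest.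
  rewrite !(polyCB, polyCM, polyCD, polyC_exp); ring.
exists (q + 2 * v * (1 - 'X * (1 - 'X))).
  have cv : cone v.
    rewrite /v -[(_ ^+ 2)^-1]mulr1 -exprVn polyCM polyC_exp.
    by apply: cone_sqM; rewrite -/1.
  apply: coneD.
    apply: binE_cone => j; apply: coneD.
      by rewrite -[X in cone X]mulr1; apply: cone_sqM.
    have : 0 <= (m%:R ^+ 2)^-1 - (far j - near j) ^+ 2.
      rewrite subr_ge0 -exprVn ler_sqr ?nnegrE ?invr_ge0 //.
        rewrite /far /near {1}(divn_eq j m) natrD natrM.
        have -> : (((j %/ m)%N)%:R * m%:R + ((j %% m)%N)%:R) / m%:R ^+ 2 -
            ((j %/ m)%N)%:R / m%:R = ((j %% m)%N)%:R / m%:R ^+ 2 :> R by field.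
        rewrite expr2 invfM mulrA ler_piMl ?invr_ge0 // ler_pdivrMr ?ltr0n //.
        by rewrite mul1r ler_nat ltnW // ltn_mod.
      rewrite /far /near {1}(divn_eq j m) natrD natrM.
      have -> : (((j %/ m)%N)%:R * m%:R + ((j %% m)%N)%:R) / m%:R ^+ 2 -
            ((j %/ m)%N)%:R / m%:R = ((j %% m)%N)%:R / m%:R ^+ 2 :> R by field.
      by rewrite mulr_ge0 // invr_ge0 exprn_ge0.
    move=> h.
    have -> : 2 * v - 2 * ((far j - near j) ^+ 2)%:P =
      (Num.sqrt 2 * Num.sqrt ((m%:R ^+ 2)^-1 - (far j - near j) ^+ 2))%:P ^+ 2 * 1.
      rewrite mulr1 -polyC_exp exprMn !sqr_sqrtr // -mulrBr -polyCB [in RHS]polyCM.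
      by rewrite polyC_natr.
    exact: cone_sqM.
  have -> : 2 * v * (1 - 'X * (1 - 'X)) =
      v * (1 + (1 - 'X) * (1 - 'X) + 'X * 'X) by ring.
  rewrite /v -exprVn polyC_exp; apply: cone_sqM; apply: coneD; first apply: coneD.
  - exact: cone1.
  - by apply: cone1X; rewrite -[1 - _]mulr1; apply: cone1X.
  - by apply: coneX; rewrite -['X]mulr1; apply: coneX.
rewrite e1 addrA e3.
have -> : (4 / m%:R ^+ 2)%:P = 4 * v by rewrite polyCM polyC_natr.
ring.
Qed.

(** Put [z = (A - node k) x]. Since a block dominates its square, [|block z|^2 <= <block z, z>], and
    these bounds are summed by [block_spread]. The sum of squares is of order [1 / m^2] for [m + 1]
    pieces, so even the sum of the norms tends to zero. *)
Lemma approximate_spectral_decomposition x :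
  exists (mu : 'I_m.+1 -> R) (F : 'I_m.+1 -> {poly R}),
    \sum_k rpe (F k) x = x /\
    \sum_k nr (A (rpe (F k) x) - ((mu k)%:C)%C *: rpe (F k) x) ^+ 2 <=
      4 / m%:R ^+ 2 * nr x ^+ 2.
Proof.
exists node, block; split; first by rewrite -rpe_sum block_sum rpe1.
have [p cp hp] := block_spread.
have h k : nr (A (rpe (block k) x) - ((node k)%:C)%C *: rpe (block k) x) ^+ 2 <=
    rip (rpe (('X - (node k)%:P) ^+ 2 * block k) x) x.
  have -> : A (rpe (block k) x) - ((node k)%:C)%C *: rpe (block k) x =
      rpe (block k) (rpe ('X - (node k)%:P) x).
    by rewrite -rpeM mulrC rpeM rpeB rpeX rpeC.
  set z := rpe ('X - _) x.
  have -> : rip (rpe (('X - (node k)%:P) ^+ 2 * block k) x) x =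
      rip (rpe (block k) z) z.
    rewrite expr2 -mulrA rpeM -[rpe _ (rpe _ x)]bsa_polyE bsaS_rip.
    by rewrite mulrC rpeM.
  have := cone_pos (@block_idem k) z.
  rewrite mulrBr mulr1 rpeB ripBl subr_ge0 rpeM.
  by rewrite -[rpe _ (rpe _ z)]bsa_polyE bsaS_rip ripxx.
rewrite (le_trans (ler_sum _ (fun k _ => h k))) //.
rewrite -rip_suml -rpe_sum -ripxx -ripZl -rpeC -hp rpeD ripDl lerDl.
exact: cone_pos.
Qed.

End Bernstein.
End OneOperator.
End PolynomialCalculus.

(** * The double commutant property of the order *)

Section DoubleCommutant.
Variables (R : realType) (H : hilbertType R).
Implicit Types (x y z : H) (c : R[i]) (t s : R) (A B C T : bsa H).

Lemma sum_sqr_le n (a : 'I_n -> R) :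
  (\sum_i a i) ^+ 2 <= n%:R * \sum_i a i ^+ 2.
Proof.
have h : 0 <= \sum_i \sum_j (a i - a j) ^+ 2.
  by apply: sumr_ge0 => i _; apply: sumr_ge0 => j _; apply: sqr_ge0.
have e : \sum_i \sum_j (a i - a j) ^+ 2 =
    2 * (n%:R * \sum_i a i ^+ 2 - (\sum_i a i) ^+ 2).
  have -> : \sum_i \sum_j (a i - a j) ^+ 2 =
      \sum_i (n%:R * a i ^+ 2 + \sum_j a j ^+ 2 - 2 * (a i * \sum_j a j)).
    apply: eq_bigr => i _; have -> : n%:R * a i ^+ 2 = \sum_(j < n) a i ^+ 2.
      by rewrite sumr_const card_ord mulr_natl.
    by rewrite !mulr_sumr -big_split -sumrB; apply: eq_bigr => j _ /=; ring.
  rewrite sumrB big_split /= -!mulr_sumr -mulr_suml sumr_const card_ord.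
  by rewrite -mulr_natl; ring.
by move: h; rewrite e pmulr_rge0 // subr_ge0.
Qed.

Lemma eq0_of_sqr_small (a : R) K : (forall m, (0 < m)%N -> a ^+ 2 <= K / m%:R) -> a = 0.
Proof.
move=> h; apply/eqP; rewrite -sqrf_eq0; apply/negPn/negP => a0.
have p : 0 < a ^+ 2 by rewrite lt_def a0 sqr_ge0.
pose m := (Num.truncn (`|K| / a ^+ 2)).+1.
have hm : `|K| / a ^+ 2 < m%:R by exact: truncnS_gt.
have := h m isT; rewrite ler_pdivlMr ?ltr0n // leNgt.
move: hm; rewrite ltr_pdivrMr // mulrC => hm.
by rewrite (le_lt_trans (ler_norm K)).
Qed.

Section Bound.
Variables (B C T : bsa H) (k M : R).
Hypotheses (k_ge0 : 0 <= k) (M_gt0 : 0 < M).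
Hypothesis BC : forall x, hvar x B <= k ^+ 2 * hvar x C.
Hypothesis TM : forall x, nr (T x) <= M * nr x.
Hypothesis TC : bcomm T C.

(** As [T] commutes with [C], the vector [T y] is as close to the eigenvalue [mu] of [C] as [y] is,
    up to the factor [M]. So [B] is near one and the same scalar at [y] and at [T y], and the scalar
    cancels in the commutator. Two errors with factor 11 make 22. *)
Lemma commutator_bound mu y :
  nr (B (T y) - T (B y)) <= 22 * k * M * nr (C y - (mu%:C)%C *: y).
Proof.
set r := nr (C y - _).
have r0 : 0 <= r by exact: nr_ge0.
apply/ler_addgt0Pr => e e0.
pose e' := e / (22 * k * M * nr y + 1).
have d0 : 0 < 22 * k * M * nr y + 1.
  by rewrite ltr_wpDl // !mulr_ge0 // ?nr_ge0 // ltW.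
have [|c hc] := near_scalar k_ge0 BC mu (_ : 0 < e'); first by rewrite divr_gt0.
have -> : B (T y) - T (B y) = (B (T y) - (c%:C)%C *: T y) -
    T (B y - (c%:C)%C *: y).
  by rewrite bsaBr bsaZr opprB addrA subrK.
rewrite (le_trans (nrB _ _)) //.
have h1 := hc (T y).
have h2 := le_trans (TM _) (ler_wpM2l (ltW M_gt0) (hc y)).
have h3 : nr (C (T y) - (mu%:C)%C *: T y) <= M * r.
  by rewrite -TC -bsaZr -bsaBr; apply: TM.
have h4 := TM y; have h5 := ltW (_ : 0 < e'); move: h5; rewrite divr_gt0 // => /(_ isT) h5.
have h6 : 11 * k * (nr (C (T y) - (mu%:C)%C *: T y) + e' * nr (T y)) <=
    11 * k * (M * r + e' * (M * nr y)).
  by rewrite ler_wpM2l ?mulr_ge0 // lerD // ler_wpM2l.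
rewrite (le_trans (lerD (le_trans h1 h6) h2)) // -/r.
have -> : 11 * k * (M * r + e' * (M * nr y)) + M * (11 * k * (r + e' * nr y)) =
  22 * k * M * r + e' * (22 * k * M * nr y) by ring.
rewrite lerD2l /e' mulrAC ler_pdivrMr // ler_pM2l //.
by rewrite lerDl.
Qed.
End Bound.

Lemma double_commutant_aux B C T k : 0 <= k ->
  (forall x, 0 <= rip (C x) x) -> (forall x, rip (C x) x <= rip x x) ->
  (forall x, hvar x B <= k ^+ 2 * hvar x C) -> bcomm T C -> bcomm T B.
Proof.
move=> k0 C0 C1 BC TC x; have [M M0 hM] := bsa_bound T.
apply/esym/eqP; rewrite -subr_eq0 -nr_eq0; apply/eqP.
(* With [m + 1] pieces, [sum_sqr_le] and the bound [4 / m^2] give [4 (m + 1) / m^2 <= 8 / m]. *)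
pose K := (22 * k * M) ^+ 2 * (8 * nr x ^+ 2).
apply: (@eq0_of_sqr_small _ K) => m m0.
have [mu [F [sF hF]]] := approximate_spectral_decomposition C0 C1 m0 x.
have step k' : nr (B (T (rpe C (F k') x)) - T (B (rpe C (F k') x))) <=
    22 * k * M * nr (C (rpe C (F k') x) - ((mu k')%:C)%C *: rpe C (F k') x).
  exact: (commutator_bound k0 M0 BC hM TC).
have le1 : nr (B (T x) - T (B x)) <= 22 * k * M *
    \sum_i nr (C (rpe C (F i) x) - ((mu i)%:C)%C *: rpe C (F i) x).
  rewrite -{1 2}sF !bsa_sumr -sumrB mulr_sumr (le_trans (nr_sum _)) //.
  by apply: ler_sum => i _; apply: step.
have q0 : 0 <= 22 * k * M by rewrite !mulr_ge0 // ltW.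
rewrite (le_trans (_ : _ <= (22 * k * M * (\sum_i nr (C (rpe C (F i) x) -
    ((mu i)%:C)%C *: rpe C (F i) x))) ^+ 2)) //.
  rewrite ler_sqr ?nnegrE ?nr_ge0 // mulr_ge0 // sumr_ge0 // => i _.
  exact: nr_ge0.
rewrite exprMn /K -[X in _ <= X]mulrA ler_wpM2l ?sqr_ge0 //.
rewrite (le_trans (sum_sqr_le _)) //.
rewrite (le_trans (ler_wpM2l (ler0n _ _) hF)) //.
have mR : 1 <= m%:R :> R by rewrite ler1n.
have mR0 : 0 < m%:R :> R by rewrite ltr0n.
rewrite mulrA [8 * _ / _]mulrAC; apply: ler_wpM2r; first exact: sqr_ge0.
rewrite ler_pdivlMr // -natr1.
have -> : (m%:R + 1) * (4 / m%:R ^+ 2) * m%:R = 4 * (m%:R + 1) / m%:R :> R.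
  by field; rewrite gt_eqF.
by rewrite ler_pdivrMr //; lra.
Qed.

Lemma double_commutant B C T : vle B C -> bcomm T C -> bcomm T B.
Proof.
move=> /vleP BC TC; have [M M0 hM] := bsa_bound C.
have M2 : 0 < 2 * M by rewrite mulr_gt0.
(* An affine image of [C] with [0 <= D <= 1], as the Bernstein polynomials require; the shift leaves
   the variance alone and the factor becomes [k = 2 M]. *)
pose D := (2 * M)^-1 *: C + 2^-1 *: bsa_one H.
have DE x : rip (D x) x = (2 * M)^-1 * rip (C x) x + 2^-1 * rip x x.
  by rewrite /D bsaDE !bsaZE bsa_oneE !ripE.
have Cb x : `|rip (C x) x| <= M * nr x ^+ 2.
  by rewrite (le_trans (rip_CS _ _)) // expr2 mulrA ler_wpM2r ?nr_ge0.
apply: (@double_commutant_aux B D T (2 * M)); first exact: ltW.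
- move=> x; rewrite DE ripxx; have := Cb x; rewrite ler_norml => /andP[h _].
  rewrite -(ler_pM2l M2) mulr0 mulrDr mulrA divff ?gt_eqF // mul1r; nra.
- move=> x; rewrite DE ripxx; have := Cb x; rewrite ler_norml => /andP[_ h].
  rewrite -(ler_pM2l M2) mulrDr mulrA divff ?gt_eqF // mul1r; nra.
- move=> x; rewrite hvar_aff mulrA -exprMn divff ?gt_eqF //.
  by rewrite expr1n mul1r.
- by move=> x; rewrite /D !bsaDE !bsaZE !bsa_oneE bsaDr !bsaZr TC.
Qed.

(** The double commutant property is used twice: [C] commutes with itself, hence with [A]; then [A]
    commutes with [C], hence with [B]. *)
Lemma bounded_pair_bcomm A B C : vle A C -> vle B C -> bcomm A B.
Proof.
move=> AC BC; apply: double_commutant BC _ => x; symmetry.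
exact: (double_commutant AC).
Qed.

End DoubleCommutant.

(** * Approximate eigenvalues *)

Section ApproximateEigenvalues.
Variables (R : realType) (H : hilbertType R).
Implicit Types (x y : H) (c : R[i]) (t s : R) (A B C T : bsa H).

Definition apeig A (r : R) :=
  forall e : R, 0 < e -> exists2 u, nr u = 1 & nr (A u - (r%:C)%C *: u) <= e.

Let below (f : H -> H) :=
  exists2 d : R, 0 < d & forall x, d * nr x <= nr (f x).

Lemma not_below (f : H -> H) : (forall l x, f (l *: x) = l *: f x) -> ~ below f ->
  forall e : R, 0 < e -> exists2 u, nr u = 1 & nr (f u) <= e.
Proof.
move=> fZ nb e e0; have := nb; apply: contra_notP => h; exists e => // x.
have [->|x0] := eqVneq x 0; first by rewrite nr0 mulr0 nr_ge0.
have n0 : 0 < nr x by rewrite nr_gt0.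
rewrite -ler_pdivlMr // leNgt; apply/negP => hx; apply: h.
exists (((nr x)^-1%:C)%C *: x); first exact: unitize.
by rewrite fZ nrZ gtr0_norm ?invr_gt0 // mulrC ltW.
Qed.

Lemma below_prod A (r : seq R[i]) :
  (forall z, z \in r -> below (fun x => A x - z *: x)) ->
  below (cpe A (\prod_(z <- r) ('X - z%:P))).
Proof.
elim: r => [|z r IH] h.
  by exists 1 => // x; rewrite big_nil cpeC scale1r mul1r.
have [d d0 hd] := h z (mem_head _ _).
have [|d' d'0 hd'] := IH; first by move=> w hw; apply: h; rewrite inE hw orbT.
exists (d * d'); first exact: mulr_gt0.
move=> x; rewrite big_cons cpeM cpeD cpeX -polyCN cpeC scaleNr -mulrA.
by rewrite (le_trans (ler_wpM2l (ltW d0) (hd' x))).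
Qed.

Lemma Im_le_norm c : `|complex.Im c| <= complex.Re `|c|.
Proof.
case: c => a b; rewrite normc_def /= -[X in X <= _]sqrtr_sqr ler_wsqrtr //.
by rewrite lerDr sqr_ge0.
Qed.

(** [<A u, u>] is real, so the imaginary part of [z] is bounded by [|A u - z u|] for every unit
    vector [u]. *)
Lemma apeig_real A (z : R[i]) : ~ below (fun x => A x - z *: x) ->
  exists2 r : R, z = (r%:C)%C & apeig A r.
Proof.
move=> nb.
have h e : 0 < e -> exists2 u, nr u = 1 & nr (A u - z *: u) <= e.
  apply: not_below nb e => l x.
  by rewrite bsaZr scalerBr !scalerA mulrC.
have im0 : complex.Im z = 0.
  apply/eqP; rewrite -normr_eq0; apply/eqP/le_anti; rewrite normr_ge0 andbT.
  apply/ler_addgt0Pr => e e0; rewrite add0r.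
  have [u u1 hu] := h e e0; apply: le_trans hu.
  have := inner_CS (A u - z *: u) u; rewrite u1 mulr1.
  apply: le_trans.
  rewrite innerBl innerZl inner_xx u1 expr1n mulr1 inner_bsa_xx.
  apply: le_trans (Im_le_norm _).
  by case: z {nb h} => a b /=; rewrite add0r normrN.
have zE : z = ((complex.Re z)%:C)%C by case: z im0 {nb h} => a b /= ->.
by exists (complex.Re z) => // e e0; rewrite -zE; apply: h.
Qed.

(** One half of a spectral mapping theorem: factor [p] over the complex numbers; were all factors
    bounded below, so would be their product. *)
Lemma apeig_root A (p : {poly R[i]}) : ~ below (cpe A p) -> p != 0 ->
  exists2 r : R, p.[(r%:C)%C] = 0 & apeig A r.
Proof.
move=> nb p0; have [r pE] := closed_field_poly_normal p.
have l0 : lead_coef p != 0 by rewrite lead_coef_eq0.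
have [z zr nz] : exists2 z, z \in r & ~ below (fun x => A x - z *: x).
  apply: contra_notP nb => no.
  have [|d d0 hd] := @below_prod A r.
    by move=> z zr; apply: contrapT => nz; apply: no; exists z.
  exists (complex.Re `|lead_coef p| * d).
    by rewrite mulr_gt0 // lt_def Re_norm_ge0 andbT -(inj_eq (@complexI R)) -Re_ge0C ?normr_ge0 // normr_eq0.
  by move=> x; rewrite {2}pE cpeZ nrCZ -mulrA ler_wpM2l ?Re_norm_ge0.
have [t zE ht] := apeig_real nz; exists t => //.
rewrite -zE pE hornerZ horner_prod (big_rem z) //= hornerXsubC subrr mul0r mulr0.
by [].
Qed.

(** Let [m > 0] be the norm of [p(A)]. As the norm is nearly attained, [m^2 - p(A)^2] is not bounded
    below, so this polynomial has an approximate eigenvalue as a root. It is not in [s], where [p]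
    vanishes and the value is [m^2]. *)
Lemma spectral_avoid_aux A (s : seq R) a0 x : a0 \in s ->
  rpe A (\prod_(a <- s) ('X - a%:P)) x != 0 ->
  exists2 r, r \notin s & apeig A r.
Proof.
move=> a0s; set p := \prod_(a <- s) _ => px0; pose B := bsa_poly A p.
have x0 : x != 0 by apply: contraNneq px0 => ->; rewrite -bsa_polyE bsa0r.
have [M M0 hM] := bsa_bound B.
pose E := [set nr (B y) | y in [set y | nr y = 1]].
pose u := ((nr x)^-1%:C)%C *: x.
have u1 : nr u = 1 by exact: unitize.
have hE : has_sup E.
  split; first by exists (nr (B u)), u.
  by exists M => _ [y /= y1 <-]; rewrite -[M]mulr1 -y1; apply: hM.
pose m := sup E.
have Em y : nr y = 1 -> nr (B y) <= m.
  by move=> y1; apply: ub_le_sup; [have [] := hE | exists y].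
have m0 : 0 < m.
  apply: lt_le_trans (Em u u1); rewrite nr_gt0 /u bsaZr scaler_eq0 negb_or px0.
  by rewrite andbT -[0]/((0%:C)%C) (inj_eq (@complexI R)) invr_eq0 nr_eq0.
have Bm y : nr (B y) <= m * nr y.
  have [->|y0] := eqVneq y 0; first by rewrite bsa0r nr0 mulr0.
  have n0 : 0 < nr y by rewrite nr_gt0.
  have := Em _ (unitize y0); rewrite bsaZr nrZ gtr0_norm ?invr_gt0 //.
  by rewrite mulrC ler_pdivrMr.
pose q := (m ^+ 2)%:P - p ^+ 2.
have qE r : r \in s -> q.[r] = m ^+ 2.
  move=> rs; rewrite /q hornerD hornerC hornerN horner_exp.
  by rewrite /p horner_prod (big_rem r) //= hornerXsubC subrr mul0r expr0n subr0.
have nb : ~ below (rpe A q).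
  move=> [d d0 hd].
  (* If [|B y| > m - e], then [|q(A) y|^2 <= m^2 (m^2 - |B y|^2) < 2 m^3 e <= d^2 / 2], against the
     lower bound [d]. *)
  pose e := Num.min (m / 2) (d ^+ 2 / (4 * m ^+ 3)).
  have e0 : 0 < e by rewrite lt_min !divr_gt0 ?exprn_gt0 ?mulr_gt0 ?exprn_gt0.
  have [_ [y /= y1 <-] hy] := sup_adherent e0 hE.
  have e1 : e <= m / 2 by rewrite ge_min lexx.
  have e2 : e * (4 * m ^+ 3) <= d ^+ 2.
    by rewrite -ler_pdivlMr ?mulr_gt0 ?exprn_gt0 // ge_min lexx orbT.
  set b := nr (B y) in hy; pose bb := nr (B (B y)).
  have hy' : m - e < b by [].
  have h2 : d ^+ 2 <= m ^+ 4 + bb ^+ 2 - 2 * (m ^+ 2 * b ^+ 2).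
    have -> : m ^+ 4 + bb ^+ 2 - 2 * (m ^+ 2 * b ^+ 2) = nr (rpe A q y) ^+ 2.
      rewrite rpeB rpeC expr2 rpeM -!bsa_polyE -/B sqnrB nrZ y1 mulr1.
      by rewrite real_normK ?num_real // ripZl ripC bsaS_rip ripxx -exprM.
    by rewrite ler_sqr ?nnegrE ?nr_ge0 ?(ltW d0) // -[d]mulr1 -y1.
  have h1 : bb ^+ 2 <= m ^+ 2 * b ^+ 2.
    rewrite -exprMn ler_sqr ?nnegrE ?nr_ge0 ?mulr_ge0 ?(ltW m0) ?nr_ge0 //.
    exact: Bm.
  have e3 : 0 <= m - e by lra.
  have b1 : (m - e) ^+ 2 < b ^+ 2.
    by rewrite ltr_sqr ?nnegrE ?nr_ge0.
  have h3 : d ^+ 2 <= m ^+ 2 * (m ^+ 2 - b ^+ 2).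
    by lra.
  have h4 : m ^+ 2 - b ^+ 2 < 2 * m * e by nra.
  have h5 : m ^+ 2 * (m ^+ 2 - b ^+ 2) < m ^+ 2 * (2 * m * e).
    by rewrite ltr_pM2l ?exprn_gt0.
  have h6 : m ^+ 2 * (2 * m * e) * 2 = e * (4 * m ^+ 3) by ring.
  have h7 : 0 < m ^+ 2 * (2 * m * e) by rewrite !mulr_gt0 ?exprn_gt0.
  lra.
have q0 : map_poly (real_complex R) q != 0.
  apply/eqP => q0; have /eqP := congr1 (fun w => w.[(a0%:C)%C]) q0.
  rewrite horner_map horner0 -[0]/((0%:C)%C) (inj_eq (@complexI R)) qE //.
  by rewrite sqrf_eq0 gt_eqF.
have [r qr hr] := apeig_root nb q0; exists r => //.
apply/negP => rs; move: qr; rewrite horner_map /= => /complexI.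
by rewrite qE // => /eqP; rewrite sqrf_eq0 gt_eqF.
Qed.

(** For the empty list this is the existence of an approximate eigenvalue: either [A x = 0] and it
    is [0], or the list [[:: 0]] applies. *)
Lemma spectral_avoid A (s : seq R) x :
  rpe A (\prod_(a <- s) ('X - a%:P)) x != 0 ->
  exists2 r, r \notin s & apeig A r.
Proof.
case: s => [|a s]; last by apply: spectral_avoid_aux (mem_head a s).
rewrite big_nil rpe1 => x0.
have [/eqP Ax|Ax] := eqVneq (A x) 0; last first.
  have [|r _ hr] := @spectral_avoid_aux A [:: 0] 0 x (mem_head _ _).
    by rewrite big_seq1 rpeB rpeX rpeC scale0r subr0.
  by exists r.
exists 0 => // e e0; exists (((nr x)^-1%:C)%C *: x); first exact: unitize.
by rewrite scale0r subr0 bsaZr (eqP Ax) scaler0 nr0 ltW.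
Qed.

End ApproximateEigenvalues.

(** * Operators whose down-set is a chain *)

Section TwoLevels.
Variables (R : realType) (H : hilbertType R).
Implicit Types (x y : H) (c : R[i]) (t s d r : R) (A B C F G : bsa H).

Definition quad A d := bsa_poly A ('X ^+ 2 - d%:P * 'X).

Lemma quad_factor A : exists2 M : R, 0 < M & forall d r x,
  nr (quad A d x - ((r ^+ 2 - d * r)%:C)%C *: x) <=
  (M + `|r| + `|d|) * nr (A x - (r%:C)%C *: x).
Proof.
have [M M0 hM] := bsa_bound A; exists M => // d r x.
have -> : quad A d x - ((r ^+ 2 - d * r)%:C)%C *: x =
    rpe A ('X + (r - d)%:P) (A x - (r%:C)%C *: x).
  have -> : A x - (r%:C)%C *: x = rpe A ('X - r%:P) x by rewrite rpeB rpeX rpeC.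
  rewrite -rpeM bsa_polyE -(rpeC A) -rpeB; congr (rpe A _ x).
  rewrite !(polyCB, polyCM, polyC_exp); ring.
rewrite rpeD rpeX rpeC; set z := A x - _.
rewrite (le_trans (nr_triangle _ _)) // nrZ -addrA mulrDl lerD //.
by rewrite ler_wpM2r ?nr_ge0 // ler_normB.
Qed.

(** [A^2 - d A - (m^2 - d m) = (A + m - d) (A - m)], taken at the Rayleigh quotient [m] of [A] at
    [x]: the residual of [quad A d] is at most [K] times the optimal residual of [A]. *)
Lemma quad_below A d : exists2 e : R, 0 < e & vle (e *: quad A d) A.
Proof.
have [M M0 hM] := quad_factor A; have [N N0 hN] := bsa_bound A.
pose K := M + N + `|d|; have K0 : 0 < K by rewrite ltr_wpDr ?addr_gt0.
exists K^-1; first by rewrite invr_gt0.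
apply/vleP => x; have [->|x0] := eqVneq x 0.
  by rewrite /hvar !bsa0r !rip0l.
have p : 0 < nr x ^+ 2 by rewrite exprn_gt0 // nr_gt0.
pose m := rip (A x) x / nr x ^+ 2.
have mN : `|m| <= N.
  rewrite normf_div [X in _ / X]ger0_norm ?sqr_ge0 // ler_pdivrMr //.
  rewrite (le_trans (rip_CS _ _)) // expr2 mulrA ler_wpM2r ?nr_ge0 //.
rewrite hvar_scale exprVn mulrC ler_pdivrMr ?exprn_gt0 // (hvarE A x0) -/m.
rewrite (le_trans (hvar_le _ _ (m ^+ 2 - d * m))) //.
rewrite -[leRHS]mulrA ler_pM2l //.
rewrite [leRHS]mulrC -exprMn ler_sqr ?nnegrE ?mulr_ge0 ?nr_ge0 ?(ltW K0) //.
rewrite (le_trans (hM d m x)) // ler_wpM2r ?nr_ge0 //.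
by rewrite lerD2r lerD2l.
Qed.

(* [quad A (r1 + r2)] takes the same value at [r1] and [r2]. *)
Lemma quad_not_below A d r1 r2 e1 e2 : 0 < e1 -> 
  vle (e1 *: quad A d) (e2 *: quad A (r1 + r2)) ->
  apeig A r1 -> apeig A r2 -> r1 != r2 -> d = r1 + r2.
Proof.
move=> e10 /vleP h a1 a2 r12; have [M M0 hM] := quad_factor A.
set g := quad A (r1 + r2) in h; set f := quad A d in h.
pose k := `|e2| / e1; have k0 : 0 <= k by rewrite divr_ge0 // ltW.
have h' x : hvar x f <= k ^+ 2 * hvar x g.
  rewrite -(ler_pM2l (exprn_gt0 2 e10)) /k expr_div_n real_normK ?num_real //.
  rewrite mulrA [_ * (_ / _)]mulrC mulfVK ?expf_neq0 ?gt_eqF //.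
  by rewrite -!hvar_scale.
(* The difference of the values of [r^2 - d r] at [r1] and [r2]; it is shown to be at most [K e']
   for arbitrarily small [e']. *)
pose D := (r1 - r2) * (r1 + r2 - d).
pose L := M + (`|r1| + `|r2|) + (`|r1 + r2| + `|d|).
have L0 : 0 <= L by do ?apply: addr_ge0; rewrite ?normr_ge0 ?(ltW M0).
pose K := 2 * L + 10 * k * L.
have K0 : 0 <= K by have := mulr_ge0 k0 L0; rewrite /K; lra.
suff D0 : D = 0.
  by move/eqP: D0; rewrite mulf_eq0 !subr_eq0 (negPf r12) /= => /eqP.
apply/eqP; rewrite -normr_eq0; apply/eqP/le_anti; rewrite normr_ge0 andbT.
apply/ler_addgt0Pr => e e0; rewrite add0r.
pose e' := e / (K + 1).
have K1 : 0 < K + 1 by rewrite ltr_wpDl.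
have e'0 : 0 < e' by rewrite divr_gt0.
have [u u1 hu] := a1 e' e'0; have [v v1 hv] := a2 e' e'0.
pose mu := r1 ^+ 2 - (r1 + r2) * r1.
have near r w d' : nr (A w - (r%:C)%C *: w) <= e' -> `|r| <= `|r1| + `|r2| ->
    `|d'| <= `|r1 + r2| + `|d| ->
    nr (quad A d' w - ((r ^+ 2 - d' * r)%:C)%C *: w) <= L * e'.
  move=> hw hr hd; rewrite (le_trans (hM _ _ _)) // ler_pM ?nr_ge0 //.
    by do ?apply: addr_ge0; rewrite ?normr_ge0 ?(ltW M0).
  by rewrite lerD // lerD2l.
have hg1 : nr (g u - (mu%:C)%C *: u) <= L * e'.
  by apply: near => //; rewrite ?lerDl ?lerDr.
have hg2 : nr (g v - (mu%:C)%C *: v) <= L * e'.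
  have -> : mu = r2 ^+ 2 - (r1 + r2) * r2 by rewrite /mu; ring.
  by apply: near => //; rewrite ?lerDl ?lerDr.
have hf r w : nr w = 1 -> nr (A w - (r%:C)%C *: w) <= e' -> `|r| <= `|r1| + `|r2| ->
    `|rip (f w) w - (r ^+ 2 - d * r)| <= L * e'.
  move=> w1 hw hr; have -> : rip (f w) w - (r ^+ 2 - d * r) =
      rip (f w - ((r ^+ 2 - d * r)%:C)%C *: w) w.
    by rewrite ripBl ripZl ripxx w1 expr1n mulr1.
  rewrite (le_trans (rip_CS _ _)) // w1 mulr1; apply: near => //.
  by rewrite lerDr.
have c1 := near_eigenvalues k0 h' mu u1 v1.
have c2 := hf _ _ u1 hu (ler_wpDr (normr_ge0 _) (lexx _)).
have c3 := hf _ _ v1 hv (ler_wpDl (normr_ge0 _) (lexx _)).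
have c4 : `|rip (f u) u - rip (f v) v| <= 5 * k * (L * e' + L * e').
  by apply: le_trans c1 _; apply: ler_wpM2l; [apply: mulr_ge0 | apply: lerD].
have -> : D = (rip (f u) u - rip (f v) v) - (rip (f u) u - (r1 ^+ 2 - d * r1)) +
   (rip (f v) v - (r2 ^+ 2 - d * r2)) by rewrite /D; ring.
rewrite (le_trans (ler_normD _ _)) //.
rewrite (le_trans (lerD (ler_normB _ _) (lexx _))) //.
rewrite (le_trans (lerD (lerD c4 c2) c3)) //.
have -> : 5 * k * (L * e' + L * e') + L * e' + L * e' = K * e' by rewrite /K; ring.
by rewrite /e' mulrCA ler_piMr ?(ltW e0) // ler_pdivrMr // mul1r lerDl.
Qed.

Definition chain_below A := forall B C, vle B A -> vle C A -> vle B C \/ vle C B.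

Definition ntproj F := [/\ isproj F, exists2 x, x != 0 & F x = x &
  exists2 x, x != 0 & F x = 0].

(** If three distinct approximate eigenvalues [a], [b], [c] existed, small multiples of
    [quad A (a + b)] and [quad A (b + c)] would lie below [A]. They are incomparable: the first
    merges [a] with [b], the second [b] with [c]. *)
Lemma chain_below_quad A : chain_below A ->
  exists a b, forall x, rpe A (('X - a%:P) * ('X - b%:P)) x = 0.
Proof.
move=> ch.
have [[x0 hx0]|no] := pselect (exists x, x != 0); last first.
  exists 0, 0 => x; apply/eqP; apply: contra_notT no => h.
  by exists (rpe A (('X - 0%:P) * ('X - 0%:P)) x).
have [|a _ ha] := @spectral_avoid _ _ A [::] x0; first by rewrite big_nil rpe1.
have [h|] := pselect (forall x, rpe A ('X - a%:P) x = 0).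
  by exists a, a => x; rewrite rpeM h.
case/existsNP => x1 /eqP hx1.
have [|b] := @spectral_avoid _ _ A [:: a] x1; first by rewrite big_seq1.
rewrite inE => ab hb.
have [h|] := pselect (forall x, rpe A (('X - a%:P) * ('X - b%:P)) x = 0).
  by exists a, b.
case/existsNP => x2 /eqP hx2.
have [|c] := @spectral_avoid _ _ A [:: a; b] x2.
  by rewrite big_cons big_seq1.
rewrite !inE negb_or => /andP[ca cb] hc.
have [e1 e10 h1] := quad_below A (a + b); have [e2 e20 h2] := quad_below A (b + c).
case: (ch _ _ h1 h2) => h.
  have := quad_not_below e10 h hb hc; rewrite eq_sym cb => /(_ isT).
  by rewrite addrC => /addrI e; rewrite e eqxx in ca.
have := quad_not_below e20 h ha hb; rewrite eq_sym ab => /(_ isT).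
by rewrite addrC => /addIr e; rewrite e eqxx in ca.
Qed.

Lemma proj0 F x : isproj F -> F (x - F x) = 0.
Proof. by move=> pF; rewrite bsaBr pF subrr. Qed.

Lemma ntproj_1B F : ntproj F -> ntproj (bsa_one H - F).
Proof.
move=> [pF [x x0 hx] [y y0 hy]]; split; first exact: isproj_1B.
  by exists y => //; rewrite bsaBE bsa_oneE hy subr0.
by exists x => //; rewrite bsaBE bsa_oneE hx subrr.
Qed.

Lemma veq_1B t F : veq (t *: (bsa_one H - F)) (t *: F).
Proof.
apply: veq_scale; rewrite -opprB; apply: veq_trans (veq_opp _) _.
by rewrite -scaleN1r; apply: veq_aff.
Qed.

(** If the two roots agree, [A] is scalar, since a self-adjoint operator of square zero vanishes.
    Otherwise [(A - a) / (b - a)] is a projection, and a trivial one again makes [A] scalar. *)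
Lemma chain_below_proj A : chain_below A ->
  vle A 0 \/ exists t F, [/\ 0 < t, ntproj F & veq A (t *: F)].
Proof.
move=> /chain_below_quad[a [b h]].
have fE x : rpe A ('X - a%:P) x = A x - (a%:C)%C *: x by rewrite rpeB rpeX rpeC.
have [ab|ab] := eqVneq a b.
  left; apply/vleP => x; rewrite hvar0 (_ : hvar x A = 0) //.
  apply/hvar_eig; exists a; apply/eqP; rewrite -subr_eq0 -fE -nr_eq0.
  rewrite -sqrf_eq0 -ripxx -{1}bsa_polyE bsaS_rip bsa_polyE.
  by rewrite -rpeM {2}ab h rip0r.
pose F := (b - a)^-1 *: (A - a *: bsa_one H).
have ba : b - a != 0 by rewrite subr_eq0 eq_sym.
have AE : A = (b - a) *: F + a *: bsa_one H.
  by rewrite /F scalerA divff // scale1r subrK.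
have pF : isproj F.
  move=> x; pose z := A x - (a%:C)%C *: x.
  have hz : A z = (b%:C)%C *: z.
    apply/eqP; rewrite -subr_eq0; apply/eqP.
    have := h x; rewrite mulrC rpeM fE -/z => <-.
    by rewrite rpeB rpeX rpeC.
  rewrite /F !bsaZE !bsaBE !bsaZE !bsa_oneE -/z bsaZr hz scalerA.
  rewrite [_ *: (_ *: z)]scalerA [(a%:C)%C * _]mulrC -scalerA -scalerA -scalerBr -scalerBl.
  by rewrite -rmorphB scalerA -rmorphM mulVf // scale1r.
have vF : veq A (`|b - a| *: F).
  apply/veqP => x; rewrite {1}AE hvar_aff (hvar_scale x F `|b - a|).
  by rewrite real_normK ?num_real.
have [|no] := pselect (ntproj F).
  by move=> nF; right; exists `|b - a|, F; split; rewrite ?normr_gt0.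
left; apply: vle_trans (proj1 vF) _; apply/vleP => x.
rewrite hvar0 (hvar_scale x F) (_ : hvar x F = 0) ?mulr0 //; apply/hvar_eig.
apply: contra_notP no => no; split=> //.
  have [/eqP Fx|Fx] := eqVneq (F x) 0.
    by case: no; exists 0; rewrite (eqP Fx) scale0r.
  by exists (F x).
have [/eqP Fx|Fx] := eqVneq (x - F x) 0.
  case: no; exists 1; rewrite scale1r; apply/esym/eqP; rewrite -subr_eq0.
  exact: Fx.
by exists (x - F x); rewrite ?proj0.
Qed.

(* An operator all of whose vectors in a range are eigenvectors is scalar
   there, as eigenvectors for distinct eigenvalues are orthogonal. *)
Lemma eig_scalar (P : H -> Prop) A :
  (forall x y, P x -> P y -> P (x + y)) -> (forall x, P x -> eigv A x) ->
  exists s, forall x, P x -> A x = (s%:C)%C *: x.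
Proof.
move=> PD Pe.
have [[x [Px x0]]|no] := pselect (exists x, P x /\ x != 0); last first.
  exists 0 => x Px; have [->|x0] := eqVneq x 0; first by rewrite bsa0r scaler0.
  by case: no; exists x.
have [s hs] := Pe _ Px; exists s => y Py.
have [s' hs'] := Pe _ Py; have [->//|ss'] := eqVneq s s'.
have [->|y0] := eqVneq y 0; first by rewrite bsa0r scaler0.
have o : rip x y = 0.
  have := bsaS_rip A x y; rewrite hs hs' ripZl ripZr => /eqP.
  rewrite -subr_eq0 -mulrBl mulf_eq0 subr_eq0 (negPf ss') /= => /eqP.
  by [].
have [w hw] := Pe _ (PD _ _ Px Py); move: hw; rewrite bsaDr hs hs' scalerDr => hw.
have := congr1 (fun z => rip z x) hw; rewrite !ripE [rip y x]ripC o !mulr0 !addr0.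
move/mulIf; rewrite rip_eq0 => /(_ x0) sw.
have := congr1 (fun z => rip z y) hw; rewrite !ripE o !mulr0 !add0r.
by move/mulIf; rewrite rip_eq0 => /(_ y0) s'w; rewrite s'w -sw.
Qed.

Lemma eigv_two A F : isproj F -> (forall x, F x = x -> eigv A x) ->
  (forall x, F x = 0 -> eigv A x) ->
  exists s t, A = s *: F + t *: (bsa_one H - F).
Proof.
move=> pF h1 h0.
have [|s hs] := @eig_scalar (fun x => F x = x) A _ h1.
  by move=> x y hx hy; rewrite bsaDr hx hy.
have [|t ht] := @eig_scalar (fun x => F x = 0) A _ h0.
  by move=> x y hx hy; rewrite bsaDr hx hy addr0.
exists s, t; apply: bsa_ext => x.
rewrite bsaDE !bsaZE bsaBE bsa_oneE -[in LHS](subrK (F x) x) bsaDr addrC.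
by rewrite hs ?pF // ht ?proj0.
Qed.

Lemma veq_two F s t : veq (s *: F + t *: (bsa_one H - F)) (`|s - t| *: F).
Proof.
have -> : s *: F + t *: (bsa_one H - F) = (s - t) *: F + t *: bsa_one H.
  by rewrite scalerBr scalerBl addrA addrAC.
apply/veqP => x; rewrite hvar_aff hvar_scale.
by rewrite real_normK ?num_real.
Qed.

Lemma below_proj B F t : isproj F -> vle B (t *: F) ->
  exists s, 0 <= s /\ veq B (s *: F).
Proof.
move=> pF h.
have [||s [u BE]] := @eigv_two B F pF.
- by move=> x hx; apply: vle_eig h _; exists t; rewrite bsaZE hx.
- move=> x hx; apply: vle_eig h _; exists 0.
  by rewrite bsaZE hx scaler0 scale0r.
by exists `|s - u|; split=> //; rewrite BE; apply: veq_two.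
Qed.

Lemma vle_scale2 F s t : 0 <= s -> s <= t -> vle (s *: F) (t *: F).
Proof.
move=> s0 st; apply/vleP => x; rewrite !hvar_scale ler_wpM2r ?hvar_ge0 //.
by rewrite ler_sqr // nnegrE // (le_trans s0).
Qed.

Lemma proj_chain F t : isproj F -> chain_below (t *: F).
Proof.
move=> pF B C /(below_proj pF)[s [s0 hs]] /(below_proj pF)[u [u0 hu]].
have [su|us] := leP s u.
  left; apply: vle_trans (proj1 hs) _; apply: vle_trans (proj2 hu).
  exact: vle_scale2.
right; apply: vle_trans (proj1 hu) _; apply: vle_trans (proj2 hs).
exact: vle_scale2 (ltW us).
Qed.

Lemma hvar_ntproj F : ntproj F -> exists x, 0 < hvar x F.
Proof.
move=> [pF [x x0 hx] [y y0 hy]].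
pose u := ((nr x)^-1%:C)%C *: x; pose v := ((nr y)^-1%:C)%C *: y.
have Fu : F u = (1%:C)%C *: u by rewrite scale1r /u bsaZr hx.
have Fv : F v = (0%:C)%C *: v by rewrite scale0r /v bsaZr hy scaler0.
have uv : inner u v = 0 by rewrite -[u]scale1r -Fu bsaS Fv scale0r inner0r.
exists (u + v); rewrite (hvar_eig2 uv (unitize x0) (unitize y0) Fu Fv).
by rewrite subr0 expr1n.
Qed.

Lemma ntproj_not0 F t : ntproj F -> 0 < t -> ~ vle (t *: F) 0.
Proof.
move=> /hvar_ntproj[x hx] t0 /vleP/(_ x); rewrite hvar0 hvar_scale leNgt.
by rewrite mulr_gt0 // exprn_gt0.
Qed.

Lemma ntproj_le F s t : ntproj F -> 0 <= s -> 0 <= t ->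
  vle (s *: F) (t *: F) <-> s <= t.
Proof.
move=> /hvar_ntproj[x hx] s0 t0; split=> [/vleP/(_ x)|]; last exact: vle_scale2.
by rewrite !hvar_scale ler_pM2r // ler_sqr.
Qed.

Lemma ntproj_veq F s t : ntproj F -> 0 <= s -> 0 <= t ->
  veq (s *: F) (t *: F) -> s = t.
Proof.
move=> nF s0 t0 [h1 h2]; apply/le_anti.
by rewrite (proj1 (ntproj_le nF s0 t0) h1) (proj1 (ntproj_le nF t0 s0) h2).
Qed.

Lemma proj_eig01 G x s : isproj G -> x != 0 -> G x = (s%:C)%C *: x ->
  s = 0 \/ s = 1.
Proof.
move=> pG x0 hc; have := pG x; rewrite hc bsaZr hc scalerA -rmorphM => /eqP.
rewrite -subr_eq0 -scalerBl -rmorphB scaler_eq0 (negPf x0) orbF.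
rewrite -[0]/((0%:C)%C) (inj_eq (@complexI R)) -[X in _ - X]mulr1 -mulrBr mulf_eq0.
by rewrite subr_eq0 => /orP[]/eqP; [left | right].
Qed.

(* The four projections that are scalar on the range and on the kernel of [F]
   are [0], [1], [F] and [1 - F]. *)
Lemma ntproj_comparable F G s t : ntproj F -> ntproj G -> 0 < s -> 
  vle (s *: F) (t *: G) -> F = G \/ F = bsa_one H - G.
Proof.
move=> nF [pG [x1 x10 hx1] [x2 x20 hx2]] s0 h.
have eF x : eigv (t *: G) x -> eigv F x.
  move=> e; have [a ha] := vle_eig h e; exists (s^-1 * a).
  by rewrite rmorphM -scalerA -ha bsaZE scalerA -rmorphM mulVf ?gt_eqF // scale1r.
have [||a [b FE]] := @eigv_two F G pG.
- by move=> x hx; apply: eF; exists t; rewrite bsaZE hx.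
- by move=> x hx; apply: eF; exists 0; rewrite bsaZE hx scaler0 scale0r.
have [pF _ _] := nF.
have F1 : F x1 = (a%:C)%C *: x1.
  by rewrite FE bsaDE !bsaZE bsaBE bsa_oneE hx1 subrr scaler0 addr0.
have F2 : F x2 = (b%:C)%C *: x2.
  by rewrite FE bsaDE !bsaZE bsaBE bsa_oneE hx2 subr0 scaler0 add0r.
have := ntproj_not0 nF ltr01; rewrite scale1r.
case: (proj_eig01 pF x10 F1) (proj_eig01 pF x20 F2) FE => -> [] -> ->; rewrite ?scale0r ?scale1r ?add0r ?addr0.
- by case; apply: vle_refl.
- by right.
- by left.
- rewrite addrC subrK; case; apply/vleP => x.
  by rewrite -[bsa_one H]scale1r hvar_scalar hvar0.
Qed.
End TwoLevels.

(** * Rank-one projections characterised by the order *)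

Section RankOne.
Variables (R : realType) (H : hilbertType R).
Implicit Types (x y z : H) (t s r : R) (A B C Q T E F G : bsa H).

Definition oiso (f g : bsa H -> bsa H) :=
  [/\ cancel f g, cancel g f & forall A B, vle A B <-> vle (f A) (f B)].

Lemma oiso_sym f g : oiso f g -> oiso g f.
Proof.
move=> [fK gK h]; split=> // A B.
by rewrite -[A in X in X <-> _]gK -[B in X in X <-> _]gK -h.
Qed.

Lemma oiso_veq f g A B : oiso f g -> veq A B -> veq (f A) (f B).
Proof. by move=> [_ _ h] [h1 h2]; split; apply: (h _ _).1. Qed.

(** All notions from here to [rk1] are stated by [vle] alone, so every order isomorphism transports
    them. Up to equivalence, [tl] singles out the positive multiples of nontrivial projections; for
    these [cub] means commuting, so [bicom A Q T] puts [T] into the double commutant of [A] and [Q],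
    as far as projections can test it. *)
Definition bot A := forall B, vle A B.
Definition tl A := chain_below A /\ ~ bot A.
Definition cmp A B := vle A B \/ vle B A.
Definition cub A B := exists C, vle A C /\ vle B C.
Definition bicom A Q T := forall B, tl B -> cub B A -> cub B Q -> cub B T.

(* For a projection [A] this says that no projection commuting with [A] splits
   both its range and its kernel: the Boolean algebra generated by [A] and [Q]
   has at most three atoms. *)
Definition rk1 A := tl A /\ forall Q T T', tl Q -> tl T -> tl T' -> cub A Q ->
  bicom A Q T -> bicom A Q T' ->
  cmp A Q \/ cmp A T \/ cmp A T' \/ cmp Q T \/ cmp Q T' \/ cmp T T'.

Section Transport.
Variables f g : bsa H -> bsa H.
Hypothesis fg : oiso f g.

Let gf : oiso g f. Proof. exact: oiso_sym. Qed.
Let fK : cancel f g. Proof. by case: fg. Qed.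
Let gK : cancel g f. Proof. by case: fg. Qed.
Let fE A B : vle A B <-> vle (f A) (f B). Proof. by case: fg => _ _ h; exact: h. Qed.
Let gE A B : vle A B <-> vle (g A) (g B). Proof. by case: gf => _ _ h; exact: h. Qed.

Lemma oiso_cmp A B : cmp A B -> cmp (f A) (f B).
Proof. by case=> h; [left | right]; apply: (fE _ _).1. Qed.

Lemma oiso_cub A B : cub A B -> cub (f A) (f B).
Proof. by case=> C [h1 h2]; exists (f C); split; apply: (fE _ _).1. Qed.

Lemma oiso_bot A : bot A -> bot (f A).
Proof. by move=> h B; rewrite -[B]gK; apply: (fE _ _).1. Qed.

Lemma oiso_chain A : chain_below A -> chain_below (f A).
Proof.
move=> h B C; rewrite -[B]gK -[C]gK -!fE => hB hC.
exact: h.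
Qed.
End Transport.

Lemma oiso_tl f g A : oiso f g -> tl A -> tl (f A).
Proof.
move=> fg [h1 h2]; split; first exact: (oiso_chain fg h1).
move=> /(oiso_bot (oiso_sym fg)); have [fK _ _] := fg.
by rewrite fK.
Qed.

Lemma oiso_bicom f g A Q T : oiso f g -> bicom A Q T -> bicom (f A) (f Q) (f T).
Proof.
move=> fg h B tB c1 c2; have [fK gK _] := fg; have gf := oiso_sym fg.
rewrite -[B]gK; apply: (oiso_cub fg); apply: h; first exact: oiso_tl gf tB.
  by rewrite -[A]fK; apply: oiso_cub gf _ _ c1.
by rewrite -[Q]fK; apply: oiso_cub gf _ _ c2.
Qed.

Lemma oiso_rk1 f g A : oiso f g -> rk1 A -> rk1 (f A).
Proof.
move=> fg [tA h]; have gf := oiso_sym fg; have [fK gK _] := fg.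
split; first exact: oiso_tl fg tA.
move=> Q T T' tQ tT tT' cQ bT bT'.
have := h (g Q) (g T) (g T') (oiso_tl gf tQ) (oiso_tl gf tT) (oiso_tl gf tT').
have c1 : cub A (g Q) by rewrite -[A]fK; apply: oiso_cub gf _ _ cQ.
have b1 := oiso_bicom gf bT; have b2 := oiso_bicom gf bT'; rewrite !fK in b1 b2.
move=> /(_ c1 b1 b2) D.
have cf B C : cmp (g B) (g C) -> cmp B C.
  by move/(oiso_cmp fg); rewrite !gK.
have cA B : cmp A (g B) -> cmp (f A) B.
  by rewrite -{1}[A]fK; apply: cf.
by case: D => [/cA|[/cA|[/cA|[/cf|[/cf|/cf]]]]]; tauto.
Qed.

Lemma botP A : bot A <-> vle A 0.
Proof.
split=> [|h B]; first exact.
by apply: vle_trans h _; apply/vleP => x; rewrite hvar0 hvar_ge0.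
Qed.

Lemma cub_sym A B : cub A B -> cub B A.
Proof. by case=> C [? ?]; exists C. Qed.
Lemma cub_veq A A' B : veq A A' -> cub A B -> cub A' B.
Proof. by move=> [_ h] [C [h1 h2]]; exists C; split=> //; apply: vle_trans h1. Qed.
Lemma cmp_sym A B : cmp A B -> cmp B A.
Proof. by case; [right | left]. Qed.
Lemma cmp_veq A A' B : veq A A' -> cmp A B -> cmp A' B.
Proof.
move=> [h1 h2] [h|h]; first by left; apply: vle_trans h.
by right; apply: vle_trans h1.
Qed.

Lemma tlP A : tl A <-> exists t F, [/\ 0 < t, ntproj F & veq A (t *: F)].
Proof.
split=> [[h nb]|[t [F [t0 nF [h1 h2]]]]].
  case: (chain_below_proj h) => // h'; case: nb; exact/botP.
have [pF _ _] := nF; split.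
  by move=> B C hB hC; apply: (proj_chain pF (vle_trans hB h1) (vle_trans hC h1)).
by move/botP => h; apply: ntproj_not0 nF t0 _; apply: vle_trans h.
Qed.

Lemma tl_proj F : ntproj F -> tl F.
Proof.
move=> nF; apply/tlP; exists 1, F; split=> //.
by rewrite scale1r; apply: veq_refl.
Qed.

Lemma bcomm_scale A E t : 0 < t -> bcomm (t *: E) A -> bcomm A E.
Proof.
move=> t0 h x; have := h x; rewrite !bsaZE bsaZr => /(can_inj (scalerK _)) -> //.
by rewrite -[0]/((0%:C)%C) (inj_eq (@complexI R)) gt_eqF.
Qed.

Lemma cub_projP A E t : isproj E -> 0 < t -> cub A (t *: E) <-> bcomm A E.
Proof.
move=> pE t0; split=> [[C [h1 h2]]|h].
  exact: bcomm_scale t0 (bounded_pair_bcomm h2 h1).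
by have [C hC] := upper_bound pE h (ltW t0); exists C.
Qed.

Lemma bcomm_sym A B : bcomm A B -> bcomm B A. Proof. by move=> h x; rewrite h. Qed.

Lemma cub_projE A B E t : isproj E -> 0 < t -> veq B (t *: E) ->
  cub A B <-> bcomm A E.
Proof.
move=> pE t0 h; rewrite -(cub_projP A pE t0); split=> /cub_sym c; apply: cub_sym.
  exact: cub_veq h c.
exact: cub_veq (veq_sym h) c.
Qed.

Lemma cmp_scale F s t : 0 <= s -> 0 <= t -> cmp (s *: F) (t *: F).
Proof.
move=> s0 t0; have [h|/ltW h] := leP s t; [left | right]; exact: vle_scale2.
Qed.

Lemma cmp_proj F G s t : ntproj F -> ntproj G -> 0 < s -> 0 < t ->
  cmp (s *: F) (t *: G) -> F = G \/ F = bsa_one H - G.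
Proof.
move=> nF nG s0 t0 [] h; first exact: ntproj_comparable nF nG s0 h.
case: (ntproj_comparable nG nF t0 h) => ->; first by left.
by right; rewrite opprB addrC subrK.
Qed.

Hypothesis dim3 : forall x y, exists z, [/\ z != 0, inner z x = 0 & inner z y = 0].

Lemma innerC0 x y : inner x y = 0 -> inner y x = 0.
Proof. by move=> h; rewrite innerC h rmorph0. Qed.

Lemma ntproj_pr x : x != 0 -> ntproj (pr x).
Proof.
move=> x0; split; first exact: pr_proj.
  by exists x; rewrite ?pr_self.
have [z [z0 zx _]] := dim3 x x; exists z => //.
exact: pr_orth.
Qed.

(** Passing to complements, all projections involved may be taken to kill [x]. The candidates for
    [T] and [T'] are then [F], [1 - pr x] and [1 - F - pr x]. The first two are comparable to [Q]
    and to [A], so only the third is left for both. *)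
Lemma rk1_pr x : x != 0 -> rk1 (pr x).
Proof.
move=> x0; split; first exact/tl_proj/ntproj_pr.
move=> Q T T' tQ tT tT' cQ bT bT'.
have norm B : tl B -> cub B (pr x) ->
    exists t F, [/\ 0 < t, ntproj F, F x = 0 & veq B (t *: F)].
  move=> /tlP[t [F [t0 nF e]]]; have [pF _ _] := nF => c.
  have hF : bcomm (pr x) F by apply/(cub_projE _ pF t0 e)/cub_sym.
  have [s hs] := (bcomm_pr F x).1 (bcomm_sym hF).
  case: (proj_eig01 pF x0 hs) => s01; rewrite s01 in hs.
    by exists t, F; split=> //; rewrite hs scale0r.
  exists t, (bsa_one H - F); split=> //; first exact: ntproj_1B.
    by rewrite bsaBE bsa_oneE hs scale1r subrr.
  exact: veq_trans e (veq_sym (veq_1B _ _)).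
have cx : cub (pr x) (pr x) by exists (pr x); split; apply: vle_refl.
have tx : tl (pr x) by exact/tl_proj/ntproj_pr.
have [q [F [q0 nF Fx eQ]]] := norm Q tQ (cub_sym cQ).
have [pF [w w0 Fw] _] := nF.
have split3 B : tl B -> bicom (pr x) Q B -> exists t G,
    [/\ 0 < t, ntproj G, veq B (t *: G) &
        [\/ G = F, G = bsa_one H - pr x | G = bsa_one H - F - pr x]].
  move=> tB bB; have cB := bB _ tx cx cQ.
  have [t [G [t0 nG Gx eB]]] := norm B tB (cub_sym cB).
  have [pG _ _] := nG; exists t, G; split=> //.
  (* The hypothesis [bicom] is probed with the rank-one projections [pr z], which commute with
     [pr x] and [F]. *)
  have eG z : z != 0 -> inner z x = 0 -> eigv F z -> eigv G z.
    move=> z0 zx eF; apply/bcomm_pr/bcomm_sym.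
    apply/(cub_projE _ pG t0 eB); apply: bB; first exact/tl_proj/ntproj_pr.
      rewrite -[X in cub _ X]scale1r; apply/(cub_projP _ (pr_proj x) ltr01).
      by apply/bcomm_pr; exists 0; rewrite scale0r pr_orth // innerC0.
    by apply/(cub_projE _ pF q0 eQ)/bcomm_sym/bcomm_pr.
  have eG' z : inner z x = 0 -> eigv F z -> eigv G z.
    have [->|] := eqVneq z 0; first by exists 0; rewrite bsa0r scaler0.
    exact: eG.
  have Fox z : inner (F z) x = 0 by rewrite bsaS Fx inner0r.
  have [||a ha] := @eig_scalar _ _ (fun z => F z = z) G.
  - by move=> y z hy hz; rewrite bsaDr hy hz.
  - by move=> z hz; apply: eG'; [rewrite -hz | exists 1; rewrite scale1r].
  have [||b hb] := @eig_scalar _ _ (fun z => F z = 0 /\ inner z x = 0) G.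
  - move=> y z [hy oy] [hz oz].
    by rewrite bsaDr hy hz innerDl oy oz !addr0.
  - by move=> z [hz oz]; apply: eG' => //; exists 0; rewrite scale0r.
  have FP z : F (pr x z) = 0 by rewrite prE bsaZr Fx scaler0.
  have dec z : z = F z + (z - F z - pr x z) + pr x z.
    by rewrite -addrA subrK addrC subrK.
  have rest z : F (z - F z - pr x z) = 0 /\ inner (z - F z - pr x z) x = 0.
    rewrite !bsaBr pF FP subrr subr0; split=> //.
    by rewrite !innerBl Fox bsaS pr_self subr0 subrr.
  have GE z : G z = (a%:C)%C *: F z + (b%:C)%C *: (z - F z - pr x z).
    rewrite {1}(dec z) bsaDr [G (F z + _)]bsaDr (ha _ (pF z)) (hb _ (rest z)) prE bsaZr Gx scaler0.
    by rewrite addr0.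
  have aE := proj_eig01 pG w0 (ha _ Fw).
  (* The third piece [1 - F - pr x] may vanish, and then [b] is arbitrary. *)
  have [bE|noz] : (b = 0 \/ b = 1) \/ forall z, z - F z - pr x z = 0.
    have [h|] := pselect (forall z, z - F z - pr x z = 0); first by right.
    case/existsNP => z /eqP hz; left.
    exact: proj_eig01 pG hz (hb _ (rest z)).
  - case: aE bE GE => -> [] -> GE.
    + have [_ [z z0 hz] _] := nG; move: hz; rewrite GE !scale0r addr0 => /esym/eqP.
      by rewrite (negPf z0).
    + constructor 3; apply: bsa_ext => z.
      by rewrite GE scale0r add0r scale1r.
    + constructor 1; apply: bsa_ext => z.
      by rewrite GE scale0r addr0 scale1r.
    + constructor 2; apply: bsa_ext => z.
      rewrite GE !scale1r !bsaBE bsa_oneE addrA [F z + _]addrC.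
      by rewrite subrK.
  - case: aE GE => -> GE.
      have [_ [z z0 hz] _] := nG; move: hz.
      by rewrite GE noz scaler0 scale0r addr0 => /esym/eqP; rewrite (negPf z0).
    constructor 1; apply: bsa_ext => z.
    by rewrite GE noz scaler0 scale1r addr0.
have [t [G [t0 nG eT hG]]] := split3 T tT bT.
have [t' [G' [t'0 nG' eT' hG']]] := split3 T' tT' bT'.
have cmpE B C s s' D : 0 < s -> 0 < s' -> veq B (s *: D) -> veq C (s' *: D) ->
    cmp B C.
  move=> s0 s'0 e e'; apply: cmp_veq (veq_sym e) _; apply: cmp_sym.
  apply: cmp_veq (veq_sym e') _; apply: cmp_scale; exact: ltW.
have ex : veq (pr x) (1 *: pr x) by rewrite scale1r; apply: veq_refl.
case: hG => hG; rewrite hG in eT.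
- do 3![right]; left; exact: cmpE q0 t0 eQ eT.
- right; left; apply: cmpE ltr01 t0 ex _.
  exact: veq_trans eT (veq_1B _ _).
case: hG' => hG'; rewrite hG' in eT'.
- do 4![right]; left; exact: cmpE q0 t'0 eQ eT'.
- right; right; left; apply: cmpE ltr01 t'0 ex _.
  exact: veq_trans eT' (veq_1B _ _).
do 5![right]; exact: cmpE t0 t'0 eT eT'.
Qed.

(** Otherwise choose [x] in the range and [y] in the kernel of [P] and put [F = pr x + pr y]. Then
    [pr x = P F] and [pr y = F - P F] lie in the double commutant of [P] and [F], while [P], [F],
    [pr x], [pr y] are pairwise incomparable; a vector [w] orthogonal to [x] and [y] keeps [F] from
    being the identity. *)
Lemma rk1P A : rk1 A -> exists x t, [/\ x != 0, 0 < t & veq A (t *: pr x)].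
Proof.
move=> [/tlP[t [P [t0 nP eA]]] h]; have [pP [x x0 Px] [y y0 Py]] := nP.
apply: contrapT => no.
have no1 z : z != 0 -> P <> pr z.
  by move=> z0 e; apply: no; exists z, t; rewrite -e.
have no2 z : z != 0 -> P <> bsa_one H - pr z.
  move=> z0 e; apply: no; exists z, t; split=> //; rewrite e in eA.
  exact: veq_trans eA (veq_1B _ _).
have xy : inner x y = 0 by rewrite -Px bsaS Py inner0r.
have yx := innerC0 xy.
have x_y z : pr x (pr y z) = 0 by rewrite [pr y z]prE bsaZr pr_orth ?scaler0.
have y_x z : pr y (pr x z) = 0 by rewrite [pr x z]prE bsaZr pr_orth ?scaler0.
have [w [w0 wx wy]] := dim3 x y.
pose F := pr x + pr y.
have FE z : F z = pr x z + pr y z by [].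
have Fx : F x = x by rewrite FE pr_self pr_orth ?addr0.
have Fy : F y = y by rewrite FE pr_self pr_orth ?add0r.
have Fw : F w = 0 by rewrite FE !pr_orth ?addr0.
have pF : isproj F.
  by move=> z; rewrite [F z]FE bsaDr !FE !pr_proj x_y y_x addr0 add0r.
have nF : ntproj F by split=> //; [exists x | exists w].
have Pprx z : P (pr x z) = pr x z by rewrite prE bsaZr Px.
have Ppry z : P (pr y z) = 0 by rewrite prE bsaZr Py scaler0.
have PF z : P (F z) = pr x z by rewrite FE bsaDr Pprx Ppry addr0.
have cPx : bcomm P (pr x) by apply/bcomm_pr; exists 1; rewrite scale1r.
have cPy : bcomm P (pr y) by apply/bcomm_pr; exists 0; rewrite scale0r.
have cPF : bcomm P F by move=> z; rewrite FE bsaDr cPx cPy.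
have e1 E : veq E (1 *: E) by rewrite scale1r; apply: veq_refl.
have bic E : isproj E -> (forall G, bcomm G P -> bcomm G F -> bcomm G E) ->
    bicom A F E.
  move=> pE hE B /tlP[s [G [s0 nG eB]]] c1 c2; have [pG _ _] := nG.
  have cGP : bcomm G P.
    apply: (bcomm_scale t0); apply/(cub_projE _ pG s0 eB).
    exact: cub_veq eA (cub_sym c1).
  have cGF : bcomm G F by apply/bcomm_sym/(cub_projE _ pG s0 eB)/cub_sym.
  apply/cub_sym/(cub_projE _ pG s0 eB)/bcomm_sym; exact: hE.
have bx : bicom A F (pr x).
  apply: bic; first exact: pr_proj.
  by move=> G cP cF z; rewrite -!PF cP cF.
have by' : bicom A F (pr y).
  apply: bic; first exact: pr_proj.
  have E z : pr y z = F z - P (F z) by rewrite PF FE addrC addKr.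
  by move=> G cP cF z; rewrite !E bsaBr cP cF.
have cA : cub A F.
  apply: cub_veq (veq_sym eA) _; apply: cub_sym.
  by apply/(cub_projP _ pP t0).
have tF := tl_proj nF; have nx := ntproj_pr x0; have ny := ntproj_pr y0.
have key E D s : ntproj E -> ntproj D -> 0 < s -> cmp (s *: E) D ->
    E = D \/ E = bsa_one H - D.
  by move=> nE nD s0; rewrite -[D in cmp _ D]scale1r; apply: cmp_proj.
have key1 E D : ntproj E -> ntproj D -> cmp E D -> E = D \/ E = bsa_one H - D.
  by move=> nE nD; rewrite -[E in cmp E _]scale1r; apply: key.
have app E D z : E = D -> E z = D z by move=> ->.
have z_0 z v : z != 0 -> v = z -> v = 0 -> False.
  by move=> z0 -> zE; rewrite zE eqxx in z0.
case: (h F (pr x) (pr y) tF (tl_proj nx) (tl_proj ny) cA bx by').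
  case/(cmp_veq eA)/(key _ _ _ nP nF t0) => /app e.
    by apply: (z_0 y (F y)) => //; rewrite -e.
  by apply: (z_0 x (P x)) => //; rewrite e bsaBE bsa_oneE Fx subrr.
case.
  case/(cmp_veq eA)/(key _ _ _ nP nx t0); first exact: no1.
  exact: no2.
case.
  case/(cmp_veq eA)/(key _ _ _ nP ny t0); first exact: no1.
  exact: no2.
have prxy : pr x y = 0 by exact: pr_orth.
have pryx : pr y x = 0 by exact: pr_orth.
case.
  case/(key1 _ _ nF nx) => /app e.
    by apply: (z_0 y (F y)) => //; rewrite e.
  by apply: (z_0 x (F x)) => //; rewrite e bsaBE bsa_oneE pr_self subrr.
case.
  case/(key1 _ _ nF ny) => /app e.
    by apply: (z_0 x (F x)) => //; rewrite e.
  by apply: (z_0 y (F y)) => //; rewrite e bsaBE bsa_oneE pr_self subrr.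
case/(key1 _ _ nx ny) => /app e.
  by apply: (z_0 x (pr x x)); rewrite ?pr_self // -[LHS]pr_self e.
apply: (z_0 w w) => //; have := e w.
by rewrite !pr_orth // bsaBE bsa_oneE pr_orth // subr0.
Qed.

Lemma oiso_pr f g x : oiso f g -> x != 0 ->
  exists y t, [/\ y != 0, 0 < t & veq (f (pr x)) (t *: pr y)].
Proof. by move=> fg x0; apply/rk1P/(oiso_rk1 fg)/rk1_pr. Qed.

Lemma cub_prP A x t : 0 < t -> cub A (t *: pr x) <-> eigv A x.
Proof.
move=> t0; rewrite (cub_projP A (pr_proj x) t0); exact: bcomm_pr.
Qed.

End RankOne.

(** * Cauchy's equation and endomorphisms of the complex field *)

Section Additive.
Variable R : realType.

(** Positivity gives monotonicity; enclosing [n x] between consecutive integers bounds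
    [|f x - f 1 * x|] by [f 1 / n]. *)
Lemma additive_nonneg_linear (f : R -> R) :
  (forall x y, 0 <= x -> 0 <= y -> f (x + y) = f x + f y) ->
  (forall x, 0 <= x -> 0 <= f x) -> forall x, 0 <= x -> f x = f 1 * x.
Proof.
move=> fD f0 x x0.
have fMn n y : 0 <= y -> f (n%:R * y) = n%:R * f y.
  move=> y0; elim: n => [|n IH].
    rewrite !mul0r; apply: (addIr (f 0)); rewrite -fD ?lexx //.
    by rewrite !addr0 add0r.
  by rewrite -natr1 !mulrDl !mul1r fD ?mulr_ge0 // IH.
have mono y z : 0 <= y -> y <= z -> f y <= f z.
  move=> y0 yz; rewrite -[z](subrK y) fD ?subr_ge0 // lerDr.
  by apply: f0; rewrite subr_ge0.
apply/eqP; rewrite -subr_eq0; apply/eqP; apply: (@eq0_of_sqr_small _ _ (f 1 ^+ 2)).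
move=> n n0; pose k := Num.truncn (n%:R * x).
have nx0 : 0 <= n%:R * x by rewrite mulr_ge0.
have k1 : k%:R <= n%:R * x by rewrite truncn_le.
have k2 : n%:R * x <= k.+1%:R by apply/ltW/truncnS_gt.
have := mono _ _ (ler0n _ _) k1; have := mono _ _ nx0 k2.
rewrite -[k.+1%:R]mulr1 -[k%:R]mulr1 !fMn // -natr1 => h1 h2.
have f1 := f0 1 ler01.
have nR : 1 <= n%:R :> R by rewrite ler1n.
have nR0 : 0 < n%:R :> R by rewrite ltr0n.
set d := f x - f 1 * x.
have e1 : n%:R * d <= f 1 by rewrite /d; nra.
have e2 : - f 1 <= n%:R * d by rewrite /d; nra.
rewrite ler_pdivlMr // -(ler_pM2l nR0).
have -> : n%:R * (d ^+ 2 * n%:R) = (n%:R * d) ^+ 2 by ring.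
rewrite (le_trans (_ : _ <= f 1 ^+ 2)) ?ler_peMl ?sqr_ge0 //.
by rewrite -[leLHS]real_normK ?num_real // ler_sqr ?nnegrE // ler_norml e1 e2.
Qed.

(* Such an endomorphism fixes the reals, being monotone on them. *)
Lemma conj_ring_endo (tau : R[i] -> R[i]) :
  {morph tau : x y / x + y} -> {morph tau : x y / x * y} -> tau 1 = 1 ->
  (forall x, tau (Num.conj x) = Num.conj (tau x)) ->
  tau =1 id \/ tau =1 Num.conj.
Proof.
move=> tD tM t1 tC.
have tR r : tau (r%:C)%C = ((complex.Re (tau (r%:C)%C))%:C)%C.
  by rewrite RRe_real //; apply/CrealP; rewrite -tC conjR.
pose f r := complex.Re (tau (r%:C)%C).
have fD x y : f (x + y) = f x + f y.
  by rewrite /f rmorphD tD ReD.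
have f_ge0 x : 0 <= x -> 0 <= f x.
  move=> x0; rewrite /f -[x]sqr_sqrtr // expr2 rmorphM tM tR ReMr.
  by rewrite /= -expr2 sqr_ge0.
have f1 : f 1 = 1 by rewrite /f rmorph1 t1.
have f0 : f 0 = 0 by apply: (addIr (f 0)); rewrite -fD !add0r.
have fE x : f x = x.
  have h y : 0 <= y -> f y = y.
    by move/(additive_nonneg_linear (fun x y _ _ => fD x y) f_ge0) ->; rewrite f1 mul1r.
  have [/h //|/ltW x0] := leP 0 x.
  apply: (addIr (f (- x))); rewrite -fD subrr f0 h ?subrr //.
  by rewrite oppr_ge0.
have tE r : tau (r%:C)%C = (r%:C)%C by rewrite tR -/(f r) fE.
pose i : R[i] := Num.imaginary.
have ti : tau i = i \/ tau i = - i.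
  have : tau i ^+ 2 == i ^+ 2.
    rewrite expr2 -tM -expr2 sqrCi -[1]/((1%:C)%C).
    by rewrite -rmorphN tE.
  by rewrite eqf_sqr => /orP[]/eqP; [left | right].
have dec (z : R[i]) : z = ((complex.Re z)%:C)%C + i * ((complex.Im z)%:C)%C.
  exact: complexE.
case: ti => ti; [left | right] => z; rewrite [z in tau z]dec tD tM !tE ti.
  by rewrite -dec.
rewrite [in RHS](dec z) rmorphD rmorphM /= !conjR; congr (_ + _ * _).
by rewrite conjCi.
Qed.
End Additive.

(** * Uhlhorn's theorem on maps preserving orthogonality *)

Section Uhlhorn.
Variables (R : realType) (H : hilbertType R).
Implicit Types (x y z w : H) (c d : R[i]).

Lemma inner_eq0 x : inner x x = 0 -> x = 0.
Proof.
rewrite inner_xx => /eqP; rewrite -[0]/((0%:C)%C) (inj_eq (@complexI R)).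
by rewrite sqrf_eq0 nr_eq0 => /eqP.
Qed.

(** By Gram-Schmidt, the part [z'] of [z] outside the span is orthogonal to [x] and [y], hence to
    [z] and so to itself. This turns preservation of orthogonality into preservation of planes. *)
Lemma span2 x y z :
  (forall w, inner w x = 0 -> inner w y = 0 -> inner w z = 0) ->
  exists c d, z = c *: x + d *: y.
Proof.
move=> h; pose y' := y - pr x y; pose z' := z - pr x z - pr y' z.
have oy' : inner y' x = 0 by rewrite innerBl bsaS pr_self subrr.
have ox' : inner x y' = 0 by exact: innerC0.
have oz'x : inner z' x = 0.
  by rewrite !innerBl bsaS pr_self subrr sub0r bsaS pr_orth // inner0r oppr0.
have oz'y' : inner z' y' = 0.
  by rewrite !innerBl bsaS pr_orth // inner0r subr0 bsaS pr_self subrr.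
have oz'y : inner z' y = 0.
  have -> : y = y' + pr x y by rewrite subrK.
  by rewrite innerDr oz'y' add0r prE innerZr oz'x mulr0.
have z'0 : z' = 0.
  apply: inner_eq0; rewrite {2}/z' !innerBr h // !prE !innerZr oz'x oz'y'.
  by rewrite !mulr0 !subr0.
have zE : z = pr y' z + pr x z by apply/eqP; rewrite -subr_eq -subr_eq0 -/z' z'0.
have [b hb] : exists b, pr y' z = b *: y' by eexists; apply: prE.
have [c hc] : exists c, pr x z = c *: x by eexists; apply: prE.
have [a ha] : exists a, pr x y = a *: x by eexists; apply: prE.
exists (c - b * a), b; rewrite [LHS]zE hb hc /y' ha.
by rewrite scalerBr scalerBl scalerA addrAC [RHS]addrC addrA.
Qed.

Hypothesis dim3 : forall x y, exists z, [/\ z != 0, inner z x = 0 & inner z y = 0].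

Variable g : H -> H.
Hypothesis g_neq0 : forall x, x != 0 -> g x != 0.
Hypothesis g_orth : forall x y, x != 0 -> y != 0 ->
  inner x y = 0 <-> inner (g x) (g y) = 0.
Hypothesis g_surj : forall y, y != 0 -> exists x c, x != 0 /\ y = c *: g x.

Let g_span x y z c d : x != 0 -> y != 0 -> z != 0 -> z = c *: x + d *: y ->
  exists c' d', g z = c' *: g x + d' *: g y.
Proof.
move=> x0 y0 z0 zE; apply: span2 => w wx wy.
have [->|w0] := eqVneq w 0; first by rewrite inner0l.
have [v [a [v0 wE]]] := g_surj w0.
have a0 : a != 0 by apply: contraNneq w0 => a0; rewrite wE a0 scale0r.
have hv u : u != 0 -> inner w (g u) = 0 -> inner v u = 0.
  move=> u0; rewrite wE innerZl => /eqP; rewrite mulf_eq0 (negPf a0) /=.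
  by move/eqP/(g_orth v0 u0).
rewrite wE innerZl (_ : inner (g v) (g z) = 0) ?mulr0 //.
by apply: (g_orth v0 z0).1; rewrite zE innerDr !innerZr !hv // !mulr0 addr0.
Qed.

Let g_line x c : x != 0 -> c != 0 -> exists c', g (c *: x) = c' *: g x.
Proof.
move=> x0 c0; have cx0 : c *: x != 0 by rewrite scaler_eq0 negb_or c0.
have [|a [b hab]] := @g_span x x (c *: x) c 0 x0 x0 cx0.
  by rewrite scale0r addr0.
by exists (a + b); rewrite scalerDl.
Qed.

Let g_inj x y c : x != 0 -> y != 0 -> g x = c *: g y -> exists d, x = d *: y.
Proof.
move=> x0 y0 e; have [|a [b hab]] := @span2 y y x.
  move=> w wy _; have [->|w0] := eqVneq w 0; first by rewrite inner0l.
  apply: (g_orth w0 x0).2; rewrite e innerZr ((g_orth w0 y0).1 wy).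
  exact: mulr0.
by exists (a + b); rewrite scalerDl.
Qed.

Variable e : H.
Hypothesis e1 : nr e = 1.

Let ee : inner e e = 1. Proof. by rewrite inner_xx e1 expr1n. Qed.
Let e0 : e != 0. Proof. by rewrite -nr_gt0 e1. Qed.

Variable f : H.
Hypothesis ff : inner f f = 1.
Hypothesis gE : exists2 c, c != 0 & g e = c *: f.

Let M x := inner x e = 0.

Let M0 : M 0. Proof. by rewrite /M inner0l. Qed.
Let MD x y : M x -> M y -> M (x + y).
Proof. by rewrite /M innerDl => -> ->; rewrite addr0. Qed.
Let MZ c x : M x -> M (c *: x).
Proof. by rewrite /M innerZl => ->; rewrite mulr0. Qed.
Let MN x : M x -> M (- x). Proof. by rewrite -scaleN1r; apply: MZ. Qed.

Let ex_neq0 x : M x -> e + x != 0.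
Proof.
move=> Mx; apply/eqP => h; have := congr1 (fun z => inner z e) h.
by rewrite innerDl ee Mx addr0 inner0l => /eqP; rewrite oner_eq0.
Qed.

Lemma gef x : x != 0 -> (inner (g x) f == 0) = (inner x e == 0).
Proof.
move=> x0; have [c c0 gc] := gE.
have -> : (inner (g x) f == 0) = (inner (g x) (g e) == 0).
  by rewrite gc innerZr mulf_eq0 fmorph_eq0 (negPf c0).
by apply/eqP/eqP => h; [exact: (g_orth x0 e0).2 | exact: (g_orth x0 e0).1].
Qed.

Lemma den_neq0 x : M x -> inner (g (e + x)) f != 0.
Proof.
move=> Mx; rewrite gef ?ex_neq0 // innerDl ee Mx addr0; exact: oner_neq0.
Qed.

(* The line of [e + x] is mapped to the line of [f + T x]. *)
Variable T : H -> H.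
Hypothesis Tg : forall x, M x -> g (e + x) = inner (g (e + x)) f *: (f + T x).
Hypothesis Tf : forall x, M x -> inner (T x) f = 0.
Hypothesis T0 : T 0 = 0.

Let fT x : M x -> inner f (T x) = 0.
Proof. by move/Tf/innerC0. Qed.

(** As [x] lies in the plane of [e + x] and [e], its image lies in the plane of [f + T x] and [f];
    being orthogonal to [f], it is a multiple of [T x]. *)
Let gT x : M x -> x != 0 -> exists2 c, c != 0 & g x = c *: T x.
Proof.
move=> Mx x0.
have [|a [b hab]] := @g_span (e + x) e x 1 (-1) (ex_neq0 Mx) e0 x0.
  by rewrite scale1r scaleN1r addrC addKr.
have [c c0 gc] := gE; rewrite Tg // gc !scalerA in hab.
set p := a * _ in hab; set q := b * c in hab.
have pq : p + q = 0.
  have := congr1 (fun z => inner z f) hab.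
  rewrite innerDl !innerZl innerDl ff Tf // addr0 !mulr1 => <-.
  by apply/eqP; rewrite gef // Mx.
have gxE : g x = p *: T x.
  by rewrite hab scalerDr addrAC -scalerDl pq scale0r add0r.
exists p => //; apply: contraNneq (g_neq0 x0) => p0.
by rewrite gxE p0 scale0r.
Qed.

Let T_neq0 x : M x -> x != 0 -> T x != 0.
Proof.
move=> Mx x0; have [c c0 gc] := gT Mx x0; apply: contraNneq (g_neq0 x0) => h.
by rewrite gc h scaler0.
Qed.

(** For [x] and [y] orthogonal to [e] the condition says that [e + x] and [e + y] are orthogonal,
    which [g] preserves. *)
Let T_m1 x y : M x -> M y -> inner x y = -1 -> inner (T x) (T y) = -1.
Proof.
move=> Mx My xy; have : inner (g (e + x)) (g (e + y)) = 0.
  apply: (g_orth (ex_neq0 Mx) (ex_neq0 My)).1; rewrite innerDl !innerDr ee Mx (innerC0 My) xy.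
  by rewrite addr0 add0r subrr.
rewrite Tg // [g (e + y)]Tg // innerZl innerZr => /eqP.
rewrite !mulf_eq0 (negPf (den_neq0 Mx)) /= fmorph_eq0 (negPf (den_neq0 My)) /=.
rewrite innerDl !innerDr ff Tf // fT // addr0 add0r addrC addr_eq0.
by move/eqP.
Qed.

Let T_orth x y : M x -> M y -> inner x y = 0 -> inner (T x) (T y) = 0.
Proof.
move=> Mx My xy.
have [->|x0] := eqVneq x 0; first by rewrite T0 inner0l.
have [->|y0] := eqVneq y 0; first by rewrite T0 inner0r.
have [c c0 gc] := gT Mx x0; have [d d0 gd] := gT My y0.
have /eqP := (g_orth x0 y0).1 xy; rewrite gc gd innerZl innerZr.
by rewrite !mulf_eq0 (negPf c0) fmorph_eq0 (negPf d0) => /eqP.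
Qed.

Let indep x y := [/\ M x, M y, x != 0, y != 0 & forall c, y <> c *: x].

Let indepC x y : indep x y -> indep y x.
Proof.
move=> [Mx My x0 y0 h]; split=> // c xE; apply: (h c^-1).
have c0 : c != 0 by apply: contraNneq x0 => c0; rewrite xE c0 scale0r.
by rewrite xE scalerA mulVf // scale1r.
Qed.

Let T_indep x y c d : indep x y -> c *: T x = d *: T y -> c = 0 /\ d = 0.
Proof.
move=> [Mx My x0 y0 h] E; have [a a0 ga] := gT Mx x0; have [b b0 gb] := gT My y0.
have d0 : d = 0.
  apply/eqP/negPn/negP => d0.
  have TyE : T y = (d^-1 * c) *: T x by rewrite -scalerA E scalerA mulVf // scale1r.
  have [|k hk] := @g_inj y x (b * (d^-1 * c) / a) y0 x0.
    by rewrite gb TyE ga !scalerA mulfVK.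
  exact: h hk.
move/eqP: E; rewrite d0 scale0r scaler_eq0 (negPf (T_neq0 Mx x0)) orbF => /eqP.
by [].
Qed.

(** [e + x + y] lies in the plane of [e + x] and [y]. Exchanging [x] and [y] and comparing
    coefficients then gives additivity. *)
Let TD_half x y : indep x y -> exists d, T (x + y) = T x + d *: T y.
Proof.
move=> [Mx My x0 y0 h].
have [|a [b hab]] :=
    @g_span (e + x) y (e + (x + y)) 1 1 (ex_neq0 Mx) y0 (ex_neq0 (MD Mx My)).
  by rewrite !scale1r addrA.
have [c c0 gc] := gT My y0.
rewrite (Tg (MD Mx My)) (Tg Mx) gc !scalerA in hab.
set p := inner _ f in hab; set q := a * _ in hab; set s := b * c in hab.
have p0 : p != 0 by apply/den_neq0/MD.
have pq : p = q.
  have := congr1 (fun z => inner z f) hab.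
  rewrite innerDl !innerZl !innerDl ff (Tf (MD Mx My)) (Tf Mx) (Tf My).
  by rewrite !addr0 mulr0 addr0 !mulr1.
exists (p^-1 * s); apply: (addrI f); rewrite addrA -[f + T (x + y)]scale1r.
rewrite -{1}(mulVf p0) -scalerA hab -pq scalerDr scalerA mulVf // scale1r.
by rewrite scalerA.
Qed.

Let TD_indep x y : indep x y -> T (x + y) = T x + T y.
Proof.
move=> h; have [d hd] := TD_half h; have [c hc] := TD_half (indepC h).
have E : T y + c *: T x = T x + d *: T y by rewrite -hc -hd [y + x]addrC.
have E1 : c *: T x = T x + d *: T y - T y by rewrite -E addrAC subrr add0r.
have := @T_indep x y (c - 1) (d - 1) h.
rewrite !scalerBl !scale1r E1 => /(_ _)[|_ /eqP].
  by rewrite addrAC [T x + _]addrC addrK.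
by rewrite subr_eq0 => /eqP d1; rewrite hd d1 scale1r.
Qed.

Let perp x : exists z, [/\ M z, z != 0 & inner z x = 0].
Proof. by have [z [z0 ze zx]] := dim3 e x; exists z. Qed.

Let indep_perp x z c : M x -> M z -> x != 0 -> z != 0 -> inner z x = 0 ->
  indep x (c *: x + z).
Proof.
move=> Mx Mz x0 z0 zx.
have k d : c *: x + z <> d *: x.
  move=> h; have zE : z = (d - c) *: x by rewrite scalerBl -h addrC addKr.
  by move/eqP: z0; apply; apply: inner_eq0; rewrite {2}zE innerZr zx mulr0.
split=> //; first exact: MD (MZ c Mx) Mz.
by apply/eqP => h; apply: (k 0); rewrite h scale0r.
Qed.

Let indep_perp0 x z : M x -> M z -> x != 0 -> z != 0 -> inner z x = 0 ->
  indep x z.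
Proof.
move=> Mx Mz x0 z0 zx; have := indep_perp 0 Mx Mz x0 z0 zx.
by rewrite scale0r add0r.
Qed.

Let TD x y : M x -> M y -> T (x + y) = T x + T y.
Proof.
move=> Mx My.
have [->|x0] := eqVneq x 0; first by rewrite T0 !add0r.
have [->|y0] := eqVneq y 0; first by rewrite T0 !addr0.
have [h|] := pselect (forall c, y <> c *: x); first exact: TD_indep.
case/existsNP => c /contrapT yE.
(* For dependent [x] and [y] a direction [z] orthogonal to both is adjoined, so that each sum to be
   split has independent terms. *)
have [z [Mz z0 zx]] := perp x.
apply: (addIr (T z)).
have zy : inner z y = 0 by rewrite yE innerZr zx mulr0.
have i2 : indep x (y + z) by rewrite yE; apply: indep_perp.
rewrite -addrA -(TD_indep (indep_perp0 My Mz y0 z0 zy)) -(TD_indep i2) addrA.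
have [->|xy0] := eqVneq (x + y) 0; first by rewrite T0 !add0r.
have zxy : inner z (x + y) = 0 by rewrite innerDr zx zy addr0.
by rewrite (TD_indep (indep_perp0 (MD Mx My) Mz xy0 z0 zxy)).
Qed.

Let TN x : M x -> T (- x) = - T x.
Proof.
move=> Mx; apply: (addIr (T x)); rewrite -(TD (MN Mx) Mx) !addNr; exact: T0.
Qed.

Let T_line x c : M x -> x != 0 -> exists d, T (c *: x) = d *: T x.
Proof.
move=> Mx x0; have [->|c0] := eqVneq c 0.
  by exists 0; rewrite !scale0r T0.
have [a a0 ga] := gT Mx x0.
have [|b b0 gb] := gT (MZ c Mx); first by rewrite scaler_eq0 negb_or c0.
have [d hd] := g_line x0 c0; rewrite gb ga scalerA in hd.
exists (b^-1 * (d * a)).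
by rewrite -scalerA -hd scalerA mulVf // scale1r.
Qed.

(** Comparing [T (c (x + y))] with the sum of the images shows that the factor belonging to [c] is
    the same in independent directions. *)
Let T_ratio x y c d d' : indep x y -> T (c *: x) = d *: T x ->
  T (c *: y) = d' *: T y -> d = d'.
Proof.
move=> h; have [Mx My x0 y0 hxy] := h => hd hd'.
have xy0 : x + y != 0.
  by apply/eqP => E; apply: (hxy (-1)); rewrite scaleN1r -(addrK x y) [y + x]addrC E sub0r.
have [b hb] := T_line c (MD Mx My) xy0.
rewrite scalerDr (TD (MZ c Mx) (MZ c My)) (TD Mx My) hd hd' scalerDr in hb.
have := @T_indep x y (d - b) (b - d') h; rewrite !scalerBl => /(_ _)[].
  by apply/eqP; rewrite subr_eq eq_sym addrAC subr_eq hb addrC.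
by move=> /eqP; rewrite subr_eq0 => /eqP -> /eqP; rewrite subr_eq0 => /eqP.
Qed.

Variable v : H.
Hypotheses (Mv : M v) (v1 : nr v = 1).

Let v0 : v != 0. Proof. by rewrite -nr_gt0 v1. Qed.

Let T_unit x : M x -> nr x = 1 -> inner (T x) (T x) = 1.
Proof.
move=> Mx x1; apply: oppr_inj; rewrite -innerNr -(TN Mx).
by apply: T_m1 => //; [apply: MN | rewrite innerNr inner_xx x1 expr1n].
Qed.

Let tau c := inner (T (c *: v)) (T v).

Let T_tau_v c : T (c *: v) = tau c *: T v.
Proof.
have [d hd] := T_line c Mv v0.
by rewrite /tau hd innerZl T_unit // mulr1.
Qed.

Let TZ x c : M x -> T (c *: x) = tau c *: T x.
Proof.
move=> Mx; have [->|x0] := eqVneq x 0; first by rewrite scaler0 T0 scaler0.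
have key y z : indep y z -> T (c *: y) = tau c *: T y -> T (c *: z) = tau c *: T z.
  move=> h hy; have [_ Mz _ z0 _] := h; have [d hd] := T_line c Mz z0.
  by rewrite hd (T_ratio h hy hd).
have [h|] := pselect (indep v x); first exact: key h (T_tau_v c).
have [z [Mz z0 zv]] := perp v.
have iz : indep v z by exact: indep_perp0.
move=> nvx; have [k xE] : exists k, x = k *: v.
  apply: contra_notP nvx => no; split=> // k hk; apply: no.
  by exists k.
apply: (@key z x) (key _ _ iz (T_tau_v c)).
apply/indepC/indep_perp0 => //; by rewrite xE innerZr zv mulr0.
Qed.

Let tauD : {morph tau : c d / c + d}.
Proof.
by move=> c d; rewrite /tau scalerDl (TD (MZ c Mv) (MZ d Mv)) innerDl.
Qed.
Let tauM : {morph tau : c d / c * d}.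
Proof.
move=> c d; rewrite {1}/tau -scalerA (TZ c (MZ d Mv)) T_tau_v.
by rewrite !innerZl T_unit // mulr1.
Qed.
Let tau1 : tau 1 = 1. Proof. by rewrite /tau scale1r T_unit. Qed.
Let tau0 : tau 0 = 0. Proof. by rewrite /tau scale0r T0 inner0l. Qed.
Let tauV c : c != 0 -> tau c^-1 = (tau c)^-1.
Proof.
move=> c0; have h : tau c * tau c^-1 = 1 by rewrite -tauM divff.
have t0 : tau c != 0 by apply/eqP => t0; move/eqP: h; rewrite t0 mul0r eq_sym oner_eq0.
by apply: (mulfI t0); rewrite h divff.
Qed.
(** The vectors [c v] and [- (1 / conj c) v] have inner product [-1], which [T] preserves. *)
Let tauC c : tau (Num.conj c) = Num.conj (tau c).
Proof.
have [->|c0] := eqVneq c 0; first by rewrite rmorph0 tau0 rmorph0.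
have cc0 : Num.conj c != 0 by rewrite fmorph_eq0.
have : inner (T (c *: v)) (T ((- (Num.conj c)^-1) *: v)) = -1.
  apply: T_m1; [exact: MZ | exact: MZ |].
  rewrite innerZl innerZr rmorphN fmorphV /= conjCK inner_xx v1 expr1n.
  by rewrite mulr1 mulrN divff.
rewrite scaleNr (TN (MZ _ Mv)) innerNr !T_tau_v innerZl innerZr T_unit // mulr1.
move/oppr_inj; rewrite tauV // fmorphV /= => h.
have t0 : Num.conj (tau (Num.conj c)) != 0.
  by apply/eqP => t0; move/eqP: h; rewrite t0 invr0 mulr0 eq_sym oner_eq0.
apply: (can_inj conjCK); rewrite conjCK; symmetry.
by rewrite -[LHS](mulfVK t0) h mul1r.
Qed.

Let tau_cases : tau =1 id \/ tau =1 Num.conj.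
Proof. exact: conj_ring_endo. Qed.

Let tauR (r : R) : tau (r%:C)%C = (r%:C)%C.
Proof. by case: tau_cases => ->; rewrite ?conjR. Qed.
Let tauK : involutive tau.
Proof. by case: tau_cases => h c; rewrite !h // conjCK. Qed.

Let T_xx x : M x -> inner (T x) (T x) = inner x x.
Proof.
move=> Mx; have [->|x0] := eqVneq x 0; first by rewrite T0.
have n0 : nr x != 0 by rewrite nr_eq0.
pose u := ((nr x)^-1%:C)%C *: x.
have xE : x = ((nr x)%:C)%C *: u by rewrite scalerA -rmorphM divff // scale1r.
have Mu : M u by apply: MZ.
rewrite {1 2}xE (TZ _ Mu) tauR innerZl innerZr conjR T_unit ?unitize // mulr1.
by rewrite inner_xx -rmorphM.
Qed.

Let T_inner x y : M x -> M y -> inner (T x) (T y) = tau (inner x y).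
Proof.
move=> Mx My; have [->|x0] := eqVneq x 0; first by rewrite T0 !inner0l tau0.
have xx0 : inner x x != 0 by apply: contra_neq x0 => /inner_eq0.
have [a aE] : exists a, a * inner x x = inner y x.
  by exists (inner y x / inner x x); rewrite mulfVK.
have [w [-> Mw wx]] : exists w, [/\ y = a *: x + w, M w & inner x w = 0].
  exists (y - a *: x); split; first by rewrite addrC subrK.
    exact: MD My (MN (MZ a Mx)).
  by apply: innerC0; rewrite innerBl innerZl aE subrr.
rewrite (TD (MZ a Mx) Mw) (TZ a Mx) !innerDr (T_orth Mx Mw wx) wx !addr0 !innerZr.
by rewrite tauM tauC T_xx // inner_xx tauR.
Qed.

(** The [tau]-semilinear extension of [T] from the complement of [e] to the whole space, sending [e]
    to [f]. *)
Let U z := tau (inner z e) *: f + T (z - inner z e *: e).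

Let MU z : M (z - inner z e *: e).
Proof. by rewrite /M innerBl innerZl ee mulr1 subrr. Qed.

Let UL c x y : U (c *: x + y) = tau c *: U x + U y.
Proof.
rewrite /U innerDl innerZl.
have -> : c *: x + y - (c * inner x e + inner y e) *: e =
    c *: (x - inner x e *: e) + (y - inner y e *: e).
  by rewrite scalerBr scalerA scalerDl opprD addrACA.
rewrite (TD (MZ c (MU x)) (MU y)) (TZ c (MU x)) tauD tauM scalerDl scalerDr scalerA.
by rewrite addrACA.
Qed.

Let UU x y : inner (U x) (U y) = tau (inner x y).
Proof.
rewrite /U innerDl !innerDr !innerZl !innerZr ff (Tf (MU x)) (fT (MU y)) (T_inner (MU x) (MU y)).
rewrite !mulr0 addr0 add0r mulr1 -tauC -tauM -tauD; congr tau.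
rewrite innerBl !innerBr !innerZl !innerZr ee -!innerC; ring.
Qed.

Let U_inj : injective U.
Proof.
move=> x y h; apply/eqP; rewrite -subr_eq0; apply/eqP/inner_eq0.
have U0 : U (x - y) = 0.
  by rewrite -[x - y]addrC -scaleN1r UL h -[-1]/(-(1%:C)%C) -rmorphN tauR rmorphN scaleN1r addNr.
by have := UU (x - y) (x - y); rewrite U0 inner0l => /(congr1 tau); rewrite tauK tau0.
Qed.

Let UZ c x : U (c *: x) = tau c *: U x.
Proof.
have U0 : U 0 = 0 by rewrite /U inner0l tau0 !scale0r subr0 add0r T0.
by rewrite -[c *: x]addr0 UL U0 addr0.
Qed.

Let gU x : x != 0 -> exists c, g x = c *: U x.
Proof.
move=> x0; have [a0|a0] := eqVneq (inner x e) 0.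
  have [c _ hc] := gT a0 x0; exists c.
  by rewrite /U a0 tau0 !scale0r add0r subr0.
pose w := (inner x e)^-1 *: (x - inner x e *: e).
have Mw : M w by apply: MZ.
have xE : x = inner x e *: (e + w).
  by rewrite scalerDr scalerA divff // scale1r addrC subrK.
have [c hc] := g_line (ex_neq0 Mw) a0.
have t0 : tau (inner x e) != 0.
  by apply/eqP => t0; move/eqP: a0; apply; rewrite -[LHS]tauK t0 tau0.
have Uw : U (e + w) = f + T w.
  by rewrite /U innerDl ee Mw addr0 tau1 !scale1r [e + w]addrC addrK.
have Ux : U x = tau (inner x e) *: U (e + w) by rewrite {1}xE UZ.
rewrite {1}xE hc Tg // -Uw scalerA.
exists (c * inner (g (e + w)) f / tau (inner x e)).
by rewrite Ux scalerA mulfVK.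
Qed.

Let U_surj y : exists x, U x = y.
Proof.
have [->|y0] := eqVneq y 0.
  by exists 0; have := UZ 0 0; rewrite scale0r tau0 scale0r.
have [x [c [x0 yE]]] := g_surj y0; have [d hd] := gU x0.
by exists (tau (c * d) *: x); rewrite UZ tauK yE hd scalerA.
Qed.

Lemma uhlhorn_aux : exists W : unitary_or_antiunitary H,
  forall x, x != 0 -> exists c, g x = c *: W x.
Proof.
have [V hV] := choice U_surj.
have VK : cancel U V by move=> x; apply: U_inj; rewrite hV.
have hUV : unitary U V \/ antiunitary U V.
  case: tau_cases => ht; [left | right]; split=> //.
  - by move=> c x y; rewrite UL ht.
  - by move=> x y; rewrite -{1}[y]hV UU ht.
  - by move=> c x y; rewrite UL ht.
  - move=> x; rewrite !nrE; congr (_%:C)%C; apply/eqP.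
    rewrite -(@eqrXn2 _ 2) ?nr_ge0 // -(inj_eq (@complexI R)) -!inner_xx UU.
    by rewrite inner_xx tauR.
by exists (UnitaryOrAntiunitary hUV).
Qed.

End Uhlhorn.

Lemma uhlhorn (R : realType) (H : hilbertType R)
  (dim3 : forall x y : H, exists z, [/\ z != 0, inner z x = 0 & inner z y = 0])
  (g : H -> H) (g_neq0 : forall x, x != 0 -> g x != 0)
  (g_orth : forall x y, x != 0 -> y != 0 ->
    inner x y = 0 <-> inner (g x) (g y) = 0)
  (g_surj : forall y, y != 0 -> exists x c, x != 0 /\ y = c *: g x) :
  exists W : unitary_or_antiunitary H,
    forall x, x != 0 -> exists c, g x = c *: W x.
Proof.
have [z [z0 _ _]] := dim3 0 0.
pose e := ((nr z)^-1%:C)%C *: z; have e1 : nr e = 1 by exact: unitize.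
have [y [y0 ye _]] := dim3 e e.
pose v := ((nr y)^-1%:C)%C *: y; have v1 : nr v = 1 by exact: unitize.
have Mv : inner v e = 0 by rewrite /v innerZl ye mulr0.
have e0 : e != 0 by rewrite -nr_gt0 e1.
have ge0 := g_neq0 _ e0.
pose f := ((nr (g e))^-1%:C)%C *: g e.
have ff : inner f f = 1 by rewrite inner_xx unitize // expr1n.
have gE : exists2 c, c != 0 & g e = c *: f.
  have n0 : nr (g e) != 0 by rewrite nr_eq0.
  exists ((nr (g e))%:C)%C; first by rewrite -[0]/((0%:C)%C) (inj_eq (@complexI R)).
  by rewrite scalerA -rmorphM divff // scale1r.
clearbody f e v.
(* The line of [g (e + x)] is represented by its vector whose component along [f] is [f] itself. *)
pose T x := (inner (g (e + x)) f)^-1 *: g (e + x) - f.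
have den x : inner x e = 0 -> inner (g (e + x)) f != 0.
  exact: (den_neq0 g_orth e1 gE).
have Tg x : inner x e = 0 -> g (e + x) = inner (g (e + x)) f *: (f + T x).
  by move=> Mx; rewrite [f + _]addrC subrK scalerA divff ?den // scale1r.
have Tf x : inner x e = 0 -> inner (T x) f = 0.
  by move=> Mx; rewrite innerBl innerZl mulVf ?den // ff subrr.
have T0 : T 0 = 0.
  have [c c0 gc] := gE; rewrite /T addr0 gc innerZl ff mulr1 scalerA mulVf //.
  by rewrite scale1r subrr.
exact: (@uhlhorn_aux R H dim3 g g_neq0 g_orth g_surj e e1 f ff gE T Tg Tf T0 v Mv v1).
Qed.

(** * Conjugation by unitary and antiunitary operators *)

Section Conjugation.
Variables (R : realType) (H : hilbertType R).
Implicit Types (x y z : H) (t s r : R) (A B C : bsa H) (U : unitary_or_antiunitary H).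

Lemma uaK U : cancel U (ua_adj U).
Proof. by case: U => u v [] []. Qed.

Lemma ua_adjK U : cancel (ua_adj U) U.
Proof. by case: U => u v [] []. Qed.

Lemma ua_add U x y : U (x + y) = U x + U y.
Proof.
case: U => u v /= [[l _ _ _]|[l _ _ _]].
  by have := l 1 x y; rewrite !scale1r.
by have := l 1 x y; rewrite rmorph1 !scale1r.
Qed.

Lemma ua_scaleR U r x : U ((r%:C)%C *: x) = (r%:C)%C *: U x.
Proof.
have U0 : U 0 = 0 by apply: (addIr (U 0)); rewrite -ua_add !add0r.
rewrite -[_ *: x]addr0 -[RHS]addr0 -[in RHS]U0; move: U0.
case: U => u v /= [[l _ _ _]|[l _ _ _]] _; rewrite l //.
by rewrite conjR.
Qed.

Lemma ua_rip U x y : rip (U x) (U y) = rip x y.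
Proof.
case: U => u v /= [[_ h uK _]|h].
  by rewrite /rip h uK.
by rewrite ripC /rip (antiunitary_inner h).
Qed.

Lemma ua_nr U x : nr (U x) = nr x.
Proof.
apply/eqP; rewrite -(@eqrXn2 _ 2) ?nr_ge0 //.
by rewrite -!ripxx ua_rip.
Qed.

Lemma bsa_conjE U A x : bsa_conj U A x = U (A (ua_adj U x)).
Proof. by []. Qed.

Lemma hvar_conj U A x : hvar x (bsa_conj U A) = hvar (ua_adj U x) A.
Proof.
have e y : rip (U y) x = rip y (ua_adj U x) by rewrite -{1}[x](ua_adjK U) ua_rip.
by rewrite /hvar bsa_conjE ua_nr e ua_nr.
Qed.

Lemma ua_adj_adj U x : ua_adj (ua_adj U) x = U x.
Proof. by case: U. Qed.

Lemma bsa_conjK U : cancel (bsa_conj U) (bsa_conj (ua_adj U)).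
Proof.
by move=> A; apply: bsa_ext => x; rewrite !bsa_conjE ua_adj_adj !uaK.
Qed.

Lemma bsa_conj_adjK U : cancel (bsa_conj (ua_adj U)) (bsa_conj U).
Proof.
by move=> A; apply: bsa_ext => x; rewrite !bsa_conjE ua_adj_adj !ua_adjK.
Qed.

Lemma vle_conj U A B : vle A B <-> vle (bsa_conj U A) (bsa_conj U B).
Proof.
rewrite !vleP; split=> h x; first by rewrite !hvar_conj.
by have := h (U x); rewrite !hvar_conj uaK.
Qed.

Lemma veq_conj U A B : veq A B -> veq (bsa_conj U A) (bsa_conj U B).
Proof. by move=> [h1 h2]; split; apply: (vle_conj U _ _).1. Qed.

Lemma bsa_conjZ U t A : bsa_conj U (t *: A) = t *: bsa_conj U A.
Proof. by apply: bsa_ext => x; rewrite bsaZE !bsa_conjE bsaZE ua_scaleR. Qed.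

Lemma bsa_conj_pr U x : bsa_conj (ua_adj U) (pr (U x)) = pr x.
Proof.
apply: bsa_ext => z; rewrite bsa_conjE ua_adj_adj !prE ua_nr.
case: U => u v /= [[l h uK vK]|h].
  have [lv _ _ _] := unitary_adj (And4 l h uK vK).
  have v0 : v 0 = 0 by have := lv (-1) 0 0; rewrite scaler0 addr0 scaleN1r addNr.
  by rewrite -[_ *: u x]addr0 lv uK v0 addr0 h uK.
have [lv _ vK uK] := antiunitary_adj h.
have v0 : v 0 = 0.
  by have := lv (-1) 0 0; rewrite scaler0 addr0 rmorphN rmorph1 scaleN1r addNr.
rewrite -[_ *: u x]addr0 lv uK v0 addr0 (antiunitary_inner h).
by rewrite rmorphM fmorphV /= conjR -innerC.
Qed.

Lemma oiso_conj f g U : oiso f g ->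
  oiso (fun A => bsa_conj (ua_adj U) (f A)) (fun A => g (bsa_conj U A)).
Proof.
move=> [fK gK h]; split=> [A|A|A B].
- by rewrite bsa_conj_adjK fK.
- by rewrite gK bsa_conjK.
- by rewrite -vle_conj; exact: h.
Qed.

End Conjugation.

(** * The action of an order isomorphism on lines *)

Section Wigner.
Variables (R : realType) (H : hilbertType R).
Implicit Types (x y z : H) (t s r : R) (A B C : bsa H).
Hypothesis dim3 : forall x y : H, exists z, [/\ z != 0, inner z x = 0 & inner z y = 0].

Lemma cmp_pr x y s t : x != 0 -> y != 0 -> 0 < s -> 0 < t ->
  cmp (s *: pr x) (t *: pr y) -> exists c, y = c *: x.
Proof.
move=> x0 y0 s0 t0 /(cmp_proj (ntproj_pr dim3 x0) (ntproj_pr dim3 y0) s0 t0)[] e.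
  by apply/pr_line; rewrite e pr_self.
have [z [z0 zx zy]] := dim3 x y.
have := congr1 (fun F : bsa H => F z) e.
by rewrite bsaBE bsa_oneE !pr_orth // subr0 => /esym/eqP; rewrite (negPf z0).
Qed.

Lemma pr_scale c x : c != 0 -> pr (c *: x) = pr x.
Proof.
move=> c0; apply: bsa_ext => z; have [->|x0] := eqVneq x 0.
  by rewrite !prE !scaler0.
rewrite !prE -!inner_xx !innerZr innerZl scalerA; congr (_ *: _).
have xx0 : inner x x != 0 by apply: contra_neq x0 => /inner_eq0.
have cc0 : Num.conj c != 0 by rewrite fmorph_eq0.
by field; rewrite c0 xx0 cc0.
Qed.

(** Rank-one projections commute only if their lines are orthogonal or equal, and equality of the
    lines amounts to comparability. *)
Lemma orth_pr x y s t : x != 0 -> y != 0 -> 0 < s -> 0 < t ->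
  inner x y = 0 <-> cub (s *: pr x) (t *: pr y) /\ ~ cmp (s *: pr x) (t *: pr y).
Proof.
move=> x0 y0 s0 t0; split=> [xy|[/(cub_prP _ _ t0)]].
  split; first by apply/(cub_prP _ _ t0); exists 0; rewrite bsaZE pr_orth ?scaler0 ?scale0r // innerC0.
  move/(cmp_pr x0 y0 s0 t0) => [c yE].
  by move/eqP: y0; apply; apply: inner_eq0; rewrite {1}yE innerZl xy mulr0.
move=> [r hr] nc; apply/eqP/negPn/negP => xy; apply: nc.
have sC : (s%:C)%C != 0 :> R[i].
  by rewrite -[0]/((0%:C)%C) (inj_eq (@complexI R)) gt_eqF.
have yx : inner y x != 0 by apply: contraNneq xy => /innerC0 ->.
have xE : exists c, x = c *: y.
  rewrite bsaZE prE scalerA in hr.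
  set a := _ * _ in hr; have a0 : a != 0.
    by rewrite !mulf_neq0 ?invr_eq0 ?nr2C_neq0.
  by exists (a^-1 * (r%:C)%C); rewrite -scalerA -hr scalerA mulVf // scale1r.
have [c cE] := xE; have c0 : c != 0.
  by apply: contraNneq x0 => c0; rewrite cE c0 scale0r.
rewrite cE pr_scale //; apply: cmp_scale; exact: ltW.
Qed.

Theorem oiso_wigner f g : oiso f g -> exists W : unitary_or_antiunitary H,
  forall x, x != 0 -> exists2 t, 0 < t & veq (f (pr x)) (t *: pr (W x)).
Proof.
move=> fg; have gf := oiso_sym fg; have [fK gK _] := fg.
have ex x : exists y, x != 0 -> y != 0 /\
    exists2 t, 0 < t & veq (f (pr x)) (t *: pr y).
  have [->|x0] := eqVneq x 0; first by exists 0.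
  have [y [t [y0 t0 h]]] := oiso_pr dim3 fg x0.
  by exists y => _; split=> //; exists t.
have [G hG] := choice ex.
have cmp_f A B : cmp A B <-> cmp (f A) (f B).
  by split=> [|/(oiso_cmp gf)]; [exact: oiso_cmp fg _ _ | rewrite !fK].
have cub_f A B : cub A B <-> cub (f A) (f B).
  by split=> [|/(oiso_cub gf)]; [exact: oiso_cub fg _ _ | rewrite !fK].
have cmpV A A' B B' : veq A A' -> veq B B' -> cmp A B -> cmp A' B'.
  by move=> h h' /(cmp_veq h)/cmp_sym/(cmp_veq h')/cmp_sym.
have cubV A A' B B' : veq A A' -> veq B B' -> cub A B -> cub A' B'.
  by move=> h h' /(cub_veq h)/cub_sym/(cub_veq h')/cub_sym.
have G0 x : x != 0 -> G x != 0 by move=> x0; have [] := hG x x0.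
have Gorth x y : x != 0 -> y != 0 -> inner x y = 0 <-> inner (G x) (G y) = 0.
  move=> x0 y0; have [Gx [s s0 hs]] := hG x x0; have [Gy [t t0 ht]] := hG y y0.
  rewrite (orth_pr x0 y0 ltr01 ltr01) (orth_pr Gx Gy s0 t0) !scale1r.
  rewrite cub_f cmp_f; split=> -[h1 h2]; split.
  - exact: cubV hs ht h1.
  - by move=> h; apply: h2; apply: cmpV (veq_sym hs) (veq_sym ht) h.
  - exact: cubV (veq_sym hs) (veq_sym ht) h1.
  - by move=> h; apply: h2; apply: cmpV hs ht h.
have Gsurj y : y != 0 -> exists x c, x != 0 /\ y = c *: G x.
  move=> y0; have [x [s [x0 s0 h]]] := oiso_pr dim3 gf y0.
  have [Gx [t t0 ht]] := hG x x0.
  have h1 : veq (pr y) (f (s *: pr x)) by rewrite -{1}[pr y]gK; apply: oiso_veq fg h.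
  (* The inverse isomorphism yields only some multiple [s *: pr x]; it is comparable to [pr x],
     which is enough to identify the line. *)
  have h2 : cmp (f (pr x)) (f (s *: pr x)).
    apply: (cmp_f _ _).1; rewrite -{1}[pr x]scale1r; apply: cmp_scale => //; exact: ltW.
  have h3 := cmpV _ _ _ _ ht (veq_sym h1) h2.
  rewrite -[pr y]scale1r in h3.
  have [c hc] := cmp_pr Gx y0 t0 ltr01 h3.
  by exists x, c.
have [W hW] := uhlhorn dim3 G0 Gorth Gsurj.
exists W => x x0; have [Gx [t t0 ht]] := hG x x0; exists t => //.
have [c cE] := hW x x0; have c0 : c != 0.
  by apply: contraNneq Gx => c0; rewrite cE c0 scale0r.
by rewrite cE pr_scale // in ht.
Qed.

Definition eig_iso (f g : bsa H -> bsa H) :=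
  oiso f g /\ forall A x, eigv A x <-> eigv (f A) x.

Lemma eig_iso_sym f g : eig_iso f g -> eig_iso g f.
Proof.
move=> [fg h]; split; first exact: oiso_sym.
by have [_ gK _] := fg => A x; rewrite [X in _ <-> X]h gK.
Qed.

(* [x] is an eigenvector of [A] iff [A] and [pr x] have a common upper bound. *)
Lemma oiso_eig f g :
  oiso f g -> (forall x, x != 0 -> exists2 t, 0 < t & veq (f (pr x)) (t *: pr x)) ->
  eig_iso f g.
Proof.
move=> fg h; split=> // A x; have gf := oiso_sym fg; have [fK _ _] := fg.
have [->|x0] := eqVneq x 0.
  by split=> _; exists 0; rewrite bsa0r scaler0.
have [t t0 ht] := h x x0.
have e1 := cub_prP A x ltr01; rewrite scale1r in e1.
rewrite -e1 -(cub_prP (f A) x t0); split=> [/(oiso_cub fg)/cub_sym c|c].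
  exact/cub_sym/(cub_veq ht).
have : cub (f A) (f (pr x)) by apply/cub_sym/(cub_veq (veq_sym ht))/cub_sym.
by move/(oiso_cub gf); rewrite !fK.
Qed.

End Wigner.

(** * Combinations of orthogonal projections and the gaps of their levels *)

Section Resolutions.
Variables (R : realType) (H : hilbertType R).
Implicit Types (x y z : H) (t s r : R) (A B C F : bsa H).

(** Here [a] and [b] are exactly [s] apart. The point [c], at least [t >= s > 0] away from both,
    cannot lie between them, so its distance to the farther one is at least [s + t]. *)
Lemma gap_bound (a b c s t q : R) : 0 < s -> s <= t ->
  s <= `|a - b| -> t <= `|c - a| -> t <= `|c - b| ->
  `|a - b| <= s -> `|c - a| <= q -> `|c - b| <= q -> s + t <= q.
Proof.
by case: (ger0P (a - b)); case: (ger0P (c - a)); case: (ger0P (c - b)); lra.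
Qed.

Definition resolution (I : finType) (P : I -> bsa H) :=
  [/\ forall i, isproj (P i), forall i j x, i != j -> P i (P j x) = 0 &
      forall x, \sum_i P i x = x].

Definition lc (I : finType) (P : I -> bsa H) (a : I -> R) : bsa H :=
  \sum_i a i *: P i.

Section OneResolution.
Variables (I : finType) (P : I -> bsa H).
Hypothesis rP : resolution P.

Let pP i : isproj (P i). Proof. by case: rP. Qed.
Let oP i j x : i != j -> P i (P j x) = 0. Proof. by case: rP => _ h _; apply: h. Qed.
Let sP x : \sum_i P i x = x. Proof. by case: rP => _ _. Qed.

Lemma lcE a x : lc P a x = \sum_i ((a i)%:C)%C *: P i x.
Proof. exact: bsa_sumE. Qed.

Lemma res_fix i j x : P i x = x -> P j x = if j == i then x else 0.
Proof.
move=> h; case: eqVneq => [->//|ji].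
by rewrite -h oP.
Qed.

Lemma lc_eig a i x : P i x = x -> lc P a x = ((a i)%:C)%C *: x.
Proof.
move=> h; rewrite lcE (bigD1 i) //= h big1 ?addr0 // => j ji.
by rewrite (res_fix _ h) (negPf ji) scaler0.
Qed.

Lemma P_lc a i x : P i (lc P a x) = ((a i)%:C)%C *: P i x.
Proof.
rewrite lcE bsa_sumr (bigD1 i) //= bsaZr pP big1 ?addr0 // => j ji.
by rewrite bsaZr oP ?scaler0 // eq_sym.
Qed.

Let p x i := nr (P i x) ^+ 2.

Lemma rip_lc a x : rip (lc P a x) x = \sum_i a i * p x i.
Proof.
rewrite lcE rip_suml; apply: eq_bigr => i _.
by rewrite ripZl -[P i x]pP bsaS_rip ripxx.
Qed.

Lemma lc1 : lc P (fun=> 1) = bsa_one H.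
Proof.
apply: bsa_ext => x; rewrite lcE -[RHS]sP; apply: eq_bigr => i _.
by rewrite scale1r.
Qed.

Lemma nr_lc a x : nr (lc P a x) ^+ 2 = \sum_i a i ^+ 2 * p x i.
Proof.
rewrite -ripxx -bsaS_rip -rip_lc; congr (rip _ x).
rewrite [LHS]lcE [RHS]lcE; apply: eq_bigr => i _.
by rewrite P_lc scalerA -rmorphM.
Qed.

(** The variance of a discrete law as a sum over pairs; it depends on the levels only through their
    gaps, so comparing gaps suffices for the order. *)
Lemma hvar_lc a x :
  2 * hvar x (lc P a) = \sum_i \sum_j (a i - a j) ^+ 2 * (p x i * p x j).
Proof.
have -> : \sum_i \sum_j (a i - a j) ^+ 2 * (p x i * p x j) =
   \sum_i ((a i ^+ 2 * p x i) * \sum_j p x j + p x i * \sum_j a j ^+ 2 * p x j -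
     2 * (a i * p x i * \sum_j a j * p x j)).
  apply: eq_bigr => i _; rewrite !mulr_sumr -big_split -sumrB.
  by apply: eq_bigr => j _ /=; ring.
rewrite sumrB big_split /= -!mulr_sumr -!mulr_suml /hvar rip_lc nr_lc.
have -> : nr x ^+ 2 = \sum_i p x i.
  have := nr_lc (fun=> 1) x; rewrite lc1 bsa_oneE => ->.
  by apply: eq_bigr => i _; rewrite expr1n mul1r.
ring.
Qed.

Definition dle (a b : I -> R) := forall i j, `|a i - a j| <= `|b i - b j|.

Lemma dle_vle a b : dle a b -> vle (lc P a) (lc P b).
Proof.
move=> h; apply/vleP => x; rewrite -(@ler_pM2l _ 2) // !hvar_lc.
apply: ler_sum => i _; apply: ler_sum => j _.
apply: ler_wpM2r; first by rewrite mulr_ge0 ?sqr_ge0.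
by rewrite -[leLHS]real_normK ?num_real // -[leRHS]real_normK ?num_real // ler_sqr ?nnegrE.
Qed.

Lemma eigv_lc B : (forall i x, P i x = x -> eigv B x) -> exists b, B = lc P b.
Proof.
move=> h; have hb i : exists s, forall x, P i x = x -> B x = (s%:C)%C *: x.
  apply: (@eig_scalar _ _ (fun x => P i x = x)); last exact: h.
  by move=> x y hx hy; rewrite bsaDr hx hy.
have [b hb'] := choice hb; exists b; apply: bsa_ext => x.
rewrite lcE -{1}[x]sP bsa_sumr; apply: eq_bigr => i _.
by rewrite (hb' i _ (pP i x)).
Qed.

Lemma lcZ t a : lc P (fun i => t * a i) = t *: lc P a.
Proof. by rewrite /lc scaler_sumr; apply: eq_bigr => i _; rewrite scalerA. Qed.

Hypothesis nzP : forall i, exists2 x, x != 0 & P i x = x.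

Lemma vle_dle a b : vle (lc P a) (lc P b) -> dle a b.
Proof.
move=> /vleP h i j; have [->|ij] := eqVneq i j; first by rewrite !subrr.
have [x x0 hx] := nzP i; have [y y0 hy] := nzP j.
pose u := ((nr x)^-1%:C)%C *: x; pose v := ((nr y)^-1%:C)%C *: y.
have Pu : P i u = u by rewrite bsaZr hx.
have Pv : P j v = v by rewrite bsaZr hy.
have uv : inner u v = 0 by rewrite -Pu -Pv bsaS oP // inner0r.
have := h (u + v).
rewrite !(hvar_eig2 uv (unitize x0) (unitize y0) (lc_eig _ Pu) (lc_eig _ Pv)).
by rewrite -[leLHS]real_normK ?num_real // -[leRHS]real_normK ?num_real // ler_sqr ?nnegrE.
Qed.

Lemma vle_lc a b : vle (lc P a) (lc P b) <-> dle a b.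
Proof. by split; [apply: vle_dle | apply: dle_vle]. Qed.

Definition indic (S : pred I) i : R := (S i)%:R.

Lemma indic_proj (S : pred I) : isproj (lc P (indic S)).
Proof.
move=> x; rewrite [LHS]lcE [RHS]lcE; apply: eq_bigr => i _; rewrite P_lc /indic.
by case: (S i); rewrite ?scale1r ?scale0r.
Qed.

Lemma indic_ntproj (S : pred I) i j : S i -> ~~ S j -> ntproj (lc P (indic S)).
Proof.
move=> Si Sj; split; first exact: indic_proj.
  have [x x0 hx] := nzP i; exists x => //.
  by rewrite (lc_eig _ hx) /indic Si scale1r.
have [x x0 hx] := nzP j; exists x => //.
by rewrite (lc_eig _ hx) /indic (negPf Sj) scale0r.
Qed.

Lemma vle_indic (S : pred I) t a : 0 <= t ->
  vle (t *: lc P (indic S)) (lc P a) <->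
  (forall i j, S i -> ~~ S j -> t <= `|a i - a j|).
Proof.
move=> t0; rewrite -lcZ vle_lc /indic; split=> [h i j Si Sj|h i j].
  by have := h i j; rewrite Si (negPf Sj) mulr1 mulr0 subr0 ger0_norm.
case: (boolP (S i)) (boolP (S j)) => Si [] Sj.
- by rewrite subrr normr0.
- by rewrite mulr1 mulr0 subr0 ger0_norm // h.
- by rewrite mulr1 mulr0 sub0r normrN ger0_norm // distrC h.
- by rewrite subrr normr0.
Qed.

Lemma lc_indic1 i : lc P (indic (pred1 i)) = P i.
Proof.
apply: bsa_ext => x; rewrite lcE (bigD1 i) //= /indic /= eqxx scale1r big1 ?addr0 //.
by move=> j /negPf h; rewrite h scale0r.
Qed.

Lemma vle_single i t a : 0 <= t ->
  vle (t *: P i) (lc P a) <-> (forall j, j != i -> t <= `|a i - a j|).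
Proof.
move=> t0; rewrite -{1}(lc_indic1 i) (vle_indic _ _ t0); split=> h j.
  by move=> ji; apply: h => //=.
by move=> k /eqP -> ki; apply: h.
Qed.

Lemma ntproj_single i j : i != j -> ntproj (P i).
Proof.
by move=> ij; rewrite -(lc_indic1 i); apply: (@indic_ntproj _ i j); rewrite /= ?eqxx // eq_sym.
Qed.

End OneResolution.

Section Amplitudes.
Variables f g : bsa H -> bsa H.
Hypothesis fg : eig_iso f g.

Let fE A B : vle A B <-> vle (f A) (f B).
Proof. by case: fg => -[_ _ h] _; exact: h. Qed.
Let fK : cancel f g. Proof. by case: fg => -[]. Qed.
Let gK : cancel g f. Proof. by case: fg => -[]. Qed.

Lemma eig_iso_lc (I : finType) (P : I -> bsa H) a : resolution P ->
  exists b, f (lc P a) = lc P b.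
Proof.
move=> rP; apply: (eigv_lc rP) => i x hx; apply: ((proj2 fg) _ _).1.
by exists (a i); rewrite (lc_eig rP a hx).
Qed.

(** [f (s *: F)] keeps the range and the kernel of [F] as spaces of eigenvectors, so it has at most
    two levels there; were these equal, [s *: F] would be a bottom element. *)
Lemma amplitude F s : ntproj F -> 0 < s ->
  exists2 u, 0 < u & veq (f (s *: F)) (u *: F).
Proof.
move=> nF s0; have [pF _ _] := nF.
have [||a [b E]] := @eigv_two _ _ (f (s *: F)) F pF.
- move=> x hx; apply: ((proj2 fg) _ _).1; exists s; by rewrite bsaZE hx.
- move=> x hx; apply: ((proj2 fg) _ _).1; exists 0.
  by rewrite bsaZE hx scaler0 scale0r.
have v : veq (f (s *: F)) (`|a - b| *: F) by rewrite E; apply: veq_two.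
exists `|a - b| => //; rewrite lt_def normr_ge0 andbT; apply/eqP => ab.
rewrite ab scale0r in v; apply: (ntproj_not0 nF s0); apply: (fE _ _).2.
by apply: vle_trans (proj1 v) _; apply/vleP => x; rewrite hvar0 hvar_ge0.
Qed.

Section ThreeBlocks.
Variables (I : finType) (P : I -> bsa H) (i j k : I).
Hypothesis rP : resolution P.
Hypothesis nzP : forall i, exists2 x, x != 0 & P i x = x.
Hypotheses (ij : i != j) (ik : i != k) (jk : j != k).
Hypothesis all3 : forall l, [\/ l = i, l = j | l = k].

Let pos (a b c : R) l := if l == i then a else if l == j then b else c.
Let posi a b c : pos a b c i = a. Proof. by rewrite /pos eqxx. Qed.
Let posj a b c : pos a b c j = b.
Proof. by rewrite /pos eq_sym (negPf ij) eqxx. Qed.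
Let posk a b c : pos a b c k = c.
Proof. by rewrite /pos eq_sym (negPf ik) eq_sym (negPf jk). Qed.

Let vle_i t a : 0 <= t -> vle (t *: P i) (lc P a) <->
  t <= `|a i - a j| /\ t <= `|a i - a k|.
Proof.
move=> t0; rewrite (vle_single rP nzP _ _ t0); split=> [h|[h1 h2] l].
  by split; apply: h; rewrite eq_sym.
by case: (all3 l) => ->; rewrite ?eqxx.
Qed.
Let vle_j t a : 0 <= t -> vle (t *: P j) (lc P a) <->
  t <= `|a j - a i| /\ t <= `|a j - a k|.
Proof.
move=> t0; rewrite (vle_single rP nzP _ _ t0); split=> [h|[h1 h2] l].
  by split; apply: h; rewrite // eq_sym.
by case: (all3 l) => ->; rewrite ?eqxx.
Qed.
Let vle_k t a : 0 <= t -> vle (t *: P k) (lc P a) <->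
  t <= `|a k - a i| /\ t <= `|a k - a j|.
Proof.
move=> t0; rewrite (vle_single rP nzP _ _ t0); split=> [h|[h1 h2] l].
  by split; apply: h.
by case: (all3 l) => ->; rewrite ?eqxx.
Qed.
Let dle3 a b : `|a i - a j| <= `|b i - b j| -> `|a i - a k| <= `|b i - b k| ->
  `|a j - a k| <= `|b j - b k| -> vle (lc P a) (lc P b).
Proof.
move=> h1 h2 h3; apply/(vle_lc rP nzP) => l m.
case: (all3 l) => ->; case: (all3 m) => ->; rewrite ?subrr //;
  by rewrite distrC [leRHS]distrC.
Qed.

(* The bound holds because any upper bound of [s P_i] and [s P_k] is above
   [s P_j]. *)
Lemma amplitude_le (s ui uj uk : R) : 0 < s -> 0 < ui -> 0 < uj -> 0 < uk ->
  veq (f (s *: P i)) (ui *: P i) -> veq (f (s *: P j)) (uj *: P j) ->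
  veq (f (s *: P k)) (uk *: P k) -> uj <= ui.
Proof.
move=> s0 ui0 uj0 uk0 hi hj hk.
(* An upper bound of both images in which the gap between [i] and [j] is exactly [ui]. *)
pose X := lc P (pos 0 ui (ui + uk)).
have Xi : vle (ui *: P i) X.
  apply/(vle_i _ (ltW ui0)); rewrite posi posj posk !sub0r !normrN.
  by rewrite !gtr0_norm; do ?split; lra.
have Xk : vle (uk *: P k) X.
  apply/(vle_k _ (ltW uk0)); rewrite posi posj posk subr0 [ui + uk]addrC addrK.
  by rewrite !gtr0_norm; do ?split; lra.
have [x hx] : exists x : I -> R, g X = lc P x.
  have := eig_iso_sym fg => gf; apply: (eigv_lc rP) => l y hy.
  apply: ((proj2 gf) _ _).1; eexists; exact: lc_eig hy.
have back F (u : R) : veq (f (s *: F)) (u *: F) -> vle (u *: F) X -> vle (s *: F) (lc P x).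
  move=> h hX; apply: (fE _ _).2; rewrite -hx gK.
  exact: vle_trans (proj1 h) hX.
have [h1 h2] := (vle_i _ (ltW s0)).1 (back _ _ hi Xi).
have [h3 h4] := (vle_k _ (ltW s0)).1 (back _ _ hk Xk).
have hXj : vle (s *: P j) (lc P x).
  by apply/(vle_j _ (ltW s0)); split; rewrite distrC.
have := (fE _ _).1 hXj; rewrite -hx gK => hj'.
have [] := (vle_j _ (ltW uj0)).1 (vle_trans (proj2 hj) hj').
by rewrite posi posj subr0 ger0_norm // ltW.
Qed.

(* With [q = s + t] and [Z] the operator with [P_i] in the middle and gaps [s]
   to [P_j] and [t] to [P_k], every upper bound of [s P_i] and [q P_k] is above
   [Z]; this fails for every upper bound [Z] of [s P_i] and [t P_k] when
   [q < s + t]. *)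
Lemma amplitude_superadd (h : R -> R) s t : 0 < s -> s <= t ->
  (forall u, 0 < u -> 0 < h u) ->
  (forall u F, 0 < u -> ntproj F -> veq (f (u *: F)) (h u *: F)) ->
  h s + h t <= h (s + t).
Proof.
move=> s0 st h0 hF; have t0 : 0 < t := lt_le_trans s0 st.
have q0 : 0 < s + t by rewrite addr_gt0.
have nPi := ntproj_single rP nzP ij.
have nPk : ntproj (P k) by apply: (ntproj_single rP nzP); rewrite eq_sym; exact: ik.
have mono u v : 0 < u -> u <= v -> h u <= h v.
  move=> u0 uv; have v0 := lt_le_trans u0 uv.
  apply/(ntproj_le nPi (ltW (h0 _ u0)) (ltW (h0 _ v0))).
  apply: vle_trans (proj2 (hF _ _ u0 nPi)) _; apply: vle_trans (proj1 (hF _ _ v0 nPi)).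
  apply: (fE _ _).1; exact: vle_scale2 (ltW u0) uv.
pose Z := lc P (pos 0 (- s) t).
have Zi : vle (s *: P i) Z.
  apply/(vle_i _ (ltW s0)); rewrite posi posj posk !sub0r opprK normrN.
  by rewrite !gtr0_norm; do ?split; lra.
have Zk : vle (t *: P k) Z.
  apply/(vle_k _ (ltW t0)); rewrite posi posj posk subr0 opprK.
  by rewrite !gtr0_norm; do ?split; lra.
have Zlow (x : I -> R) : vle (s *: P i) (lc P x) -> vle ((s + t) *: P k) (lc P x) ->
    vle Z (lc P x).
  move=> /(vle_i _ (ltW s0))[a1 a2] /(vle_k _ (ltW q0))[a3 a4].
  apply: dle3; rewrite ?posi ?posj ?posk.
  - by rewrite sub0r opprK gtr0_norm.
  - rewrite sub0r normrN gtr0_norm // distrC (le_trans _ a3) // lerDr ltW //.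
  - by rewrite -opprD normrN gtr0_norm // distrC.
have [b hb] := eig_iso_lc (pos 0 (- s) t) rP; rewrite -/Z in hb.
set s' := h s; set t' := h t; set q' := h (s + t).
have s'0 : 0 < s' by exact: h0.
have t'0 : 0 < t' by exact: h0.
have q'0 : 0 < q' by exact: h0.
have st' : s' <= t' by exact: mono.
have sq' : s' <= q' by apply: mono => //; rewrite lerDl ltW.
have up (x : I -> R) : vle (s' *: P i) (lc P x) -> vle (q' *: P k) (lc P x) ->
    vle (lc P b) (lc P x).
  move=> hi hk; have gf := eig_iso_sym fg.
  have [y hy] : exists y : I -> R, g (lc P x) = lc P y.
    apply: (eigv_lc rP) => l z hz; apply: ((proj2 gf) _ _).1.
    by eexists; exact: (lc_eig rP _ hz).
  rewrite -hb -[lc P x]gK hy; apply: (fE _ _).1; apply: Zlow.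
    apply: (fE _ _).2; rewrite -hy gK; exact: vle_trans (proj1 (hF _ _ s0 nPi)) hi.
  apply: (fE _ _).2; rewrite -hy gK; exact: vle_trans (proj1 (hF _ _ q0 nPk)) hk.
have bi : vle (s' *: P i) (lc P b).
  rewrite -hb; apply: vle_trans (proj2 (hF _ _ s0 nPi)) _; exact: (fE _ _).1.
have bk : vle (t' *: P k) (lc P b).
  rewrite -hb; apply: vle_trans (proj2 (hF _ _ t0 nPk)) _; exact: (fE _ _).1.
have [b1 b2] := (vle_i _ (ltW s'0)).1 bi.
have [b3 b4] := (vle_k _ (ltW t'0)).1 bk.
(* Two upper bounds of the images of [s P_i] and [(s + t) P_k], with the level of [j] on either side
   of that of [i]; the first bounds the gaps [ij] and [ik] of [b], the second the gap [jk]. *)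
have M1 : vle (lc P b) (lc P (pos 0 (- s') q')).
  apply: up.
    apply/(vle_i _ (ltW s'0)); rewrite posi posj posk !sub0r opprK normrN.
    by rewrite !gtr0_norm; do ?split; lra.
  apply/(vle_k _ (ltW q'0)); rewrite posi posj posk subr0 opprK.
  by rewrite !gtr0_norm; do ?split; lra.
have M2 : vle (lc P b) (lc P (pos 0 s' (s' + q'))).
  apply: up.
    apply/(vle_i _ (ltW s'0)); rewrite posi posj posk !sub0r !normrN.
    by rewrite !gtr0_norm; do ?split; lra.
  apply/(vle_k _ (ltW q'0)); rewrite posi posj posk subr0 [s' + q']addrC addrK.
  by rewrite !gtr0_norm; do ?split; lra.
have := (vle_lc rP nzP _ _).1 M1 i j; rewrite posi posj sub0r opprK (gtr0_norm s'0) => c1.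
have := (vle_lc rP nzP _ _).1 M1 k i; rewrite posi posk subr0 (gtr0_norm q'0) => c2.
have := (vle_lc rP nzP _ _).1 M2 k j; rewrite posj posk [s' + q']addrC addrK (gtr0_norm q'0) => c3.
exact: (gap_bound s'0 st' b1 b3 b4 c1 c2 c3).
Qed.
End ThreeBlocks.
End Amplitudes.
End Resolutions.

(** * One scale for all projections *)

Section Scale.
Variables (R : realType) (H : hilbertType R).
Implicit Types (x y z : H) (t s r : R) (A B C E F : bsa H).
Hypothesis dim3 : forall x y : H, exists z, [/\ z != 0, inner z x = 0 & inner z y = 0].

Section OneIso.
Variables f g : bsa H -> bsa H.
Hypothesis fg : eig_iso f g.

Definition three E F (i : 'I_3) : bsa H :=
  if i == 0 :> nat then E else if i == 1%N :> nat then F else bsa_one H - E - F.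

Section Three.
Variables E F : bsa H.
Hypotheses (pE : isproj E) (pF : isproj F).
Hypotheses (EF : forall x, E (F x) = 0) (FE : forall x, F (E x) = 0).
Hypothesis E0 : exists2 x, x != 0 & E x = x.
Hypothesis F0 : exists2 x, x != 0 & F x = x.
Hypothesis G0 : exists2 x, x != 0 & (E x = 0 /\ F x = 0).

Let i0 : 'I_3 := ord0.
Let i1 : 'I_3 := inord 1.
Let i2 : 'I_3 := ord_max.

Let ordP (l : 'I_3) : [\/ l = i0, l = i1 | l = i2].
Proof.
case: l => -[|[|[|//]]] h; [constructor 1 | constructor 2 | constructor 3];
  by apply: val_inj; rewrite /= ?inordK.
Qed.
Let P0 : three E F i0 = E. Proof. by []. Qed.
Let P1 : three E F i1 = F. Proof. by rewrite /three inordK. Qed.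
Let P2 : three E F i2 = bsa_one H - E - F. Proof. by []. Qed.

Lemma three_resolution : resolution (three E F).
Proof.
split.
- move=> l x; case: (ordP l) => ->; rewrite ?P0 ?P1 ?P2 //.
  by rewrite !(bsaBE, bsa_oneE, bsaBr) pE pF EF FE !(subr0, subrr).
- move=> l m x; case: (ordP l) => ->; case: (ordP m) => ->;
    rewrite ?P0 ?P1 ?P2 ?eqxx // => _.
  + by rewrite !(bsaBE, bsa_oneE, bsaBr) pE EF !(subr0, subrr).
  + by rewrite !(bsaBE, bsa_oneE, bsaBr) pF FE !(subr0, subrr).
  + by rewrite !(bsaBE, bsa_oneE, bsaBr) pE FE !(subr0, subrr).
  + by rewrite !(bsaBE, bsa_oneE, bsaBr) pF EF !(subr0, subrr).
- move=> x; rewrite !big_ord_recl big_ord0 addr0.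
  rewrite (_ : lift ord0 ord0 = i1); last by apply: val_inj; rewrite /= inordK.
  rewrite (_ : lift ord0 _ = i2); last exact: val_inj.
  by rewrite P0 P1 P2 !bsaBE bsa_oneE addrA [LHS]addrC -[x - _ - _]addrA -opprD subrK.
Qed.

Lemma amplitude_eq s u v : 0 < s -> 0 < u -> 0 < v ->
  veq (f (s *: E)) (u *: E) -> veq (f (s *: F)) (v *: F) -> u = v.
Proof.
move=> s0 u0 v0 hE hF; have rP := three_resolution.
have nz l : exists2 x, x != 0 & three E F l x = x.
  case: (ordP l) => ->; rewrite ?P0 ?P1 ?P2 //.
  have [x x0 [h1 h2]] := G0; exists x => //.
  by rewrite !bsaBE bsa_oneE h1 h2 !subr0.
have d01 : i0 != i1 by rewrite -(inj_eq val_inj) /= inordK.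
have d02 : i0 != i2 by [].
have d12 : i1 != i2 by rewrite -(inj_eq val_inj) /= inordK.
have n2 := ntproj_single rP nz (_ : i2 != i0).
rewrite eq_sym in n2; have [w w0 hw] := amplitude fg (n2 d02) s0.
apply/le_anti/andP; split.
  apply: (@amplitude_le _ _ _ _ fg _ (three E F) i1 i0 i2 rP nz _ d12 d02 _ s v u w);
    rewrite ?P0 ?P1 // 1?eq_sym //.
  by move=> l; case: (ordP l) => ->; [constructor 2 | constructor 1 | constructor 3].
apply: (@amplitude_le _ _ _ _ fg _ (three E F) i0 i1 i2 rP nz _ d02 d12 _ s u v w);
  rewrite ?P0 ?P1 //.
Qed.

End Three.

(** Orthogonal lines have equal amplitudes, and any two lines are joined by a third one orthogonal
    to both. A general [F] is reached from a line [y] in its range: if [F] is not [pr y], then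
    [pr y], [1 - F] and the rest form three blocks, and [1 - F] is equivalent to [F]. *)
Lemma common_amplitude : exists h : R -> R, (forall u, 0 < u -> 0 < h u) /\
  forall u F, 0 < u -> ntproj F -> veq (f (u *: F)) (h u *: F).
Proof.
have [x [x0 _ _]] := dim3 0 0; have nx := ntproj_pr dim3 x0.
have ex s : exists u, 0 < s -> 0 < u /\ veq (f (s *: pr x)) (u *: pr x).
  have [s0|s0] := pselect (0 < s); last by exists 0.
  by have [u u0 hu] := amplitude fg nx s0; exists u.
have [h hh] := choice ex; exists h.
have h0 u : 0 < u -> 0 < h u by move=> /hh[].
split=> // s F s0 nF; have [_ hx] := hh _ s0.
have orth y z u : y != 0 -> z != 0 -> inner y z = 0 -> 0 < u ->
    veq (f (s *: pr y)) (u *: pr y) -> veq (f (s *: pr z)) (u *: pr z).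
  move=> y0 z0 yz u0 hy; have [v v0 hz] := amplitude fg (ntproj_pr dim3 z0) s0.
  suff -> : u = v by [].
  apply: (@amplitude_eq (pr y) (pr z) _ _ _ _ _ _ _ s) => //; try exact: pr_proj.
  - by move=> w; rewrite [pr z w]prE bsaZr pr_orth ?scaler0 // innerC0.
  - by move=> w; rewrite [pr y w]prE bsaZr pr_orth ?scaler0.
  - by exists y; rewrite ?pr_self.
  - by exists z; rewrite ?pr_self.
  - have [w [w0 wy wz]] := dim3 y z; exists w => //.
    by rewrite !pr_orth.
have rk y : y != 0 -> veq (f (s *: pr y)) (h s *: pr y).
  move=> y0; have [z [z0 zx zy]] := dim3 x y.
  apply: (orth z y) => //; first exact: h0.
  by apply: (orth x z) => //; [exact: innerC0 | exact: h0].
have [pF [y y0 Fy] [w w0 Fw]] := nF.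
have [h1|] := pselect (forall z, F z = pr y z).
  by rewrite (bsa_ext h1); apply: rk.
case/existsNP => z hz.
have Fpr v : F (pr y v) = pr y v by rewrite prE bsaZr Fy.
have prF v : pr y (F v) = pr y v.
  by rewrite !prE bsaS Fy.
have [v v0 hv] := amplitude fg (ntproj_1B nF) s0.
have [u u0 hu] := amplitude fg nF s0.
have uv : u = v.
  apply: (ntproj_veq nF (ltW u0) (ltW v0)).
  apply: veq_trans (veq_sym hu) _.
  have [fgi _] := fg.
  apply: veq_trans (oiso_veq fgi (veq_sym (veq_1B s F))) _.
  exact: veq_trans hv (veq_1B _ _).
suff -> : h s = u by [].
rewrite uv; have rky := rk _ y0.
apply: (@amplitude_eq (pr y) (bsa_one H - F) _ _ _ _ _ _ _ s) => //.
- exact: pr_proj.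
- exact: isproj_1B.
- by move=> a; rewrite bsaBE bsa_oneE bsaBr prF subrr.
- by move=> a; rewrite bsaBE bsa_oneE Fpr subrr.
- by exists y; rewrite ?pr_self.
- by exists w => //; rewrite bsaBE bsa_oneE Fw subr0.
- exists (F z - pr y z); first by rewrite subr_eq0; exact/eqP.
  by rewrite bsaBr prF pr_proj subrr !bsaBE !bsa_oneE bsaBr pF Fpr subrr.
- exact: h0.
Qed.

Lemma common_amplitude_superadd (h : R -> R) : (forall u, 0 < u -> 0 < h u) ->
  (forall u F, 0 < u -> ntproj F -> veq (f (u *: F)) (h u *: F)) ->
  forall s t, 0 < s -> 0 < t -> h s + h t <= h (s + t).
Proof.
move=> h0 hF.
have [x [x0 _ _]] := dim3 0 0; have [y [y0 yx _]] := dim3 x x.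
have [z [z0 zx zy]] := dim3 x y.
have rP : resolution (three (pr x) (pr y)).
  apply: three_resolution; try exact: pr_proj.
    by move=> w; rewrite [pr y w]prE bsaZr pr_orth ?scaler0.
  by move=> w; rewrite [pr x w]prE bsaZr pr_orth ?scaler0 // innerC0.
have nz l : exists2 w, w != 0 & three (pr x) (pr y) l w = w.
  rewrite /three; case: ifP => _; first by exists x; rewrite ?pr_self.
  case: ifP => _; first by exists y; rewrite ?pr_self.
  by exists z => //; rewrite !bsaBE bsa_oneE !pr_orth // !subr0.
suff wl s t : 0 < s -> s <= t -> h s + h t <= h (s + t).
  move=> s t s0 t0; have [st|/ltW ts] := leP s t; first exact: wl.
  by rewrite addrC [s + t]addrC; apply: wl.
move=> s0 st.
apply: (@amplitude_superadd _ _ _ _ fg _ _ ord0 (inord 1) ord_max rP nz) => //.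
- by rewrite -(inj_eq val_inj) /= inordK.
- by rewrite -(inj_eq val_inj) /= inordK.
case=> -[|[|[|//]]] hl; [constructor 1 | constructor 2 | constructor 3];
  by apply: val_inj; rewrite /= ?inordK.
Qed.
End OneIso.

(** The amplitudes [h] of [f] and [k] of [g] are inverse to each other and both superadditive.
    Superadditivity of [k] is subadditivity of [h], so [h] is additive and hence linear. *)
Lemma eig_iso_scale f g : eig_iso f g -> exists2 al, 0 < al &
  forall u F, 0 < u -> ntproj F -> veq (f (u *: F)) ((al * u) *: F).
Proof.
move=> fg; have gf := eig_iso_sym fg; have [fgi _] := fg; have [gfi _] := gf.
have [fK gK _] := fgi.
have [h [h0 hF]] := common_amplitude fg; have [k [k0 kF]] := common_amplitude gf.
have sh := common_amplitude_superadd fg h0 hF.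
have sk := common_amplitude_superadd gf k0 kF.
have [x [x0 _ _]] := dim3 0 0; have nx := ntproj_pr dim3 x0.
have kh u : 0 < u -> k (h u) = u.
  move=> u0; apply: (ntproj_veq nx) => //; try exact/ltW/k0/h0; try exact: ltW.
  apply: veq_trans (veq_sym (kF _ _ (h0 _ u0) nx)) _.
  by rewrite -[u *: pr x]fK; apply: oiso_veq gfi (veq_sym (hF _ _ u0 nx)).
have hk u : 0 < u -> h (k u) = u.
  move=> u0; apply: (ntproj_veq nx) => //; try exact/ltW/h0/k0; try exact: ltW.
  apply: veq_trans (veq_sym (hF _ _ (k0 _ u0) nx)) _.
  by rewrite -[u *: pr x]gK; apply: oiso_veq fgi (veq_sym (kF _ _ u0 nx)).
have mono u v : 0 < u -> u <= v -> h u <= h v.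
  rewrite le_eqVlt => u0 /orP[/eqP -> //|uv].
  rewrite -[v](subrK u) addrC (le_trans _ (sh _ _ u0 _)) ?subr_gt0 //.
  by rewrite lerDl ltW // h0 // subr_gt0.
have hD s t : 0 < s -> 0 < t -> h (s + t) = h s + h t.
  move=> s0 t0; apply/le_anti; rewrite sh // andbT.
  have p : 0 < h s + h t by rewrite addr_gt0 ?h0.
  rewrite -[leRHS]hk //; apply: mono; first exact: addr_gt0.
  by rewrite -{1}[s]kh // -{1}[t]kh // sk ?h0.
(* [h] is controlled only at positive arguments; the value at [0] is set to [0] to keep
   additivity. *)
pose h' t := if t == 0 then 0 else h t.
have h'E t : 0 < t -> h' t = h t by rewrite /h'; case: eqP => // ->; rewrite ltxx.
have lin : forall t, 0 <= t -> h' t = h' 1 * t.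
  apply: additive_nonneg_linear => [s t|t]; rewrite !le_eqVlt.
    case/orP=> [/eqP <-|s0]; first by rewrite /h' eqxx !add0r.
    case/orP=> [/eqP <-|t0]; first by rewrite {3}/h' eqxx !addr0.
    by rewrite !h'E ?addr_gt0 // hD.
  case/orP=> [/eqP <-|t0]; first by rewrite /h' !eqxx.
  by rewrite h'E // h0 ?orbT.
exists (h 1); first exact: h0.
move=> u F u0 nF; rewrite -(h'E 1) // -lin ?ltW // h'E //; exact: hF.
Qed.

End Scale.

(** * Operators with finitely many levels *)

Section FiniteLevel.
Variables (R : realType) (H : hilbertType R).
Implicit Types (x y z : H) (t s r : R) (A B C E F : bsa H).

Definition rigid_iso (f g : bsa H -> bsa H) := eig_iso f g /\
  forall u F, 0 < u -> ntproj F -> veq (f (u *: F)) (u *: F).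

Lemma rigid_iso_sym f g : rigid_iso f g -> rigid_iso g f.
Proof.
move=> [fg h]; split; first exact: eig_iso_sym.
have [fgi _] := fg; have gfi := oiso_sym fgi; have [fK _ _] := fgi.
move=> u F u0 nF; rewrite -{2}[u *: F]fK; apply: oiso_veq gfi _.
exact/veq_sym/h.
Qed.

(* For a pair [p, q] of levels of [a] at distance [L], every upper bound of
   [lc P a] and of [L E_S], where [E_S] is the spectral projection onto the two
   levels, is above [L E_T], where [E_T] is the one onto the level of [p].  If
   [f (lc P a) = lc P b], the same then holds for [lc P b]; moving the levels
   outside [S] far away gives an upper bound keeping the distance
   [|b p - b q|]. *)
Lemma rigid_iso_le f g (I : finType) (P : I -> bsa H) (a : I -> R) :
  rigid_iso f g -> resolution P -> (forall i, exists2 x, x != 0 & P i x = x) ->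
  vle (lc P a) (f (lc P a)).
Proof.
move=> [fg hf] rP nzP; have gf := eig_iso_sym fg.
have [[fK gK fE] _] := fg.
have [b hb] := eig_iso_lc fg a rP; rewrite hb; apply/(vle_lc rP nzP) => p q.
set L := `|a p - a q|; have L0 : 0 <= L by exact: normr_ge0.
have fix_indic (S : pred I) X : vle (L *: lc P (indic R S)) X <->
    vle (L *: lc P (indic R S)) (f X).
  have [L_0|L_0] := eqVneq L 0.
    by rewrite L_0 !scale0r; split=> _; apply: (botP _).2 (vle_refl _) _.
  have Lp : 0 < L by rewrite lt_def L_0.
  have [/existsP[i Si]|/existsPn nS] := boolP [exists i, S i]; last first.
    have -> : lc P (indic R S) = 0.
      apply: bsa_ext => x; rewrite lcE big1 // => i _.
      by rewrite /indic (negPf (nS i)) scale0r.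
    by rewrite scaler0; split=> _; apply: (botP _).2 (vle_refl _) _.
  have [/existsP[j Sj]|/existsPn nS'] := boolP [exists i, ~~ S i]; last first.
    have -> : lc P (indic R S) = bsa_one H.
      rewrite -(lc1 rP); congr lc; apply/funext => j.
      by have := nS' j; rewrite negbK /indic => ->.
    split=> _; apply: (botP _).2; apply/vleP => x; by rewrite hvar_scalar hvar0.
  have h := hf _ _ Lp (indic_ntproj rP nzP Si Sj).
  by rewrite fE; split; apply: vle_trans; [exact: (proj2 h) | exact: (proj1 h)].
pose S : pred I := fun i => (a i == a p) || (a i == a q).
pose T : pred I := fun i => a i == a p.
have prop (x : I -> R) : vle (lc P a) (lc P x) -> vle (L *: lc P (indic R S)) (lc P x) ->
    vle (L *: lc P (indic R T)) (lc P x).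
  move=> /(vle_lc rP nzP) h1 /(vle_indic rP nzP _ _ L0) h2.
  apply/(vle_indic rP nzP _ _ L0) => i j Ti Tj.
  have [Sj|Sj] := boolP (S j); last by apply: h2 => //; rewrite /S; move: Ti; rewrite /T => ->.
  apply: le_trans (h1 i j); move: Sj; rewrite /S -/(T j) (negPf Tj) /= => /eqP ->.
  by move/eqP: Ti => ->.
(* [N] bounds all gaps of [b]; shifting by [M] then makes every gap across the boundary of [S] at
   least [L + N]. *)
pose N : R := \sum_i \sum_j `|b i - b j|; pose M := L + 2 * N.
have bN i j : `|b i - b j| <= N.
  rewrite /N (bigD1 i) //= (bigD1 j) //= -addrA lerDl addr_ge0 //.
    by apply: sumr_ge0.
  by apply: sumr_ge0 => k _; apply: sumr_ge0.
pose x i := if S i then b i else b i + M.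
have far i j : S i -> ~~ S j -> L + N <= `|x i - x j|.
  move=> Si Sj; rewrite /x Si (negPf Sj); have := bN i j; rewrite ler_norml => /andP[h1 h2].
  rewrite distrC (le_trans _ (ler_norm _)) // /M; lra.
have N0 : 0 <= N by apply: le_trans (bN p p).
have xb : vle (lc P b) (lc P x).
  apply/(vle_lc rP nzP) => i j.
  have [Si|Si] := boolP (S i); have [Sj|Sj] := boolP (S j).
  - by rewrite /x Si Sj.
  - apply: le_trans (far i j Si Sj); have := bN i j; lra.
  - rewrite distrC [leRHS]distrC.
    apply: le_trans (far j i Sj Si); have := bN j i; lra.
  - by rewrite /x (negPf Si) (negPf Sj) opprD addrACA subrr addr0.
have xS : vle (L *: lc P (indic R S)) (lc P x).
  apply/(vle_indic rP nzP _ _ L0) => i j Si Sj.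
  apply: le_trans (far i j Si Sj); lra.
have [y hy] := eig_iso_lc gf x rP.
have ay : vle (lc P a) (lc P y) by rewrite -hy fE gK hb.
have Sy : vle (L *: lc P (indic R S)) (lc P y) by rewrite -hy fix_indic gK.
have := prop _ ay Sy; rewrite -hy fix_indic gK => /(vle_indic rP nzP _ _ L0).
have [apq|apq] := eqVneq (a p) (a q); first by move=> _; rewrite /L apq subrr normr0.
move/(_ p q); rewrite /T eqxx eq_sym apq => /(_ isT isT).
by rewrite /x /S !eqxx orbT.
Qed.

Definition finite_level A := exists (I : finType) (P : I -> bsa H) (a : I -> R),
  [/\ resolution P, forall i, exists2 x, x != 0 & P i x = x & A = lc P a].

(** The inequality of [rigid_iso_le] for [f] and for its inverse shows that the levels keep all
    their distances, and an isometry of a finite set of reals is affine of slope [1] or [-1]. *)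
Lemma rigid_iso_finite_level f g A : rigid_iso f g -> finite_level A ->
  exists c, f A = A + c *: bsa_one H \/ f A = - A + c *: bsa_one H.
Proof.
move=> fg [I [P [a [rP nzP ->]]]]; have gf := rigid_iso_sym fg.
have [[[fK _ fE] _] _] := fg.
have [b hb] := eig_iso_lc (proj1 fg) a rP.
have h1 := rigid_iso_le a fg rP nzP; have h2 := rigid_iso_le b gf rP nzP.
rewrite -hb fK hb in h2; rewrite hb in h1.
have d i j : `|b i - b j| = `|a i - a j|.
  by apply/le_anti; rewrite (vle_dle rP nzP h1) (vle_dle rP nzP h2).
have lcaff (e c : R) : lc P (fun i => e * a i + c) = e *: lc P a + c *: bsa_one H.
  rewrite -lcZ -(lc1 rP) -lcZ /lc -big_split; apply: eq_bigr => i _.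
  by rewrite mulr1 scalerDl.
suff [c [e [ee h]]] : exists c e : R, (e = 1 \/ e = -1) /\ forall i, b i = e * a i + c.
  exists c; rewrite hb (_ : b = fun i => e * a i + c); last exact/funext.
  rewrite lcaff; case: ee => ->; first by left; rewrite scale1r.
  by right; rewrite scaleN1r.
have [[i [j ij]]|no] := pselect (exists i j, a i != a j); last first.
  have ac i j : a i = a j by apply/eqP; apply: contra_notT no => h; exists i, j.
  have bc i j : b i = b j.
    apply/eqP; rewrite -subr_eq0 -normr_eq0 d normr_eq0 subr_eq0; exact/eqP.
  have [i0|no'] := pselect (inhabited I); last first.
    by exists 0, 1; split=> [|i]; [left | case: no'; exists; exact: i].
  case: i0 => i0; exists (b i0 - a i0), 1; split=> [|i]; first by left.
  by rewrite mul1r (ac i i0) (bc i i0) addrC subrK.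
have sq k l : (b k - b l) ^+ 2 = (a k - a l) ^+ 2.
  by rewrite -real_normK ?num_real // d real_normK ?num_real.
have aij : a i - a j != 0 by rewrite subr_eq0.
pose e := (b i - b j) / (a i - a j).
have e2 : e ^+ 2 = 1 by rewrite expr_div_n sq divff // sqrf_eq0.
exists (b i - e * a i), e; split.
  by move/eqP: e2; rewrite sqrf_eq1 => /orP[]/eqP; [left | right].
move=> k; have eE : b i - b j = e * (a i - a j) by rewrite mulfVK.
have s1 := sq k i; have s2 := sq k j; have s3 := sq i j.
(* Polarisation of the three equalities of squares; it shows that the sign [e] taken from one pair
   is right for every level. *)
have s4 : (b k - b i) * (b i - b j) = (a k - a i) * (a i - a j) by lra.
rewrite eE in s4.
have s5 : (b k - b i) * e = a k - a i.
  by apply: (mulIf aij); rewrite -mulrA.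
have s6 : b k - b i = e * (a k - a i) by rewrite -s5 mulrCA -expr2 e2 mulr1.
by rewrite -[LHS](subrK (b i)) s6; ring.
Qed.

Lemma rpe_eig A (p : {poly R}) x r :
  A x = (r%:C)%C *: x -> rpe A p x = ((p.[r])%:C)%C *: x.
Proof. by move=> h; rewrite /rpe (cpe_eig _ h) horner_map. Qed.

Lemma split_finite_level A (s : seq R) : uniq s ->
  (forall x, rpe A (\prod_(a <- s) ('X - a%:P)) x = 0) -> finite_level A.
Proof.
have [n] := ubnP (size s); elim: n s => // n IH s sn us hs.
pose num a : {poly R} := \prod_(b <- rem a s) ('X - b%:P).
have [[a as_ ha]|no] := pselect (exists2 a, a \in s & forall x, rpe A (num a) x = 0).
  apply: (IH (rem a s)) => //; last exact: rem_uniq.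
  rewrite size_rem //; case: (s) as_ sn => //= ? ? _; by rewrite ltnS.
have [s0|s0] := eqVneq s [::].
  have x0 x : x = 0 by have := hs x; rewrite s0 big_nil rpe1.
  exists void, (fun=> 0), (fun=> 0); split; try by case.
    by split; try (by case); move=> x; rewrite [RHS]x0 [LHS]x0.
  by apply: bsa_ext => x; rewrite [LHS]x0 [RHS]x0.
pose L a : {poly R} := ((num a).[a]^-1)%:P * num a.
have numE a b : a \in s -> b \in s -> ((num a).[b] == 0) = (a != b).
  move=> as_ bs; rewrite horner_prod prodf_seq_eq0.
  apply/hasP/idP => [[c]|ab].
    rewrite mem_rem_uniq // !inE => /andP[ca _].
    by rewrite hornerXsubC subr_eq0 => /eqP ->; rewrite eq_sym.
  exists b; last by rewrite hornerXsubC subrr eqxx.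
  by rewrite mem_rem_uniq // !inE eq_sym ab.
have LE a b : a \in s -> b \in s -> (L a).[b] = (a == b)%:R.
  move=> as_ bs; rewrite hornerM hornerC; have := numE a b as_ bs.
  have := numE a a as_ as_; rewrite eqxx /= => /negbT na.
  case: (eqVneq a b) => [<-|_] /=; first by move=> _; rewrite mulVf.
  by move=> h; have /eqP -> : (num a).[b] == 0; rewrite ?h ?mulr0.
have vs (a : seq_sub s) : val a \in s by exact: ssvalP.
pose P (a : seq_sub s) := bsa_poly A (L (val a)).
have AP a x : A (P a x) = ((val a)%:C)%C *: P a x.
  apply/eqP; rewrite -subr_eq0; apply/eqP.
  have -> : A (P a x) - ((val a)%:C)%C *: P a x = rpe A (('X - (val a)%:P) * L (val a)) x.
    by rewrite rpeM rpeB rpeX rpeC.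
  have -> : ('X - (val a)%:P) * L (val a) =
      ((num (val a)).[val a]^-1)%:P * \prod_(b <- s) ('X - b%:P).
    by rewrite /L mulrCA [in RHS](big_rem (val a)) ?vs.
  by rewrite rpeM hs -bsa_polyE bsa0r.
have PP a b x : P b (P a x) = if a == b then P a x else 0.
  rewrite {1}/P bsa_polyE (rpe_eig _ (AP a x)) LE ?vs // (inj_eq val_inj) eq_sym.
  by case: eqP => _; rewrite ?scale1r ?scale0r.
have sumL : \sum_(a : seq_sub s) L (val a) = 1.
  apply/eqP; rewrite -subr_eq0; apply/eqP; apply: (@roots_geq_poly_eq0 _ _ s) => //.
    apply/allP => b bs; rewrite /root hornerD hornerN hornerC horner_sum.
    rewrite (bigD1 (SeqSub bs)) //= LE // eqxx big1 ?addr0 ?subrr // => a ab.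
    by rewrite LE ?vs // -[b]/(val (SeqSub bs)) (inj_eq val_inj) (negPf ab).
  rewrite (leq_trans (size_polyD _ _)) // geq_max size_polyN size_poly1.
  rewrite lt0n size_eq0 s0 andbT (leq_trans (size_sum _ _ _)) //.
  apply/bigmax_leqP => a _; rewrite /L mul_polyC (leq_trans (size_scale_leq _ _)) //.
  rewrite size_prod_XsubC size_rem ?vs //.
  by case: (s) s0.
exists (seq_sub s), P, val; split.
- split=> [a x|a b x ab|x].
  + by rewrite PP eqxx.
  + by rewrite PP eq_sym (negPf ab).
  + rewrite -[RHS](rpe1 A) -sumL rpe_sum //.
- move=> a; apply: contrapT => nz; apply: no; exists (val a); first exact: vs.
  move=> x; have := PP a a x; rewrite eqxx => hP.
  have [Px|Px] := eqVneq (P a x) 0; last by case: nz; exists (P a x).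
  have nz0 : (num (val a)).[val a] != 0 by rewrite numE ?vs ?eqxx.
  have -> : num (val a) = ((num (val a)).[val a])%:P * L (val a).
    by rewrite mulrA -polyCM divff // mul1r.
  by rewrite rpeM -[rpe A (L _) x]/(P a x) Px -bsa_polyE bsa0r.
- apply: bsa_ext => x; rewrite lcE -[x in LHS](rpe1 A) -sumL rpe_sum bsa_sumr.
  by apply: eq_bigr => a _; rewrite -AP.
Qed.

End FiniteLevel.

(** * Finite spectrum, finite dimension and separability *)

Section Dimension.
Variables (R : realType) (H : hilbertType R).
Implicit Types (x y z : H) (t s r : R) (A B : bsa H) (E : set H).

(** The product over the spectrum annihilates [A]: otherwise [spectral_avoid] gives an approximate
    eigenvalue outside the spectrum, and there the inverse would be unbounded. *)
Lemma finite_spectrum_finite_level A : finite_set (spectrum A) -> finite_level A.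
Proof.
move=> /finite_seqP[l hl].
pose s := undup (map (@complex.Re R) l).
apply: (@split_finite_level _ _ A s); first exact: undup_uniq.
move=> x; apply/eqP/negPn/negP => /spectral_avoid[r rs hr].
move/negP: rs; apply; rewrite mem_undup; apply/mapP.
exists (r%:C)%C => //.
have : spectrum A (r%:C)%C; last by rewrite hl.
move=> [B [[linB [M hM]] BK _]].
have M1 : 0 < `|M| + 1 by rewrite ltr_wpDl.
have [|u u1 hu] := hr (`|M| + 1)^-1 _; first by rewrite invr_gt0.
have hB v : nr (B v) <= M * nr v by have := hM v; rewrite !nrE -rmorphM lecR.
have := hB (A u - (r%:C)%C *: u); rewrite BK u1 leNgt => /negP; apply.
apply: le_lt_trans (_ : `|M| * (`|M| + 1)^-1 < 1).
  apply: le_trans (ler_wpM2r (nr_ge0 _) (ler_norm M)) _.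
  by rewrite ler_wpM2l.
by rewrite ltr_pdivrMr // mul1r ltrDl.
Qed.

Lemma cpe_bounded A (p : {poly R[i]}) :
  exists2 M : R, 0 <= M & forall x, nr (cpe A p x) <= M * nr x.
Proof.
elim/poly_ind: p => [|p c [M M0 hM]].
  by exists 0 => // x; rewrite cpe0 nr0 mul0r.
have [N N0 hN] := bsa_bound A.
exists (N * M + complex.Re `|c|).
  by rewrite addr_ge0 ?Re_norm_ge0 // mulr_ge0 // ltW.
move=> x; rewrite cpeD cpeXr cpeC (le_trans (nr_triangle _ _)) // mulrDl nrCZ.
rewrite lerD2r (le_trans (hN _)) // -mulrA ler_pM2l //.
Qed.

(** Every approximate eigenvalue [r] is a root of [p]: writing [p - p(r) = q ('X - r)], the vector
    [p(r) u = - q(A) (A - r) u] is arbitrarily small. So the real parts of the roots form a list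
    that [spectral_avoid] cannot leave. *)
Lemma annihilated_finite_level A (p : {poly R[i]}) : p != 0 ->
  (forall x, cpe A p x = 0) -> finite_level A.
Proof.
move=> p0 hp; have [rs pE] := closed_field_poly_normal p.
pose s := undup (map (@complex.Re R) rs).
apply: (@split_finite_level _ _ A s); first exact: undup_uniq.
move=> x; apply/eqP/negPn/negP => /spectral_avoid[r rs' hr].
move/negP: rs'; apply; rewrite mem_undup; apply/mapP; exists (r%:C)%C => //.
have : root p (r%:C)%C.
  rewrite /root; apply/negPn/negP => pr0.
  have /factor_theorem[q qE] : root (p - (p.[(r%:C)%C])%:P) (r%:C)%C.
    by rewrite /root hornerD hornerN hornerC subrr.
  have [M M0 hM] := cpe_bounded A q.
  have n0 : 0 < complex.Re `|p.[(r%:C)%C]|.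
    by rewrite lt_def Re_norm_ge0 andbT -(inj_eq (@complexI R)) -Re_ge0C ?normr_ge0 // normr_eq0.
  set d := complex.Re _ in n0.
  have [|u u1 hu] := hr (d / (M + 1) / 2).
    by rewrite !divr_gt0 // ltr_wpDl.
  have E : cpe A q (A u - (r%:C)%C *: u) = - (p.[(r%:C)%C] *: u).
    have -> : A u - (r%:C)%C *: u = cpe A ('X - ((r%:C)%C)%:P) u.
      by rewrite cpeD cpeX -polyCN cpeC scaleNr.
    by rewrite -cpeM -qE cpeD hp -polyCN cpeC scaleNr add0r.
  have := hM (A u - (r%:C)%C *: u); rewrite E nrN nrCZ u1 mulr1 -/d.
  apply/negP; rewrite -ltNge.
  apply: le_lt_trans (_ : M * (d / (M + 1) / 2) < d).
    by rewrite ler_wpM2l.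
  have M1 : 0 < M + 1 by rewrite ltr_wpDl.
  rewrite mulrA ltr_pdivrMr // mulrA ltr_pdivrMr //; nra.
by rewrite pE rootZ ?lead_coef_eq0 // root_prod_XsubC.
Qed.

Lemma inner_sumr (I : eqType) (l : seq I) (F : I -> H) x :
  inner x (\sum_(i <- l) F i) = \sum_(i <- l) inner x (F i).
Proof.
elim/big_rec2: _ => [|i s y _ <-]; first by rewrite inner0r.
by rewrite innerDr.
Qed.

Lemma inner_suml (I : eqType) (l : seq I) (F : I -> H) x :
  inner (\sum_(i <- l) F i) x = \sum_(i <- l) inner (F i) x.
Proof.
elim/big_rec2: _ => [|i s y _ <-]; first by rewrite inner0l.
by rewrite innerDl.
Qed.

Lemma orthonormal_basis_total E x : orthonormal_basis E ->
  (forall e, E e -> inner x e = 0) -> x = 0.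
Proof.
move=> [oE cE] h; apply/eqP/negPn/negP => x0.
have n0 : 0 < nr x by rewrite nr_gt0.
have : closure (linear_span E) x by rewrite cE.
move=> /(_ (ball x ((nr x)%:C)%C)) [|y [[n [e [c [Ee yE]]]]]].
  by apply: nbhsx_ballx; rewrite ltcR.
rewrite -ball_normE /= nrE ltcR => hy.
have xy : inner x y = 0.
  rewrite yE inner_sumr big1 // => i _.
  by rewrite innerZr h ?mulr0.
have := rip_CS x (x - y); rewrite ripBr {2}/rip xy subr0 ripxx.
rewrite ger0_norm ?sqr_ge0 // expr2 ler_pM2l // leNgt.
by rewrite hy.
Qed.

(** Cayley-Hamilton for the matrix of [A] in the basis; vectors are rows, so [A] acts by
    multiplication by [M] on the right. *)
Lemma finite_dim_finite_level (E : set H) A : orthonormal_basis E -> finite_set E ->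
  finite_level A.
Proof.
move=> hE /finite_seqP[l0 hl0]; have [oE _] := hE.
pose l := undup l0; have ul : uniq l by exact: undup_uniq.
have El e : E e <-> e \in l by rewrite hl0 /l mem_undup.
have [s0|] := eqVneq (size l) 0%N.
  apply: (@split_finite_level _ _ A [::]) => // x.
  rewrite big_nil rpe1; apply: (orthonormal_basis_total hE) => e /El.
  by rewrite (size0nil s0).
case sl : (size l) => [//|n] _.
pose e (i : 'I_n.+1) := nth 0 l i.
have Ee i : E (e i) by apply/El; rewrite mem_nth // sl.
have ee i j : inner (e i) (e j) = (i == j)%:R.
  by rewrite oE // /e nth_uniq ?sl.
have dec x : x = \sum_i inner x (e i) *: e i.
  apply/eqP; rewrite -subr_eq0; apply/eqP/(orthonormal_basis_total hE) => v /El vl.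
  have hi : (index v l < n.+1)%N by rewrite -sl index_mem.
  have -> : v = e (Ordinal hi) by rewrite /e /= nth_index.
  rewrite innerBl inner_suml (bigD1 (Ordinal hi)) //= innerZl ee eqxx mulr1.
  rewrite big1 ?addr0 ?subrr // => j jn.
  by rewrite innerZl ee (negPf jn) mulr0.
pose M : 'M[R[i]]_n.+1 := \matrix_(i, j) inner (A (e i)) (e j).
pose phi (v : 'rV[R[i]]_n.+1) := \sum_i v 0 i *: e i.
have Aphi v : A (phi v) = phi (v *m M).
  rewrite /phi bsa_sumr.
  transitivity (\sum_i \sum_j (v 0 i * M i j) *: e j).
    apply: eq_bigr => i _; rewrite bsaZr {1}[A (e i)]dec scaler_sumr.
    by apply: eq_bigr => j _; rewrite scalerA mxE.
  rewrite exchange_big; apply: eq_bigr => j _.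
  by rewrite mxE -scaler_suml.
have pphi p v : cpe A p (phi v) = phi (v *m horner_mx M p).
  elim/poly_ind: p => [|p c IH].
    rewrite cpe0 rmorph0 mulmx0 /phi big1 // => i _; by rewrite mxE scale0r.
  rewrite cpeD cpeXr cpeC IH Aphi rmorphD rmorphM /= horner_mx_X horner_mx_C.
  rewrite mulmxDr mulmxA mul_mx_scalar /phi scaler_sumr -big_split.
  by apply: eq_bigr => i _; rewrite !mxE scalerDl scalerA.
apply: (@annihilated_finite_level A (char_poly M)).
  exact/monic_neq0/char_poly_monic.
move=> x; have -> : x = phi (\row_i inner x (e i)).
  by rewrite {1}[x]dec; apply: eq_bigr => i _; rewrite mxE.
rewrite pphi Cayley_Hamilton mulmx0 /phi big1 // => i _; by rewrite mxE scale0r.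
Qed.

(** Among the combinations of three orthonormal vectors, two linear conditions leave a nonzero
    solution. *)
Lemma dim_ge3_orth : dim_ge H 3 ->
  forall x y, exists z, [/\ z != 0, inner z x = 0 & inner z y = 0].
Proof.
move=> [E [[oE _] /card_leP[f]]] x y.
have h3 (i : 'I_3) : `I_3 i by exact: ltn_ord.
have [e [Ee ee]] : exists e : 'I_3 -> H, (forall i, E (e i)) /\
    forall i j, inner (e i) (e j) = (i == j)%:R.
  pose e (i : 'I_3) : H := val (f (SigSub (mem_set (h3 i)))).
  have Ee i : E (e i) by apply/set_mem; apply: valP.
  exists e; split=> // i j; rewrite oE //; congr (_%:R); congr nat_of_bool.
  apply/eqP/eqP => [h|-> //].
  have := @inj _ _ _ f _ _ (mem_set I) (mem_set I) (val_inj h).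
  by case=> ij; apply: val_inj.
pose N : 'M[R[i]]_(3, 2) := \matrix_(i, j) (if j == ord0 then inner (e i) x else inner (e i) y).
have : kermx N != 0.
  rewrite kermx_eq0 /row_free; apply/eqP => h.
  by have := rank_leq_col N; rewrite h.
case/rowV0Pn => v /sub_kermxP vN v0.
pose z := \sum_i v 0 i *: e i.
have zk w (j : 'I_2) : (forall i, N i j = inner (e i) w) -> inner z w = 0.
  move=> hw; have := congr1 (fun K : 'M[R[i]]_(1, 2) => K 0 j) vN; rewrite !mxE => <-.
  rewrite inner_suml; apply: eq_bigr => i _; by rewrite innerZl hw.
exists z; split.
- apply/eqP => z0; move/eqP: v0; apply; apply/rowP => i; rewrite mxE.
  have : inner z (e i) = 0 by rewrite z0 inner0l.
  rewrite inner_suml (bigD1 i) //= innerZl ee eqxx mulr1 big1 ?addr0 // => j ji.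
  by rewrite innerZl ee (negPf ji) mulr0.
- by apply: (zk x ord0) => i; rewrite mxE.
- by apply: (zk y (lift ord0 ord0)) => i; rewrite mxE.
Qed.

(** Distinct basis vectors are at distance the square root of 2, so points of the countable dense
    set within [1 / 2] of them are distinct. *)
Lemma separable_aleph0 E : separable H -> orthonormal_basis E ->
  ~ finite_set E -> dim_aleph0 H.
Proof.
move=> [S [cS dS]] hE infE; exists E; split=> //; apply: eq_card_nat => //.
have [oE _] := hE.
have near (e : H) : exists s : H, S s /\ nr (e - s) < 2^-1.
  have [|s [hs Ss]] := dS (ball e ((2^-1 : R)%:C)%C) _ (ball_open _ _).
    by exists e; apply: ballxx; rewrite ltcR invr_gt0.
  exists s; split=> //; move: hs; rewrite -ball_normE /= nrE ltcR //.
have [phi hphi] := choice near.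
move/countable_injP: cS => [psi psi_inj].
apply/countable_injP; exists (psi \o phi) => e e' /set_mem Ee /set_mem Ee' /= hpsi.
have [[Se he] [Se' he']] := (hphi e, hphi e').
have pp : phi e = phi e' by apply: psi_inj; rewrite ?inE.
apply/eqP/negPn/negP => ne.
have d1 : nr (e - e') < 1.
  rewrite -(subrK (phi e) e) -addrA {2}pp; apply: le_lt_trans (nr_triangle _ _) _.
  by rewrite -[nr (phi e' - e')]nrN opprB; lra.
have n1 v : E v -> nr v ^+ 2 = 1.
  by move=> Ev; apply: (@complexI R); rewrite -inner_xx oE // eqxx.
have r0 : rip e e' = 0 by rewrite /rip (oE _ _ Ee Ee') (negPf ne).
have := sqnrB e e'; rewrite (n1 _ Ee) (n1 _ Ee') r0 mulr0 subr0 => d2.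
have := nr_ge0 (e - e'); nra.
Qed.

End Dimension.

(** * Closed lines and density in a vector topology *)

Section VectorTopology.
Variables (R : realType) (H : hilbertType R) (T : Topological (bsa H)).
Let X : topologicalType := Topological.Pack T.
Hypothesis vT : vector_topology T.

Let addC : continuous ((fun p => (p.1 : bsa H) + (p.2 : bsa H)) : X * X -> X).
Proof. by case: vT. Qed.
Let scaleC : continuous ((fun p => (p.1 : R) *: (p.2 : bsa H)) : R^o * X -> X).
Proof. by case: vT. Qed.
Let hT : hausdorff_space X. Proof. by case: vT. Qed.

Lemma scale_continuous (r : R) : continuous ((fun A : bsa H => r *: A) : X -> X).
Proof.
move=> A; apply: (@continuous_comp X (R^o * X)%type X (fun A => (r, A))
  (fun p => (p.1 : R) *: (p.2 : bsa H))); last exact: scaleC.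
apply: (@cvg_pair _ _ _ (nbhs A) (nbhs (r : R^o)) (nbhs A) _ _ _ (fun=> r) id).
  exact: cvg_cst.
exact: cvg_id.
Qed.

Lemma scale_continuousl (A : bsa H) : continuous ((fun r : R => r *: A) : R^o -> X).
Proof.
move=> r; apply: (@continuous_comp R^o (R^o * X)%type X (fun r => (r, A))
  (fun p => (p.1 : R) *: (p.2 : bsa H))); last exact: scaleC.
apply: (@cvg_pair _ _ _ (nbhs r) (nbhs (r : R^o)) (nbhs (A : X)) _ _ _ id (fun=> A)).
  exact: cvg_id.
exact: cvg_cst.
Qed.

Lemma add_continuous (F G : X -> X) : continuous F -> continuous G ->
  continuous ((fun A => (F A : bsa H) + (G A : bsa H)) : X -> X).
Proof.
move=> cF cG A; apply: (@continuous_comp X (X * X)%type X (fun A => (F A, G A))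
  (fun p => (p.1 : bsa H) + (p.2 : bsa H))); last exact: addC.
apply: (@cvg_pair _ _ _ (nbhs A) (nbhs (F A)) (nbhs (G A)) _ _ _ F G).
  exact: cF.
exact: cG.
Qed.

(* Near each of its adherent points a line lies in a compact segment. *)
Lemma line_closed (B : bsa H) : closed ([set A | exists r : R, A = r *: B] : set X).
Proof.
have [->|B0] := eqVneq B 0.
  have -> : [set A : bsa H | exists r : R, A = r *: 0] = [set 0].
    by apply/seteqP; split=> A /= [r]; [rewrite scaler0 | exists 0; rewrite scaler0].
  exact: (@accessible_closed_set1 X (hausdorff_accessible hT) (0 : bsa H)).
have nV : nbhs (0 : X) (~` [set (B : X)]).
  apply: open_nbhs_nbhs; split; last by move=> /= h; move/eqP: B0; apply; rewrite -h.
  apply: closed_openC; exact: (@accessible_closed_set1 X (hausdorff_accessible hT) B).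
have [[D W] /= [nD nW] DW] : filter_from (fun P : set R^o * set X => nbhs (0 : R^o) P.1 /\ nbhs (0 : X) P.2)
    (fun P => P.1 `*` P.2) ((fun p => (p.1 : R) *: (p.2 : bsa H)) @^-1` (~` [set (B : X)])).
  have := @scaleC (0, 0); apply; rewrite /= scale0r; exact: nV.
have [d /= d0 hd] := (nbhs_ballP _ _).1 nD.
(* [D] times [W] avoids [B]; if [c] were larger than [1 / d], its inverse would lie in [D] and carry
   [c *: B] to [B]. *)
have small (c : R) : W (c *: B) -> `|c| <= d^-1.
  move=> Wc; have [->|c0] := eqVneq c 0; first by rewrite normr0 invr_ge0 ltW.
  rewrite leNgt; apply/negP => hc.
  have Dc : D c^-1.
    apply: hd; rewrite -ball_normE /= sub0r normrN normfV.
    by rewrite -[d]invrK ltf_pV2 ?posrE ?normr_gt0 ?invr_gt0.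
  by apply: (DW (c^-1, c *: B)) => //=; rewrite scalerA mulVf // scale1r.
move=> Y clY.
(* Scaling by a small [r] brings [Y], and by continuity a neighbourhood of [Y], into [W]; the points
   of the line in it have bounded coefficients. *)
have [r r0 Wr] : exists2 r : R, 0 < r & W° (r *: (Y : bsa H) : X).
  have nW' : nbhs (0 : X) W° by exact: nbhs_interior.
  have := @scale_continuousl (Y : bsa H) 0; rewrite /continuous_at scale0r.
  move=> /(_ _ nW') /(nbhs_ballP _ _)[e /= e0 he].
  exists (e / 2); first by rewrite divr_gt0.
  apply: he; rewrite -ball_normE /= sub0r normrN gtr0_norm ?divr_gt0 //.
  by rewrite ltr_pdivrMr // ltr_pMr // ltr1n.
have nY : nbhs Y ((fun A : bsa H => r *: A : X) @^-1` W°).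
  apply: scale_continuous; apply: open_nbhs_nbhs; split=> //; exact: open_interior.
pose K := d^-1 / r.
pose seg : set X := [set ((c : R) *: B : X) | c in `[- K, K]].
have cseg : closed seg.
  apply: compact_closed => //.
  apply: (@continuous_compact R^o X (fun c : R => c *: B)); last exact: segment_compact.
  by apply: continuous_subspaceT; exact: scale_continuousl.
have [c _ <-] : seg Y.
  apply: cseg => N nN.
  have [_ [[c ->] [Nc Wc]]] := clY _ (filterI nN nY).
  exists (c *: B); split=> //; exists c => //=.
  have := @small (r * c); rewrite -scalerA => /(_ (interior_subset Wc)).
  rewrite normrM gtr0_norm // mulrC -ler_pdivlMr // -/K.
  by rewrite ler_norml in_itv.
by exists c.
Qed.

(** Neither the sign nor [c] is known to depend continuously on [A]. But [F A + A] and [F A - A]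
    each lie in the closed line on a closed set, and the union of the two sets is closed and
    dense. *)
Lemma affine_dense (F : bsa H -> bsa H) (B : bsa H) : continuous (F : X -> X) ->
  dense ([set A : bsa H | exists c, F A = A + c *: B \/ F A = - A + c *: B] : set X) ->
  forall A, exists c, F A = A + c *: B \/ F A = - A + c *: B.
Proof.
move=> cF dF A.
pose line : set X := [set A | exists r : R, A = r *: B].
pose W (e : R) : set X := (fun A : bsa H => F A + e *: A : X) @^-1` line.
have cW e : closed (W e).
  apply: preimage_closed; last exact: line_closed.
  move=> Y _; apply: (@add_continuous (F : X -> X) (fun A : bsa H => e *: A : X)) => //.
  exact: scale_continuous.
have [[c h]|[c h]] : (W 1 `|` W (-1)) A.
- apply: contrapT => nA.
  have oO : open (~` (W 1 `|` W (-1))) by apply: closed_openC; apply: closedU.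
  have [Y [nY [c hc]]] := dF _ (ex_intro _ (A : X) nA) oO.
  apply: nY; case: hc => h; [right | left]; exists c; rewrite h.
    by rewrite scaleN1r addrAC subrr add0r.
  by rewrite scale1r addrAC addNr add0r.
- by exists c; right; move: h => /= <-; rewrite scale1r addrCA addNr addr0.
- by exists c; left; move: h => /= <-; rewrite scaleN1r addrCA subrr addr0.
Qed.
End VectorTopology.

(** * The theorem *)

Section Main.
Variables (R : realType) (H : hilbertType R).

Lemma rigid_iso_veq (f g : bsa H -> bsa H) : separable H -> dim_ge H 3 ->
  rigid_iso f g ->
  (dim_aleph0 H -> exists2 T : Topological (bsa H), vector_topology T &
     let X : topologicalType := Topological.Pack T in
     dense ([set A : bsa H | finite_set (spectrum A)] : set X) /\
     continuous (f : X -> X)) ->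
  forall A, veq (f A) A.
Proof.
move=> sH dH fg cont A.
have aff B c : f B = B + c *: bsa_one H \/ f B = - B + c *: bsa_one H -> veq (f B) B.
  case=> ->; first exact: veq_aff.
  exact: veq_trans (veq_aff _ _) (veq_opp _).
have [E [hE _]] := dH.
have [fE|iE] := pselect (finite_set E).
  have [c hc] := rigid_iso_finite_level fg (finite_dim_finite_level A hE fE).
  exact: aff hc.
have [T vT [dT cT]] := cont (separable_aleph0 sH hE iE).
have [|c hc] := @affine_dense R H T vT f (bsa_one H) cT _ A; last exact: aff hc.
move=> O On oO; have [Y [OY hY]] := dT O On oO; exists Y; split=> //=.
exact: rigid_iso_finite_level fg (finite_spectrum_finite_level hY).
Qed.

End Main.

Theorem theorem2p3 (R : realType) (H : hilbertType R)
  (Hsep : separable H) (Hdim : dim_ge H 3)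
  (Phi : bsa H -> bsa H) (Phi_bij : bijective Phi)
  (Phi_order : forall A B : bsa H, vle B A <-> vle (Phi B) (Phi A))
  (Phi_cont : dim_aleph0 H ->
    exists T : Topological (bsa H),
      let X : topologicalType := Topological.Pack T in
      [/\ ua_invariant_vector_topology T,
          dense ([set A : bsa H | finite_set (spectrum A)] : set X) &
          continuous (Phi : X -> X)]) :
  exists (U : unitary_or_antiunitary H) (alpha : R),
    0 < alpha /\
    forall A : bsa H, Phi @` vclass A = vclass (alpha *: bsa_conj U A).
Proof.
have dim3 := dim_ge3_orth Hdim.
have [Psi PhiK PsiK] := Phi_bij.
have isoPhi : oiso Phi Psi by split.
have [U hU] := oiso_wigner dim3 isoPhi.
(* After this conjugation every line is fixed, so that eigenvectors are preserved. *)
pose f A := bsa_conj (ua_adj U) (Phi A); pose g A := Psi (bsa_conj U A).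
have fg : eig_iso f g.
  apply: oiso_eig; first exact: oiso_conj isoPhi.
  move=> x /hU[t t0 ht]; exists t => //.
  by have := veq_conj (ua_adj U) ht; rewrite bsa_conjZ bsa_conj_pr.
have [al al0 hal] := eig_iso_scale dim3 fg.
have aln : al != 0 by rewrite gt_eqF.
have [[fK gK fE] feig] := fg.
(* Dividing by the common scale makes multiples of projections fixed up to equivalence. *)
pose f' A := al^-1 *: f A; pose g' A := g (al *: A).
have rig : rigid_iso f' g'.
  split; last first.
    move=> u F u0 nF; have := veq_scale al^-1 (hal u F u0 nF).
    by rewrite scalerA mulrA mulVf // mul1r.
  split; first split.
  - by move=> A; rewrite /g' /f' scalerA divff // scale1r fK.
  - by move=> A; rewrite /g' /f' gK scalerA mulVf // scale1r.
  - move=> A B; rewrite fE; split; first exact: vle_scale.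
    by move/(vle_scale al); rewrite /f' !scalerA divff // !scale1r.
  move=> A x; rewrite feig; split=> -[s hs]; rewrite /f'.
    by exists (al^-1 * s); rewrite bsaZE hs scalerA -rmorphM.
  exists (al * s); rewrite rmorphM -scalerA -hs /f' bsaZE scalerA -rmorphM.
  by rewrite divff // scale1r.
have key : forall A, veq (f' A) A.
  apply: rigid_iso_veq Hsep Hdim rig _ => /Phi_cont[T [[vT inv] dT cT]].
  exists T => //; split=> //.
  (* Invariance of the topology is what carries continuity of [Phi] over to [f], since [U] is known
     only after [Phi]. *)
  have [h [_ _ cU _]] := inv U.
  move=> A; apply: (@continuous_comp (Topological.Pack T) (Topological.Pack T)
    (Topological.Pack T) f (fun B => al^-1 *: B)).
    apply: (@continuous_comp (Topological.Pack T) (Topological.Pack T)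
      (Topological.Pack T) Phi (bsa_conj (ua_adj U))); [exact: cT | exact: cU].
  exact: scale_continuous.
exists U, al; split=> // A.
have PhiE : veq (Phi A) (al *: bsa_conj U A).
  have := veq_conj U (veq_scale al (key A)); rewrite /f' scalerA divff // scale1r.
  by rewrite /f bsa_conj_adjK bsa_conjZ.
apply/seteqP; split=> [_ [B [h1 h2] <-]|B [h1 h2]].
  have hB : veq (Phi A) (Phi B) by split; apply: (Phi_order _ _).1.
  have [h3 h4] := veq_trans (veq_sym PhiE) hB.
  by split.
exists (Psi B); last exact: PsiK.
have [h3 h4] := veq_trans PhiE (conj h1 h2).
by split; apply: (Phi_order _ _).2; rewrite PsiK.
Qed.
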